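(* Let $d\in\mathbb N$, $p\in(2-\frac{2}{3d+2},2+\frac2d)$ and set $$q:=p\,\frac{4d+2}{d(p+2)},\qquad r:=p\,\frac{4d+2}{p(3d+2)-2d}.$$ Let $T>0$. There exists $C=C(p,d)>0$ such that for every nonnegative $f\in\mathrm L^2((-\infty,T)\times\mathbb R^{2d})$ with $\nabla_vf\in\mathrm L^p((-\infty,T)\times\mathbb R^{2d})$ which is a weak subsolution of $$(\partial_t+v\cdot\nabla_x)f\le\nabla_v\cdot S_0+S_1\quad\text{in }(-\infty,T)\times\mathbb R^{2d}$$ with $S_0\in\mathrm L^{\frac{p}{p-1}}((-\infty,T)\times\mathbb R^{2d};\mathbb R^d)$ and $S_1\in\mathrm L^r((-\infty,T)\times\mathbb R^{2d})$, we have (all norms on $(-\infty,T)\times\mathbb R^{2d}$) $$\|f\|_{\mathrm L^q}\le C\bigl(\|\nabla_vf\|_{\mathrm L^p}+\|S_0\|_{\mathrm L^{\frac p{p-1}}}+\|S_1\|_{\mathrm L^r}\bigr).$$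
   Context: Weak subsolution means: for every nonnegative $\varphi\in C_c^\infty((-\infty,T)\times\mathbb R^{2d})$, $\int\bigl(-f(\partial_t+v\cdot\nabla_x)\varphi+S_0\cdot\nabla_v\varphi-S_1\varphi\bigr)\,\mathrm d(t,x,v)\le0$. *)

(* Defs.v *)
From HB Require Import structures.
From mathcomp Require Import all_boot all_order all_algebra.
From mathcomp Require Import all_classical all_reals all_analysis.
Set Implicit Arguments. Unset Strict Implicit. Unset Printing Implicit Defensive.
Import Order.TTheory GRing.Theory Num.Theory.
Import numFieldNormedType.Exports.
Local Open Scope classical_set_scope.
Local Open Scope ring_scope.

Section Defs.
Context {R : realType}.

(* Phase space (t, x, v) in R x R^d x R^d, as a normed module. *)
Definition phase (d : nat) := (R * ('rV[R]_d * 'rV[R]_d))%type.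

Definition ebase (d : nat) (i : 'I_d) : 'rV[R]_d := \row_(j < d) (i == j)%:R.

Definition eucl (d : nat) (w : 'rV[R]_d) : R := Num.sqrt (\sum_(i < d) (w ord0 i) ^+ 2).

Definition dir_t (d : nat) : phase d := (1, (0, 0)).
Arguments dir_t : clear implicits.
Definition dir_x (d : nat) (i : 'I_d) : phase d := (0, (ebase i, 0)).
Definition dir_v (d : nat) (i : 'I_d) : phase d := (0, (0, ebase i)).

(* C^k: all iterated directional derivatives of order <= k exist and are
   continuous (equivalent to the usual C^k for finite-dimensional spaces). *)
Fixpoint Ck (d : nat) (k : nat) (phi : phase d -> R) : Prop :=
  match k with
  | 0 => continuous phi
  | k'.+1 => forall u : phase d,
      (forall z, derivable phi z u) /\ Ck k' (fun z => 'D_u phi z)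
  end.

Definition smooth (d : nat) (phi : phase d -> R) : Prop := forall k, Ck k phi.

Definition OmegaT (d : nat) (T : R) : set (phase d) := [set z | z.1 < T].
Arguments OmegaT : clear implicits.

Definition test_fun (d : nat) (T : R) (phi : phase d -> R) : Prop :=
  smooth phi /\
  compact (closure [set z | phi z != 0]) /\
  closure [set z | phi z != 0] `<=` OmegaT d T.

Definition borel_meas (d : nat) (D : set (phase d)) (h : phase d -> R) : Prop :=
  forall B : set R, measurable B -> <<s open >> (D `&` h @^-1` B).

(* Lebesgue integral on R^n as an iterated integral of one-dimensional
   Lebesgue integrals (equal to the integral w.r.t. n-dimensional Lebesgue
   measure for nonnegative or integrable measurable functions, by Fubini-Tonelli) *)
Fixpoint iint (n : nat) : ('rV[R]_n -> \bar R) -> \bar R :=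
  match n return ('rV[R]_n -> \bar R) -> \bar R with
  | 0 => fun g => g 0
  | m.+1 => fun g =>
      (\int[@lebesgue_measure R]_x iint (fun y : 'rV[R]_m => g (row_mx (\row_(_ < 1) x) y)))%E
  end.

Definition Oint (d : nat) (T : R) (h : phase d -> \bar R) : \bar R :=
  (\int[@lebesgue_measure R]_(t in `]-oo, T[)
     iint (fun x : 'rV[R]_d => iint (fun v : 'rV[R]_d => h (t, (x, v)))))%E.

Definition Lpnorm (d : nat) (T p : R) (h : phase d -> R) : \bar R :=
  ((Oint T (fun z => (`|h z| `^ p)%:E)) `^ p^-1)%E.

Definition Lpnorm_vec (d : nat) (T p : R) (h : phase d -> 'rV[R]_d) : \bar R :=
  Lpnorm T p (fun z => eucl (h z)).

Definition inLp (d : nat) (T p : R) (h : phase d -> R) : Prop :=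
  borel_meas (OmegaT d T) h /\ (Lpnorm T p h < +oo)%E.

Definition inLp_vec (d : nat) (T p : R) (h : phase d -> 'rV[R]_d) : Prop :=
  (forall i, borel_meas (OmegaT d T) (fun z => h z ord0 i)) /\
  (Lpnorm_vec T p h < +oo)%E.

Definition weak_grad_v (d : nat) (T : R) (f : phase d -> R)
    (G : phase d -> 'rV[R]_d) : Prop :=
  forall phi, test_fun T phi -> forall i : 'I_d,
    Oint T (fun z => (f z * 'D_(dir_v i) phi z)%:E) =
    (- Oint T (fun z => (G z ord0 i * phi z)%:E))%E.

Definition weak_subsol (d : nat) (T : R) (f : phase d -> R)
    (S0 : phase d -> 'rV[R]_d) (S1 : phase d -> R) : Prop :=
  forall phi, test_fun T phi -> (forall z, 0 <= phi z) ->
    (Oint T (fun z =>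
      (- f z * ('D_(dir_t d) phi z
                + \sum_(i < d) z.2.2 ord0 i * 'D_(dir_x i) phi z)
       + \sum_(i < d) S0 z ord0 i * 'D_(dir_v i) phi z
       - S1 z * phi z)%:E) <= 0)%E.

End Defs.
Arguments OmegaT {R} d T _.

(* Main.v *)
(* Write z0 = (t0, x0, v0), z = (t, x, v), tau = t0 - t, X = x - x0 + tau v0,
   V = v - v0, and let D = d(1 + 2 th) for some 0 < th < 1.  Testing the two weak
   formulations with
     chi(tau) prod_i tau^-(1 + 2 th) rho(X_i / tau^(1 + th)) g(U_i / tau^th),
   where U = V + (1 + th) X / tau is adapted to trajectories curved by a control in v,
   makes every term controllable: the kinetic derivative of each factor is a v_i-derivative,
   so by definition of the weak gradient only grad_v f enters.  This bounds the averages of f at scale eps around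
   z0, uniformly in eps, by a constant times
     T_th |grad_v f| (z0) + T_(1 - th) |S0| (z0) + T_1 |S1| (z0),
   where T_kap F (z0) is the integral of F tau^(kap - 1 - D) over the cylinder
   |X_i| <= 3 tau^(1 + th), |V_i| <= 3 tau^th, tau > 0.  The potential T_kap maps L^P to
   L^q when 1/q = 1/P - kap / (D + 1); the choice
     th = (2 d + 2 - d p) / (p (2 d + 2) - 4 d)
   makes the three target exponents equal to the given q.  The L^q bound passes from the
   averages to f by comparing dyadic level sets. *)

Require Import Defs.
From HB Require Import structures.
From mathcomp Require Import all_boot all_order all_algebra.
From mathcomp Require Import all_classical all_reals all_analysis.
From mathcomp Require Import ring lra.
From mathcomp Require Import measurable_realfun.
Import Order.TTheory GRing.Theory Num.Theory.
Import numFieldNormedType.Exports.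
Local Open Scope classical_set_scope.
Local Open Scope ring_scope.
Set Implicit Arguments.
Unset Strict Implicit.
Unset Printing Implicit Defensive.

(** * Lebesgue measure on phase space *)

(** What forces the curved variable U: if the profile used V instead, the time dependence of X /
    tau^(1 + th) would leave a term (1 + th) X rho'(X) g(V) in the kinetic derivative. Its
    V-integral does not vanish, so it is not a velocity divergence and the gradient in v cannot pay
    for it. In the variables (X, U) this term is absorbed: the scaled X moves at speed U / tau, and
    U times the chosen U-profile is an exact U-derivative. The number th tilts the kinetic scaling;
    th = 1/2 is the diffusive one and occurs at p = 2. Equality of the exponents reached from the
    gradient in L^p with gain th and from S0 in the dual space with gain 1 - th is a linear equation
    in th, and the stated range of p is exactly 0 < th < 1. The cut-off chi lives on eps < tau < M.
    Its rise at scale eps produces the average; its fall at scale M produces an error 1/M times a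
    quantity that is finite because f is in L^2. Letting M tend to infinity removes it, so the L^2
    norm leaves no trace in the constant. *)

Definition BR (R : realType) (n : nat) := g_sigma_algebraType (open : set (set 'rV[R]_n)).

Section borel.
Context {R : realType}.

(** Density makes every open set a countable union of balls centred at points [c i] with radii
    1/(k+1), so only preimages of balls need checking. This is what makes the topological Borel sets
    of the statement measurable for product sigma-algebras. *)
Lemma measurable_preimage_borel dY (Y : measurableType dY)
    (X : pseudoMetricType R) (I : countType) (c : I -> X) (F : Y -> X) :
  (forall x (e : R), 0 < e -> exists i, ball x e (c i)) ->
  (forall i (e : R), 0 < e -> measurable (F @^-1` ball (c i) e)) ->
  forall A, <<s open >> A -> measurable (F @^-1` A).
Proof.
move=> dense mball A.
suff : <<s open >> `<=` [set A | measurable (F @^-1` A)] by exact.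
apply: smallest_sub.
  split => /=.
  - by rewrite preimage_set0.
  - by move=> B mB; rewrite setTD preimage_setC; exact: measurableC.
  - by move=> G mG; rewrite preimage_bigcup; exact: bigcupT_measurable.
move=> U oU /=.
pose P := [set ik : I * nat | ball (c ik.1) ik.2.+1%:R^-1 `<=` U].
have -> : F @^-1` U = \bigcup_(ik in P) F @^-1` (ball (c ik.1) (ik.2.+1%:R^-1 : R)).
  apply/seteqP; split => y.
  - move=> Uy; have := open_nbhs_nbhs (conj oU Uy).
    move=> /nbhs_ballP[e /= e0 eU].
    (* Two radii must fit into e: one from [F y] to the centre [c i], one from the centre to an
       arbitrary point of its ball. *)
    have [k ke] : exists k, (k.+1%:R^-1 : R) + k.+1%:R^-1 < e.
      have e2 : 0 < e / 2 by lra.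
      have [k _ /(_ k (leqnn k)) /= kP] := near_infty_natSinv_lt (PosNum e2).
      by exists k; rewrite [ltRHS]splitr ltrD.
    have k0 : 0 < (k.+1%:R^-1 : R) by rewrite invr_gt0.
    have [i ci] := dense (F y) _ k0.
    exists (i, k); last exact: ball_sym.
    move=> x /= xb; apply: eU.
    by apply: le_ball (ltW ke) _ _; exact: ball_triangle ci xb.
  - by move=> [[i k]] /= PU; exact: PU.
rewrite bigcup_mkcond; apply: countable_bigcupT_measurable => // ik.
case: ifPn => // _; exact: mball.
Qed.

Lemma dense_R (x e : R) : 0 < e -> exists q : rat, ball x e (ratr q).
Proof.
move=> e0; have /rat_in_itvoo[q] : x - e < x + e by lra.
rewrite in_itv /= => /andP[q1 q2]; exists q.
by rewrite /ball /= ltr_distl; apply/andP; split; lra.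
Qed.

Lemma dense_rV n (x : 'rV[R]_n) e : 0 < e ->
  exists q : 'rV[rat]_n, ball x e (\row_j ratr (q ord0 j) : 'rV[R]_n).
Proof.
move=> e0; have /choice[q hq] : forall j, exists q : rat, ball (x ord0 j) e (ratr q).
  by move=> j; exact: dense_R.
exists (\row_j q j); split => // i j; rewrite !mxE (ord1 i); exact: hq.
Qed.

Lemma measurable_rV dY (Y : measurableType dY) n (F : Y -> 'rV[R]_n) :
  (forall j, measurable_fun setT (fun y => F y ord0 j)) ->
  forall A, <<s open >> A -> measurable (F @^-1` A).
Proof.
move=> mF; apply: (@measurable_preimage_borel _ _ 'rV[R]_n 'rV[rat]_n
   (fun q => \row_j ratr (q ord0 j)) F); first by move=> x e; exact: dense_rV.
move=> q e e0.
have -> : F @^-1` ball (\row_j ratr (q ord0 j) : 'rV[R]_n) e =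
    \bigcap_(j in setT) (fun y => F y ord0 j) @^-1` ball (ratr (q ord0 j) : R) e.
  apply/seteqP; split => y /=.
  - by move=> [_ h] j _; have := h ord0 j; rewrite mxE.
  - by move=> h; split => // i j; rewrite (ord1 i) mxE; exact: h.
apply: fin_bigcap_measurable => // j _; rewrite -[X in measurable X]setTI.
by apply: mF => //; rewrite ball_itv; exact: measurable_itv.
Qed.

Lemma measurable_fun_rV dY (Y : measurableType dY) n (F : Y -> BR R n) :
  (forall j, measurable_fun setT (fun y => (F y : 'rV[R]_n) ord0 j)) ->
  measurable_fun setT F.
Proof. by move=> mF _ A mA; rewrite setTI; exact: (measurable_rV mF). Qed.

Lemma measurable_coord n (j : 'I_n) :
  measurable_fun setT (fun y : BR R n => (y : 'rV[R]_n) ord0 j).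
Proof.
apply: (@measurability _ _ _ _ setT _ _ (RGenOpens.measurableE R)).
move=> _ [_ [a [b ->]] <-]; rewrite setTI; apply: sub_sigma_algebra.
have oab : open `]a, b[%classic by exact: interval_open.
exact: open_comp (fun y _ => @coord_continuous R 1 n ord0 j y) oab.
Qed.

End borel.

Section sigma_finite_product.
Context d1 d2 (T1 : measurableType d1) (T2 : measurableType d2) (R : realType).
Variable m1 : {sigma_finite_measure set T1 -> \bar R}.
Variable m2 : {sigma_finite_measure set T2 -> \bar R}.

(* The library's sigma-finite instance on [m1 \x m2] is masked by the one for
   subprobabilities; this alias carries it. *)
Definition prod_measure : set (T1 * T2) -> \bar R := (m1 \x m2)%E.

Let m12 : {measure set (T1 * T2) -> \bar R} := (m1 \x m2)%E.

HB.instance Definition _ := isMeasure.Build _ _ _ prod_measure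
  (@measure0 _ _ _ m12) (@measure_ge0 _ _ _ m12) (@measure_semi_sigma_additive _ _ _ m12).

Let prod_measure_sigma_finite : sigma_finite setT prod_measure.
Proof.
have [F [TF ndF Foo]] := (sigma_finiteP _ _).1 (sigma_finiteT m1).
have [G [TG ndG Goo]] := (sigma_finiteP _ _).1 (sigma_finiteT m2).
exists (fun n => F n `*` G n).
  rewrite -setXTT TF TG predeqE => -[x y]; split.
    move=> [/= [n _ Fnx] [k _ Gky]]; exists (maxn n k) => //; split.
    - by move: x Fnx; exact/subsetPset/ndF/leq_maxl.
    - by move: y Gky; exact/subsetPset/ndG/leq_maxr.
  by move=> [n _ []/= ? ?]; split; exists n.
move=> k; have [? ?] := Foo k; have [? ?] := Goo k.
split; first exact: measurableX.
by rewrite /prod_measure product_measure1E// lte_mul_pinfty// ge0_fin_numE.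
Qed.

HB.instance Definition _ := Measure_isSigmaFinite.Build _ _ _ prod_measure
  prod_measure_sigma_finite.

End sigma_finite_product.

(** * Lebesgue measure in n dimensions, built one coordinate at a time *)

Section rVmeasure.
Context {R : realType}.
Local Notation leb := (@lebesgue_measure R).

(** The concatenation used in the recursive case of [iint], so that pushing a product measure
    forward by it reproduces one step of the iterated integral. *)
Definition consV n (p : measurableTypeR R * BR R n) : BR R n.+1 :=
  row_mx (\row_(_ < 1) (p.1 : R)) (p.2 : 'rV[R]_n).

Lemma consV0 n p : (@consV n p : 'rV[R]_n.+1) ord0 ord0 = p.1.
Proof.
have := @row_mxEl R 1 1 n (\row_(_ < 1) (p.1 : R)) p.2 ord0 ord0.
by rewrite mxE => <-; congr (row_mx _ _ _ _); exact/val_inj.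
Qed.

Lemma consVS n p (j : 'I_n) : (@consV n p : 'rV[R]_n.+1) ord0 (lift ord0 j) = (p.2 : 'rV[R]_n) ord0 j.
Proof.
have := @row_mxEr R 1 1 n (\row_(_ < 1) (p.1 : R)) p.2 ord0 j.
by move=> <-; congr (row_mx _ _ _ _); exact/val_inj.
Qed.

Lemma measurable_consV n : measurable_fun setT (@consV n).
Proof.
apply: measurable_fun_rV => j; case: (unliftP ord0 j) => [i ->|->].
- under eq_fun do rewrite consVS.
  by apply: measurableT_comp (measurable_coord i) _; exact: measurable_snd.
- under eq_fun do rewrite consV0; exact: measurable_fst.
Qed.

HB.instance Definition _ n := @isMeasurableFun.Build _ _ _ _ (@consV n) (@measurable_consV n).

Definition cons_measure n (mu : {sigma_finite_measure set BR R n -> \bar R}) :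
  set (BR R n.+1) -> \bar R := pushforward (prod_measure leb mu) (@consV n).

Section inst.
Variables (n : nat) (mu : {sigma_finite_measure set BR R n -> \bar R}).
Let pm : {measure set (BR R n.+1) -> \bar R} :=
  measure_function_pushforward__canonical__measure_function_Measure (prod_measure leb mu) (@measurable_consV n).

HB.instance Definition _ := isMeasure.Build _ _ _ (cons_measure mu)
  (@measure0 _ _ _ pm) (@measure_ge0 _ _ _ pm) (@measure_semi_sigma_additive _ _ _ pm).

Let sf : sigma_finite setT (cons_measure mu).
Proof.
have [F FT mF] := sigma_finiteT (prod_measure leb mu).
(* [s] splits off the first coordinate and inverts [consV]; it carries an exhausting sequence of the
   product over to the pushforward. *)
pose s (y : BR R n.+1) : measurableTypeR R * BR R n :=
  ((y : 'rV[R]_n.+1) ord0 ord0, \row_j (y : 'rV[R]_n.+1) ord0 (lift ord0 j)).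
have ms : measurable_fun setT s.
  apply: measurable_fun_pair; first exact: measurable_coord.
  apply: measurable_fun_rV => j; under eq_fun do rewrite mxE.
  exact: measurable_coord.
exists (fun k => s @^-1` F k).
  by rewrite -preimage_bigcup -FT preimage_setT.
move=> k; split; first by rewrite -[X in measurable X]setTI; apply: ms => //; exact: (mF k).1.
rewrite /cons_measure /pushforward.
have -> : (@consV n) @^-1` (s @^-1` F k) = F k; last exact: (mF k).2.
apply/seteqP; split => -[x y]; rewrite /preimage /= /s consV0;
  suff -> : (\row_j (consV (x, y) : 'rV[R]_n.+1) ord0 (lift ord0 j) = y) by [].
all: by apply/rowP => j; rewrite mxE consVS.
Qed.

HB.instance Definition _ := @Measure_isSigmaFinite.Build _ _ _ (cons_measure mu) sf.
End inst.

(** Follows the recursion of [iint], with a unit point mass in dimension 0, so that the comparison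
    of the two is an induction on n. *)
Fixpoint rVmeasure n : {sigma_finite_measure set BR R n -> \bar R} :=
  match n with
  | 0 => [the {sigma_finite_measure set _ -> \bar R} of @dirac _ (BR R 0) (0 : 'rV[R]_0) R]
  | m.+1 => cons_measure (rVmeasure m)
  end.

End rVmeasure.

(** * Iterated integrals as integrals against [rVmeasure] *)

Section iint.
Context {R : realType}.
Local Notation leb := (@lebesgue_measure R).
Local Open Scope ereal_scope.

(** No integrability is assumed: the integral is the difference of those of the positive and
    negative parts, each measurable in the parameter by Tonelli. *)
Lemma measurable_fun_integral_param d1 d2 (Y : measurableType d1) (X : measurableType d2)
    (m : {sigma_finite_measure set X -> \bar R}) (h : Y * X -> \bar R) :
  measurable_fun setT h -> measurable_fun setT (fun y => \int[m]_x h (y, x)).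
Proof.
move=> mh.
have -> : (fun y => \int[m]_x h (y, x)) =
    (fun y => (\int[m]_x h^\+ (y, x))) \- (fun y => (\int[m]_x h^\- (y, x))).
  apply/funext => y; rewrite [LHS]integralE.
  under eq_integral do rewrite funepos_comp/=.
  by under [X in _ - X = _]eq_integral do rewrite funeneg_comp/=.
apply: emeasurable_funB; apply: measurable_fun_fubini_tonelli_F => //.
- exact: measurable_funepos.
- exact: measurable_funeneg.
Qed.

(** The parameter space varies in the induction: each outer real variable joins [Y] before the next
    integration. *)
Lemma measurable_fun_iint d1 (Y : measurableType d1) n (h : Y -> BR R n -> \bar R) :
  measurable_fun setT (fun p => h p.1 p.2) ->
  measurable_fun setT (fun y => iint (h y : 'rV[R]_n -> \bar R)).
Proof.
elim: n d1 Y h => [|n IH] d1 Y h mh /=.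
  suff : measurable_fun setT ((fun p => h p.1 p.2) \o (fun y => (y, 0%R : BR R 0))) by [].
  apply: measurableT_comp; first exact: mh.
  by apply: measurable_fun_pair; [exact: measurable_id|exact: measurable_cst].
apply: (@measurable_fun_integral_param _ _ Y (measurableTypeR R) leb
  (fun p => iint (fun y : 'rV[R]_n => h p.1 (row_mx (\row_(_ < 1) p.2) y)))).
apply: (IH _ (Y * measurableTypeR R)%type (fun p y => h p.1 (row_mx (\row_(_ < 1) p.2) y))).
suff : measurable_fun setT ((fun p => h p.1 p.2) \o
  (fun q : (Y * measurableTypeR R) * BR R n => (q.1.1, consV (q.1.2, q.2)))) by [].
apply: measurableT_comp; first exact: mh.
apply: measurable_fun_pair; first exact: measurableT_comp.
apply: measurableT_comp; first exact: measurable_consV.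
apply: measurable_fun_pair; last exact: measurable_snd.
exact: measurableT_comp.
Qed.

Lemma ge0_iintE n (h : BR R n -> \bar R) : measurable_fun setT h -> (forall y, 0 <= h y) ->
  iint (h : 'rV[R]_n -> \bar R) = \int[rVmeasure n]_y h y.
Proof.
elim: n h => [|n IH] h mh h0 /=.
  by rewrite integral_dirac// diracT mul1e.
have mhc : measurable_fun setT (h \o @consV R n) by apply: measurableT_comp => //; exact: measurable_consV.
transitivity (\int[prod_measure leb (rVmeasure n)]_z (h \o @consV R n) z).
  rewrite fubini_tonelli1; [|exact: mhc|by move=> z; exact: h0].
  apply: eq_integral => x _; rewrite IH//.
  suff : measurable_fun setT ((h \o @consV R n) \o (fun y => (x, y))) by [].
  apply: measurableT_comp; first exact: mhc.
  by apply: measurable_fun_pair; [exact: measurable_cst|exact: measurable_id].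
rewrite -[LHS]/(\int[_]_(z in consV (n := n) @^-1` setT) _ z).
by rewrite -ge0_integral_pushforward//; exact: measurable_consV.
Qed.

(** Slices of an integrable function are integrable only almost everywhere, so the induction
    hypothesis gives an almost everywhere identity; the measurability needed to integrate it comes
    from [measurable_fun_iint]. *)
Lemma integrable_iintE n (h : BR R n -> \bar R) : (rVmeasure n).-integrable setT h ->
  iint (h : 'rV[R]_n -> \bar R) = \int[rVmeasure n]_y h y.
Proof.
elim: n h => [|n IH] h ih /=.
  by rewrite integral_dirac// ?diracT ?mul1e//; exact: measurable_int ih.
have mh := measurable_int _ ih.
have mhc : measurable_fun setT (h \o @consV R n) by apply: measurableT_comp => //; exact: measurable_consV.
have ihc : (prod_measure leb (rVmeasure n)).-integrable setT (h \o @consV R n).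
  apply/integrableP; split; first exact: mhc.
  have /integrableP[_] := ih; apply: le_lt_trans.
  rewrite /= [leRHS](@ge0_integral_pushforward _ _ _ _ _ _ (@measurable_consV R n)
    (prod_measure leb (rVmeasure n)) setT (abse \o h)) ?preimage_setT//.
    exact: measurableT_comp.
  by move=> y _; exact: abse_ge0.
transitivity (\int[leb]_x \int[rVmeasure n]_y h (consV (x, y))).
  apply: ae_eq_integral => //.
  - apply: (@measurable_fun_iint _ (measurableTypeR R) n (fun x y => h (consV (x, y)))).
    by rewrite [X in measurable_fun _ X](_ : _ = h \o @consV R n)//; apply/funext => -[].
  - exact: (@measurable_fun_integral_param _ _ (measurableTypeR R) (BR R n) (rVmeasure n) (h \o @consV R n) mhc).
  - have := ae_integrable1 ihc; apply: filterS => x /= ix _.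
    exact: IH.
rewrite (@integral12_prod_meas1 _ _ _ _ _ leb (rVmeasure n) (h \o @consV R n))//.
rewrite -[LHS]/(\int[prod_measure leb (rVmeasure n)]_(z in consV (n := n) @^-1` setT) _ z).
by rewrite -(integral_pushforward (@measurable_consV R n) mh ihc).
Qed.

End iint.

(** * Phase-space measure and its agreement with [Oint] *)

Section phase_measure.
Context {R : realType}.
Local Notation leb := (@lebesgue_measure R).
Local Open Scope ereal_scope.

(** Same carrier as [phase], but with the product sigma-algebra, to which product measures and
    Fubini apply. *)
Definition PH (d : nat) : Type := (measurableTypeR R * (BR R d * BR R d))%type.

Definition rV2measure d : {sigma_finite_measure set (BR R d * BR R d)%type -> \bar R} :=
  prod_measure (rVmeasure d) (rVmeasure d).

Definition phase_measure d : {sigma_finite_measure set (PH d) -> \bar R} :=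
  prod_measure leb (rV2measure d).

Lemma dense_phase d (z : @phase R d) (e : R) : (0 < e)%R ->
  exists i : rat * ('rV[rat]_d * 'rV[rat]_d),
    ball z e ((ratr i.1, (\row_j ratr (i.2.1 ord0 j), \row_j ratr (i.2.2 ord0 j))) : @phase R d).
Proof.
case: z => t [x v] e0.
have [a ha] := dense_R t e0; have [b hb] := dense_rV x e0; have [c hc] := dense_rV v e0.
by exists (a, (b, c)).
Qed.

Lemma measurable_rV_ball n (c : 'rV[R]_n) e : measurable (ball c e : set (BR R n)).
Proof. by apply: sub_sigma_algebra; exact: (@ball_open R 'rV[R]_n). Qed.

(** A ball of the product metric is a rectangle of three balls, hence product measurable, and points
    with rational coordinates are dense. *)
Lemma measurable_phase d (A : set (@phase R d)) : <<s open >> A -> measurable (A : set (PH d)).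
Proof.
move=> oA.
apply: (@measurable_preimage_borel _ _ (PH d) (@phase R d) (rat * ('rV[rat]_d * 'rV[rat]_d))%type
 (fun i => (ratr i.1, (\row_j ratr (i.2.1 ord0 j), \row_j ratr (i.2.2 ord0 j)))) (fun z => z) _ _ A oA).
  exact: dense_phase.
move=> [a [b c]] e e0 /=.
rewrite [X in measurable X](_ : _ = ball (ratr a : R) e `*` (ball (\row_j ratr (b ord0 j) : 'rV[R]_d) e `*`
    ball (\row_j ratr (c ord0 j) : 'rV[R]_d) e)).
  apply: measurableX; first by rewrite ball_itv; exact: measurable_itv.
  by apply: measurableX; exact: measurable_rV_ball.
by apply/seteqP; split => -[t [x v]].
Qed.

(* [OmegaT] as a subset of the measurable type [PH d] instead of the normed
   module [phase d]. *)
Definition OM d (T : R) : set (PH d) := OmegaT d T.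

Lemma measurable_OM d T : measurable (@OM d T).
Proof.
rewrite [X in measurable X](_ : _ = `]-oo, T[%classic `*` setT).
  by apply: measurableX => //; exact: measurable_itv.
by apply/seteqP; split => -[t w] /=; rewrite in_itv //= => -[].
Qed.

Lemma borel_measurable d T (h : @phase R d -> R) : borel_meas (OmegaT d T) h ->
  measurable_fun (@OM d T) (h : PH d -> R).
Proof. by move=> bh _ B mB; apply: measurable_phase; exact: bh. Qed.

Lemma integrable_iint2E d (g : (BR R d * BR R d)%type -> \bar R) :
  (rV2measure d).-integrable setT g ->
  iint (fun x : 'rV[R]_d => iint (fun v : 'rV[R]_d => g (x, v))) = \int[rV2measure d]_w g w.
Proof.
move=> ig; have mg := measurable_int _ ig.
have mk : measurable_fun setT (fun x : BR R d => iint (fun v : 'rV[R]_d => g (x, v))).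
  apply: (@measurable_fun_iint _ _ (BR R d) d (fun x v => g (x, v))).
  by rewrite [X in measurable_fun _ X](_ : _ = g)//; apply/funext => -[].
have iF := integrable_fubini_F ig.
have kF : ae_eq (rVmeasure d) setT (fun x : BR R d => iint (fun v : 'rV[R]_d => g (x, v)))
    (fubini_F (rVmeasure d) g).
  have := ae_integrable1 ig; apply: filterS => x /= ix _.
  exact: integrable_iintE.
rewrite integrable_iintE; last first.
  apply/integrableP; split; first exact: mk.
  have /integrableP[_] := iF; apply: le_lt_trans.
  rewrite le_eqVlt; apply/orP; left; apply/eqP; apply: ae_eq_integral => //.
  - exact: measurableT_comp.
  - by apply: measurableT_comp => //; exact: measurable_int iF.
  - by apply: filterS kF => x /= + _ => ->.
rewrite (ae_eq_integral _ _ measurableT mk _ kF); last exact: measurable_int iF.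
exact: integral12_prod_meas1.
Qed.

Lemma ge0_iint2E d (g : (BR R d * BR R d)%type -> \bar R) :
  measurable_fun setT g -> (forall w, 0 <= g w) ->
  iint (fun x : 'rV[R]_d => iint (fun v : 'rV[R]_d => g (x, v))) = \int[rV2measure d]_w g w.
Proof.
move=> mg g0.
have gE x : iint (fun v : 'rV[R]_d => g (x, v)) = \int[rVmeasure d]_v g (x, v).
  rewrite (@ge0_iintE R d (fun v => g (x, v)))//; exact: (measurableT_comp mg).
rewrite (_ : (fun x : 'rV[R]_d => _) = (fun x : BR R d => \int[rVmeasure d]_v g (x, v))); last exact/funext.
rewrite ge0_iintE//; first by rewrite -fubini_tonelli1.
- exact: (@measurable_fun_integral_param _ _ _ (BR R d) (BR R d) (rVmeasure d) g).
- by move=> x; apply: integral_ge0.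
Qed.

(** The slice integral enters as [m], zero from time T on, so that the signed and the nonnegative
    case remove the time restriction in the same way. *)
Lemma OintE d T (h : @phase R d -> \bar R) (m : R -> \bar R) :
  (forall t, (t < T)%R -> m t = iint (fun x : 'rV[R]_d => iint (fun v : 'rV[R]_d => h (t, (x, v))))) ->
  (forall t, (T <= t)%R -> m t = 0) ->
  Oint T h = \int[leb]_t m t.
Proof.
move=> mh m0; rewrite /Oint [LHS]integral_mkcond; apply: eq_integral => t _.
rewrite patchE; case: ifPn; rewrite ?inE /= ?notin_setE /= in_itv /=.
  by move=> tT; rewrite mh.
by move=> /negP; rewrite -leNgt => /m0.
Qed.

Lemma ge0_OintE d T (h : PH d -> \bar R) :
  measurable_fun (@OM d T) h -> (forall z, OM T z -> 0 <= h z) ->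
  Oint T (h : @phase R d -> _) = \int[phase_measure d]_(z in @OM d T) h z.
Proof.
move=> mh h0; have mO := @measurable_OM d T.
have mh' : measurable_fun setT (h \_ (@OM d T)) by exact/(measurable_restrictT h mO).
have h0' z : 0 <= (h \_ (@OM d T)) z.
  by rewrite patchE; case: ifPn => // /set_mem /h0.
rewrite integral_mkcond fubini_tonelli1//.
apply: OintE => t tT.
- rewrite /fubini_F -ge0_iint2E; [|exact: (measurableT_comp mh')|by []].
  apply: congr1; apply/funext => x; apply: congr1; apply/funext => v.
  by rewrite patchE mem_set.
- rewrite /fubini_F integral0_eq// => w _; rewrite patchE memNset// /OM /OmegaT /=.
  by apply/negP; rewrite -leNgt.
Qed.

Lemma integrable_OintE d T (h : PH d -> \bar R) :
  (phase_measure d).-integrable (@OM d T) h ->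
  Oint T (h : @phase R d -> _) = \int[phase_measure d]_(z in @OM d T) h z.
Proof.
move=> ih; have mO := @measurable_OM d T.
have ih' : (phase_measure d).-integrable setT (h \_ (@OM d T)) by exact/(integrable_mkcond h mO).
have mh' := measurable_int _ ih'.
pose m (t : R) := iint (fun x : 'rV[R]_d => iint (fun v : 'rV[R]_d => (h \_ (@OM d T)) (t, (x, v)))).
rewrite integral_mkcond (_ : Oint T h = \int[leb]_t m t).
  rewrite -[RHS]integral12_prod_meas1//; apply: ae_eq_integral => //.
  - apply: (@measurable_fun_iint _ _ (measurableTypeR R) d
      (fun t x => iint (fun v : 'rV[R]_d => (h \_ (@OM d T)) (t, (x, v))))).
    apply: (@measurable_fun_iint _ _ (measurableTypeR R * BR R d)%type d
      (fun p v => (h \_ (@OM d T)) (p.1, (p.2, v)))).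
    suff : measurable_fun setT ((h \_ (@OM d T)) \o
       (fun q : (measurableTypeR R * BR R d) * BR R d => (q.1.1, (q.1.2, q.2)))) by [].
    apply: measurableT_comp => //.
    apply: measurable_fun_pair; first exact: measurableT_comp.
    by apply: measurable_fun_pair => //; exact: measurableT_comp.
  - exact: measurable_fubini_F ih'.
  - have := ae_integrable1 ih'; apply: filterS => t /= it _.
    exact: integrable_iint2E it.
apply: OintE => t tT.
- rewrite /m; apply: congr1; apply/funext => x; apply: congr1; apply/funext => v.
  by rewrite patchE mem_set.
- rewrite /m; transitivity (\int[rV2measure d]_w cst 0 w); last exact: integral0.
  rewrite -ge0_iint2E//; apply: congr1; apply/funext => x; apply: congr1; apply/funext => v.
  by rewrite patchE memNset// /OM /OmegaT /=; apply/negP; rewrite -leNgt.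
Qed.

End phase_measure.

(** * Reflection and translation in time, volumes of boxes *)

Section box_volume.
Context {R : realType}.
Local Notation leb := (@lebesgue_measure R).
Local Open Scope ereal_scope.

Lemma measurable_set_ler d (Y : measurableType d) (f g : Y -> R) :
  measurable_fun setT f -> measurable_fun setT g -> measurable [set x | (f x <= g x)%R].
Proof.
move=> mf mg; have := measurable_fun_ler mf mg measurableT (Y := [set true]).
by rewrite setTI; apply.
Qed.

Lemma measurable_set_ltr d (Y : measurableType d) (f g : Y -> R) :
  measurable_fun setT f -> measurable_fun setT g -> measurable [set x | (f x < g x)%R].
Proof.
move=> mf mg; have := measurable_fun_ltr mf mg measurableT (Y := [set true]).
by rewrite setTI; apply.
Qed.


(** Lebesgue measure is determined by half-open intervals, so it suffices to compare its pushforward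
    by [g] there. Serves t -> c - t and t -> t - c. *)
Lemma lebesgue_measure_preimage (g : R -> R) :
  measurable_fun setT (g : measurableTypeR R -> measurableTypeR R) ->
  (forall a b : R, (a < b)%R -> leb (g @^-1` `]a, b]%classic) = (b - a)%:E) ->
  forall A, measurable A -> leb (g @^-1` A) = leb A.
Proof.
move=> mg gab A mA.
pose m : {measure set (measurableTypeR R) -> \bar R} :=
  measure_function_pushforward__canonical__measure_function_Measure leb mg.
apply/esym; apply: (@lebesgue_measure_unique R m) => // X [[a b] _ <-] /=.
have [ab|ba] := ltP a b.
  rewrite lebesgue_measure_itv/= lte_fin ab -EFinD.
  by rewrite -[RHS]/(leb (g @^-1` `]a, b]%classic)) gab.
rewrite set_itv_ge ?measure0//; last by rewrite bnd_simp -leNgt.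
Qed.

Lemma measurable_subC (c : R) : measurable_fun setT (fun s : measurableTypeR R => (c - s)%R : measurableTypeR R).
Proof. exact: measurable_funB. Qed.

Lemma measurable_sub_r (c : R) : measurable_fun setT (fun s : measurableTypeR R => (s - c)%R : measurableTypeR R).
Proof. exact: measurable_funB. Qed.

Lemma ge0_integral_preimage (g : R -> R) (f : R -> \bar R) :
  measurable_fun setT (g : measurableTypeR R -> measurableTypeR R) ->
  (forall a b : R, (a < b)%R -> leb (g @^-1` `]a, b]%classic) = (b - a)%:E) ->
  measurable_fun setT (f : measurableTypeR R -> \bar R) -> (forall s, 0 <= f s) ->
  \int[leb]_s f (g s) = \int[leb]_s f s.
Proof.
move=> mg gab mf f0.
have := @ge0_integral_pushforward _ _ (measurableTypeR R) (measurableTypeR R) R g mg leb setT f measurableT mf.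
rewrite preimage_setT => <-; last by move=> y _; exact: f0.
apply: eq_measure_integral => A mA _; rewrite /pushforward /=.
exact: lebesgue_measure_preimage.
Qed.

Lemma ge0_integral_subC (c : R) (f : R -> \bar R) :
  measurable_fun setT (f : measurableTypeR R -> \bar R) -> (forall s, 0 <= f s) ->
  \int[leb]_s f (c - s)%R = \int[leb]_s f s.
Proof.
apply: ge0_integral_preimage; first exact: measurable_subC.
move=> a b ab; rewrite [X in leb X](_ : _ = `[c - b, c - a[%classic)%R.
  rewrite lebesgue_measure_itv/= lte_fin ltrD2l ltrN2 ab -EFinD; congr (_%:E).
  by ring.
by apply/seteqP; split => s /=; rewrite !in_itv /= => /andP[? ?]; apply/andP; split; lra.
Qed.

Lemma ge0_integral_sub_r (c : R) (f : R -> \bar R) :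
  measurable_fun setT (f : measurableTypeR R -> \bar R) -> (forall s, 0 <= f s) ->
  \int[leb]_s f (s - c)%R = \int[leb]_s f s.
Proof.
apply: ge0_integral_preimage; first exact: measurable_sub_r.
move=> a b ab; rewrite [X in leb X](_ : _ = `]a + c, b + c]%classic)%R.
  rewrite lebesgue_measure_itv/= lte_fin ltrD2r ab -EFinD; congr (_%:E).
  by ring.
by apply/seteqP; split => s /=; rewrite !in_itv /= => /andP[? ?]; apply/andP; split; lra.
Qed.

Definition rVbox n (c : 'rV[R]_n) (r : R) : set (BR R n) :=
  [set y | forall i, (`|(y : 'rV[R]_n) ord0 i - c ord0 i| <= r)%R].

Lemma measurable_rVbox n (c : 'rV[R]_n) r : measurable (rVbox c r).
Proof.
rewrite [X in measurable X](_ : _ = \bigcap_(i in setT)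
    [set y : BR R n | (`|(y : 'rV[R]_n) ord0 i - c ord0 i| <= r)%R]).
  apply: fin_bigcap_measurable => // i _; apply: measurable_set_ler => //.
  apply: measurableT_comp => //; apply: measurable_funB => //; exact: measurable_coord.
by apply/seteqP; split => y /= h i; [move=> _|]; exact: h.
Qed.

Lemma rVmeasure_box n (c : 'rV[R]_n) (r : R) : (0 <= r)%R ->
  rVmeasure n (rVbox c r) = ((2 * r) ^+ n)%:E.
Proof.
move=> r0; elim: n c => [|n IH] c.
  rewrite expr0 /= diracE mem_set//= => -[] //.
have -> : rVmeasure n.+1 (rVbox c r) =
    (leb \x rVmeasure n)%E (`[c ord0 ord0 - r, c ord0 ord0 + r]%classic `*`
      rVbox (\row_j c ord0 (lift ord0 j)) r)%R.
  congr ((leb \x rVmeasure n)%E _); apply/seteqP; split => -[x y] /=.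
  - move=> h; split.
    + by have := h ord0; rewrite consV0 /= ler_distl in_itv.
    + by move=> i; have := h (lift ord0 i); rewrite consVS mxE.
  - move=> [hx hy] i; case: (unliftP ord0 i) => [j ->|->].
    + by have := hy j; rewrite consVS mxE.
    + by rewrite consV0 ler_distl; rewrite in_itv in hx.
rewrite product_measure1E//; last exact: measurable_rVbox.
have hl : leb `[(c ord0 ord0 - r)%R, (c ord0 ord0 + r)%R]%classic = (2 * r)%:E.
  rewrite lebesgue_measure_itv/= lte_fin.
  case: ltP => h; first by rewrite -EFinD; congr _%:E; ring.
  by congr _%:E; lra.
by rewrite IH exprS EFinM; congr (_ * _).
Qed.

End box_volume.

(** * The kinetic kernel *)

Section kernel.
Context {R : realType} (d : nat) (th l : R).
Hypothesis l0 : 0 <= l.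
Local Notation leb := (@lebesgue_measure R).
Local Notation M := (@PH R d).
Local Notation mu := (phase_measure d).

Definition tau (z0 z : @phase R d) : R := z0.1 - z.1.
Definition relx (z0 z : @phase R d) (i : 'I_d) : R :=
  z.2.1 ord0 i - z0.2.1 ord0 i + tau z0 z * z0.2.2 ord0 i.
Definition relv (z0 z : @phase R d) (i : 'I_d) : R := z.2.2 ord0 i - z0.2.2 ord0 i.

(* The kinetic cylinder slice of size [l * tau^th] in velocity around the
   backward free transport of [z0]. *)
Definition kbox : set (M * M) := [set p | [/\ 0 < tau p.1 p.2,
  forall i, `|relx p.1 p.2 i| <= l * tau p.1 p.2 `^ (1 + th) &
  forall i, `|relv p.1 p.2 i| <= l * tau p.1 p.2 `^ th]].

Definition hdim : R := d%:R * (1 + 2 * th).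

(** tau^(- hdim) is [kmass] divided by the volume of the slice of [kbox] at time distance tau, so
    all slices carry the same mass. *)
Definition kker (z0 z : M) : R := \1_kbox (z0, z) * tau z0 z `^ (- hdim).

Lemma measurable_tau : measurable_fun setT (fun p : M * M => tau p.1 p.2).
Proof. by apply: measurable_funB; exact: measurableT_comp. Qed.

Lemma measurable_tau2 (z0 : M) : measurable_fun setT (fun z : M => tau z0 z).
Proof. by apply: measurable_funB. Qed.

Lemma measurable_tau1 (z : M) : measurable_fun setT (fun z0 : M => tau z0 z).
Proof. by apply: measurable_funB. Qed.

Lemma measurable_x_fst i : measurable_fun setT (fun z : M => (z.2.1 : 'rV[R]_d) ord0 i).
Proof.
apply: (measurableT_comp (measurable_coord i) (g := fun z : M => z.2.1)).
exact: measurableT_comp.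
Qed.

Lemma measurable_v_fst i : measurable_fun setT (fun z : M => (z.2.2 : 'rV[R]_d) ord0 i).
Proof.
apply: (measurableT_comp (measurable_coord i) (g := fun z : M => z.2.2)).
exact: measurableT_comp.
Qed.

Lemma measurable_relv i : measurable_fun setT (fun p : M * M => relv p.1 p.2 i).
Proof.
by apply: measurable_funB;
  apply: (measurableT_comp (measurable_v_fst i)).
Qed.

Lemma measurable_relx i : measurable_fun setT (fun p : M * M => relx p.1 p.2 i).
Proof.
apply: measurable_funD; first apply: measurable_funB.
- exact: (measurableT_comp (measurable_x_fst i)).
- exact: (measurableT_comp (measurable_x_fst i)).
- apply: measurable_funM; first exact: measurable_tau.
  exact: (measurableT_comp (measurable_v_fst i)).
Qed.

Lemma measurable_tau_powR a : measurable_fun setT (fun p : M * M => tau p.1 p.2 `^ a).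
Proof. by apply: (measurableT_comp (measurable_powR a)); exact: measurable_tau. Qed.

Lemma measurable_kbox : measurable kbox.
Proof.
rewrite [X in measurable X](_ : _ = [set p : M * M | 0 < tau p.1 p.2] `&`
  \bigcap_(i in setT) ([set p : M * M | `|relx p.1 p.2 i| <= l * tau p.1 p.2 `^ (1 + th)] `&`
    [set p : M * M | `|relv p.1 p.2 i| <= l * tau p.1 p.2 `^ th])).
  apply: measurableI; first by apply: measurable_set_ltr => //; exact: measurable_tau.
  apply: fin_bigcap_measurable => // i _.
  apply: measurableI; apply: measurable_set_ler.
  - by apply: measurableT_comp => //; exact: measurable_relx.
  - by apply: measurable_funM => //; exact: measurable_tau_powR.
  - by apply: measurableT_comp => //; exact: measurable_relv.
  - by apply: measurable_funM => //; exact: measurable_tau_powR.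
apply/seteqP; split => p /=.
- by move=> [? hx hv]; split => // i _; split; [exact: hx|exact: hv].
- by move=> [? h]; split => // i; have [] := h i I.
Qed.

Lemma measurable_kker : measurable_fun setT (fun p : M * M => kker p.1 p.2).
Proof.
apply: measurable_funM; last exact: measurable_tau_powR.
rewrite (_ : (fun p : M * M => _) = \1_kbox); last by apply/funext => -[].
exact: measurable_indic measurable_kbox.
Qed.

Lemma kker_ge0 z0 z : 0 <= kker z0 z.
Proof. by rewrite /kker mulr_ge0 ?powR_ge0// indicE. Qed.

Local Open Scope ereal_scope.

Definition kmass : R := ((2 * l) ^+ (d + d))%R.

Lemma box_volume_powR (s : R) : (0 < s)%R ->
  ((2 * (l * s `^ (1 + th))) ^+ d * (2 * (l * s `^ th)) ^+ d * s `^ (- hdim) = kmass)%R.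
Proof.
move=> s0; rewrite !mulrA !exprMn -!powR_mulrn ?powR_ge0//.
rewrite -!powRrM /kmass exprD exprMn.
set A := (s `^ _)%R; set B := (s `^ _)%R; set C := (s `^ _)%R.
have ABC : (A * B * C = 1)%R.
  rewrite /A /B /C -!powRD ?(gt_eqF s0) ?implybT//.
  rewrite (_ : (_ + _ + _ = 0)%R) ?powRr0// /hdim; ring.
have -> : ((2 : R) `^ d%:R = 2 ^+ d)%R by rewrite powR_mulrn.
have -> : (l `^ d%:R = l ^+ d)%R by rewrite powR_mulrn.
transitivity (2 ^+ d * l ^+ d * (2 ^+ d * l ^+ d) * (A * B * C))%R; first by ring.
by rewrite ABC mulr1.
Qed.

(** For fixed [z0] and time the slice is a product of two boxes, whose volumes cancel tau^(-
    hdim). *)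
Lemma kker_inner (z0 : M) (t : R) :
  \int[rV2measure d]_w (kker z0 (t, w))%:E =
  if (0 < z0.1 - t)%R then kmass%:E else 0.
Proof.
case: ltP => [t0|t0]; last first.
  rewrite integral0_eq// => w _; rewrite /kker indicE memNset ?mul0r//=.
  by move=> [+ _ _]; rewrite /tau /= ltNge t0.
set s := (z0.1 - t)%R in t0 *.
have tauE w : tau z0 (t, w) = s by [].
pose A : set (BR R d) := rVbox (z0.2.1 - s *: (z0.2.2 : 'rV[R]_d))%R (l * s `^ (1 + th)).
pose B : set (BR R d) := rVbox (z0.2.2 : 'rV[R]_d) (l * s `^ th).
have mAB : measurable (A `*` B) by apply: measurableX; exact: measurable_rVbox.
transitivity (\int[rV2measure d]_w ((s `^ (- hdim))%:E * (\1_(A `*` B) w)%:E)).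
  apply: eq_integral => -[x v] _; rewrite -EFinM mulrC /kker; congr (_ * _)%:E.
  rewrite !indicE; congr (_%:R); congr nat_of_bool; apply/idP/idP => /set_mem h; apply/mem_set.
  - case: h => /= _ hx hv; split => i.
    + by have := hx i; rewrite tauE /relx tauE /rVbox /= !mxE opprB addrA addrAC.
    + by have := hv i; rewrite tauE.
  - case: h => /= hx hv; split => /= [|i|i]; rewrite tauE//.
    + by have := hx i; rewrite /relx tauE /rVbox /= !mxE opprB addrA addrAC.
    + exact: hv.
rewrite ge0_integralZl_EFin ?powR_ge0//; last first.
  by apply/measurable_EFinP; exact: measurable_indic.
rewrite integral_indic// setIT /rV2measure /prod_measure.
rewrite [X in _ * X](_ : _ = (rVmeasure d A * rVmeasure d B)); last first.
  by apply: product_measure1E; exact: measurable_rVbox.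
rewrite !rVmeasure_box ?mulr_ge0 ?powR_ge0// -!EFinM; congr _%:E.
by rewrite mulrC box_volume_powR.
Qed.

Lemma measurable_kker2 z0 : measurable_fun setT (kker z0).
Proof.
by apply: (measurableT_comp measurable_kker (g := fun z => (z0, z))); exact: measurable_fun_pair.
Qed.

Lemma measurable_kker1 z : measurable_fun setT (kker ^~ z).
Proof.
by apply: (measurableT_comp measurable_kker (g := fun z0 => (z0, z))); exact: measurable_fun_pair.
Qed.

(** In the first variable the x-box is centred at x + s v0 and moves with the velocity v0 being
    integrated. Integrating x before v makes the centre irrelevant, so the mass is the same as in
    the second variable. *)
Lemma kker_inner1 (z : M) (t0 : R) :
  \int[rV2measure d]_w (kker (t0, w) z)%:E =
  if (0 < t0 - z.1)%R then kmass%:E else 0.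
Proof.
case: ltP => [s0|s0]; last first.
  rewrite integral0_eq// => w _; rewrite /kker indicE memNset ?mul0r//=.
  by move=> [+ _ _]; rewrite /tau /= ltNge s0.
set s := (t0 - z.1)%R in s0 *.
have tauE w : tau (t0, w) z = s by [].
pose A (v : 'rV[R]_d) : set (BR R d) := rVbox (z.2.1 + s *: v)%R (l * s `^ (1 + th)).
pose B : set (BR R d) := rVbox (z.2.2 : 'rV[R]_d) (l * s `^ th).
have mB : measurable B by exact: measurable_rVbox.
rewrite fubini_tonelli2/=; last 2 first.
- apply/measurable_EFinP.
  by apply: (measurableT_comp (measurable_kker1 z) (g := fun w : BR R d * BR R d => (t0 : measurableTypeR R, w))); exact: measurable_fun_pair.
- by move=> w; rewrite lee_fin kker_ge0.
transitivity (\int[rVmeasure d]_v (((s `^ (- hdim)) * (2 * (l * s `^ (1 + th))) ^+ d)%:E * (\1_B v)%:E)).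
  apply: eq_integral => v _; rewrite /fubini_G /=.
  transitivity (\int[rVmeasure d]_x ((s `^ (- hdim) * \1_B v)%:E * (\1_(A v) x)%:E)).
    apply: eq_integral => x _; rewrite -EFinM /kker tauE [(_ * s `^ _)%R]mulrC -[RHS]/((_ * _ * _)%:E) -mulrA; congr (_ * _)%:E.
    rewrite !indicE -natrM mulnb; congr (_%:R); congr nat_of_bool.
    apply/idP/andP => [/set_mem h|[/set_mem h1 /set_mem h2]].
    - case: h => /= _ hx hv; split; apply/mem_set => i.
      + by have := hv i; rewrite tauE /relv distrC.
      + have := hx i; rewrite tauE /relx tauE distrC /= !mxE.
        by congr (`|_| <= _)%R; ring.
    - apply/mem_set; split => /= [|i|i]; rewrite tauE//.
      + have := h2 i; rewrite /relx tauE distrC /= !mxE.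
        by congr (`|_| <= _)%R; ring.
      + by have := h1 i; rewrite /= distrC.
  rewrite ge0_integralZl_EFin ?mulr_ge0 ?powR_ge0//.
  - rewrite integral_indic ?setIT//; last exact: measurable_rVbox.
    rewrite [X in _ * X](_ : _ = ((2 * (l * s `^ (1 + th))) ^+ d)%:E); last first.
      by apply: rVmeasure_box; rewrite mulr_ge0 ?powR_ge0.
    rewrite -!EFinM; congr _%:E; ring.
  - by apply/measurable_EFinP; apply: measurable_indic; exact: measurable_rVbox.
rewrite ge0_integralZl_EFin ?mulr_ge0 ?exprn_ge0 ?mulr_ge0 ?powR_ge0//.
- rewrite integral_indic// setIT.
  rewrite [X in _ * X](_ : _ = ((2 * (l * s `^ th)) ^+ d)%:E); last first.
    by apply: rVmeasure_box; rewrite mulr_ge0 ?powR_ge0.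
  rewrite -!EFinM; congr _%:E.
  rewrite -(box_volume_powR s0); ring.
- by apply/measurable_EFinP; exact: measurable_indic.
Qed.

Section mass.
Variable psi : R -> R.
Hypothesis mpsi : measurable_fun setT (psi : measurableTypeR R -> R).
Hypothesis psi0 : forall s, (0 <= psi s)%R.

Let mpsi' : measurable_fun setT ((fun s => (psi s)%:E) \_ `]0%R, +oo[%classic : measurableTypeR R -> \bar R).
Proof.
apply: (iffLR (measurable_restrictT _ (measurable_itv `]0%R, +oo[))).
by apply: measurable_funTS; apply/measurable_EFinP.
Qed.

Let psi'0 s : 0 <= ((fun s => (psi s)%:E) \_ `]0%R, +oo[%classic) s.
Proof. by rewrite patchE; case: ifPn => // _; rewrite lee_fin. Qed.

(** Integrating out space and velocity leaves the time weight alone; with [kker_mass1] this reduces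
    every kernel estimate to a one-dimensional integral. *)
Lemma kker_mass2 z0 :
  \int[mu]_z (psi (tau z0 z) * kker z0 z)%:E =
  kmass%:E * \int[leb]_(s in `]0%R, +oo[) (psi s)%:E.
Proof.
have kmass0 : (0 <= kmass)%R by rewrite exprn_ge0// mulr_ge0.
rewrite fubini_tonelli1; last 2 first.
- apply/measurable_EFinP/measurable_funM; last exact: measurable_kker2.
  exact: (measurableT_comp mpsi (measurable_tau2 z0)).
- by move=> z; rewrite lee_fin mulr_ge0 ?kker_ge0.
rewrite [in RHS]integral_mkcond -(ge0_integral_subC z0.1 mpsi' psi'0).
rewrite -ge0_integralZl_EFin//; last first.
  by apply: (measurableT_comp mpsi'); exact: measurable_subC.
apply: eq_integral => t _; rewrite /fubini_F /=.
transitivity (\int[rV2measure d]_w ((psi (z0.1 - t)%R)%:E * (kker z0 (t, w))%:E)).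
  by apply: eq_integral => w _; rewrite EFinM.
rewrite ge0_integralZl_EFin//; last 2 first.
- by move=> w _; rewrite lee_fin kker_ge0.
- apply/measurable_EFinP.
  by apply: (measurableT_comp (measurable_kker2 z0) (g := fun w : BR R d * BR R d => (t : measurableTypeR R, w))); exact: measurable_fun_pair.
rewrite kker_inner patchE; case: ltP => h.
- by rewrite mem_set /= ?in_itv ?andbT//= muleC.
- by rewrite memNset ?mule0//=; apply/negP; rewrite in_itv /= andbT -leNgt.
Qed.

Lemma kker_mass1 z :
  \int[mu]_z0 (psi (tau z0 z) * kker z0 z)%:E =
  kmass%:E * \int[leb]_(s in `]0%R, +oo[) (psi s)%:E.
Proof.
have kmass0 : (0 <= kmass)%R by rewrite exprn_ge0// mulr_ge0.
rewrite fubini_tonelli1; last 2 first.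
- apply/measurable_EFinP/measurable_funM; last exact: measurable_kker1.
  exact: (measurableT_comp mpsi (measurable_tau1 z)).
- by move=> z0; rewrite lee_fin mulr_ge0 ?kker_ge0.
rewrite [in RHS]integral_mkcond -(ge0_integral_sub_r z.1 mpsi' psi'0).
rewrite -ge0_integralZl_EFin//; last first.
  by apply: (measurableT_comp mpsi'); exact: measurable_sub_r.
apply: eq_integral => t _; rewrite /fubini_F /=.
transitivity (\int[rV2measure d]_w ((psi (t - z.1)%R)%:E * (kker (t, w) z)%:E)).
  by apply: eq_integral => w _; rewrite EFinM.
rewrite ge0_integralZl_EFin//; last 2 first.
- by move=> w _; rewrite lee_fin kker_ge0.
- apply/measurable_EFinP.
  by apply: (measurableT_comp (measurable_kker1 z) (g := fun w : BR R d * BR R d => (t : measurableTypeR R, w))); exact: measurable_fun_pair.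
rewrite kker_inner1 patchE; case: ltP => h.
- by rewrite mem_set /= ?in_itv ?andbT//= muleC.
- by rewrite memNset ?mule0//=; apply/negP; rewrite in_itv /= andbT -leNgt.
Qed.

End mass.

End kernel.

(** * Potentials of Riesz type *)

Section power_integrals.
Context {R : realType}.
Local Notation leb := (@lebesgue_measure R).

Lemma is_derive_powR (a x : R) : 0 < x -> is_derive x 1 (@powR R ^~ a) (a * x `^ (a - 1)).
Proof.
move=> x0; have xin : x \in `]0, +oo[ by rewrite in_itv /= x0.
apply: DeriveDef; first exact: derivable_powR.
by rewrite -derive1E; exact: powR_derive1.
Qed.

Lemma continuous_powR_gt0 (a x : R) : 0 < x -> {for x, continuous (@powR R ^~ a)}.
Proof.
move=> x0; apply: differentiable_continuous; apply/derivable1_diffP.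
by apply: derivable_powR; rewrite in_itv /= x0.
Qed.

Lemma integral_powR_itv (c a b : R) : c != 0 -> 0 < a -> a < b ->
  (\int[leb]_(s in `[a, b]) (s `^ (c - 1))%:E = (b `^ c / c - a `^ c / c)%:E)%E.
Proof.
move=> c0 a0 ab; rewrite EFinB.
have F' (x : R) : 0 < x -> is_derive x 1 (fun s : R => s `^ c / c) (x `^ (c - 1)).
  move=> x0; have h := is_derive_powR c x0.
  have -> : (fun s : R => s `^ c / c) = c^-1 *: (@powR R ^~ c).
    by apply/funext => s /=; rewrite /GRing.scale/= mulrC.
  by apply: is_derive_eq; rewrite /GRing.scale/= mulrA mulVf ?mul1r.
have cF (x : R) : 0 < x -> {for x, continuous (fun s : R => s `^ c / c)}.
  by move=> x0; apply: differentiable_continuous; apply/derivable1_diffP; have [] := F' x x0.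
apply: (@continuous_FTC2 R (fun s => s `^ (c - 1)) (fun s => s `^ c / c)) => //.
- apply: continuous_in_subspaceT => x; rewrite inE /= in_itv /= => /andP[ax _].
  by apply: continuous_powR_gt0; exact: lt_le_trans ax.
- split.
  + by move=> x; rewrite in_itv /= => /andP[ax _]; have [] := F' x (lt_trans a0 ax).
  + by apply: cvg_at_right_filter; exact: cF.
  + by apply: cvg_at_left_filter; apply: cF; exact: lt_trans ab.
- move=> x; rewrite in_itv /= => /andP[ax _]; rewrite derive1E.
  by apply: derive_val; apply: F'; exact: lt_trans ax.
Qed.

Lemma measurable_powR_itv (D : set R) c :
  measurable_fun (D : set (measurableTypeR R)) (fun s => (s `^ c)%:E).
Proof. by apply: measurable_funTS; apply/measurable_EFinP; exact: measurable_powR. Qed.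

Lemma integral_powR_bigcup_le (c K : R) (F : (set R)^nat) :
  {homo F : n m / (n <= m)%N >-> (n <= m)%O} ->
  (forall k, measurable (F k : set (measurableTypeR R))) ->
  (forall k, (\int[leb]_(s in F k) (s `^ c)%:E <= K%:E)%E) ->
  (\int[leb]_(s in \bigcup_k F k) (s `^ c)%:E <= K%:E)%E.
Proof.
move=> ndF mF FK.
have /cvg_lim <- // := @ge0_nondecreasing_set_cvg_integral _ (measurableTypeR R) R F (fun s => (s `^ c)%:E) leb ndF mF
  (fun i => @measurable_powR_itv (F i) c) (fun i x _ => powR_ge0 x c).
apply: lime_le; last by apply: nearW.
apply/ereal_nondecreasing_is_cvgn => m n mn.
apply: ge0_subset_integral => //; first exact: measurable_powR_itv.
- by move=> x _; rewrite lee_fin powR_ge0.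
- exact/subsetPset/ndF.
Qed.

Lemma integral_powR_lt (b Y : R) : 0 < b ->
  (\int[leb]_(s in `]0%R, +oo[) ((s < Y)%R%:R * s `^ (b - 1))%:E <= (Num.max Y 0 `^ b / b)%:E)%E.
Proof.
move=> b0; have bn0 : b != 0 by rewrite gt_eqF.
have [Y0|Y0] := leP Y 0.
  rewrite powR0// mul0r integral0_eq// => s; rewrite /= in_itv /= andbT => s0.
  by rewrite ltNge (le_trans Y0 (ltW s0)) mul0r.
(* The exhausting intervals stay away from the singularity at 0; k+2 instead of k+1 keeps the left
   end strictly below Y. *)
have /(le_trans _) : (\int[leb]_(s in \bigcup_k `[(Y / k.+2%:R)%R, Y]%classic) (s `^ (b - 1))%:E
    <= (Y `^ b / b)%:E)%E.
  apply: integral_powR_bigcup_le.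
  - move=> n m nm; apply/subsetPset => s /=; rewrite !in_itv /= => /andP[h ->]; rewrite andbT.
    apply: le_trans h; rewrite ler_pM2l// lef_pV2 ?posrE ?ltr0n// ler_nat !ltnS.
    exact: nm.
  - by move=> k; exact: measurable_itv.
  - move=> k; have k0 : 0 < Y / k.+2%:R by rewrite divr_gt0 ?ltr0n.
    rewrite integral_powR_itv//; last first.
      by rewrite ltr_pdivrMr ?ltr0n// ltr_pMr// ltr1n.
    by rewrite lee_fin lerBlDr lerDl divr_ge0 ?powR_ge0 ?(ltW b0)//.
apply.
rewrite [leLHS]integral_mkcond [leRHS]integral_mkcond; apply: ge0_le_integral => //.
- by move=> s _; rewrite patchE; case: ifPn => // _; rewrite lee_fin mulr_ge0 ?powR_ge0.
- apply: (iffLR (measurable_restrictT _ (measurable_itv `]0%R, +oo[))).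
  apply: measurable_funTS; apply/measurable_EFinP; apply: measurable_funM; last exact: measurable_powR.
  rewrite (_ : (fun s : R => _) = (\1_(`]-oo, Y[%classic) : R -> R)).
    by apply: measurable_indic; exact: measurable_itv.
  by apply/funext => s; rewrite indicE mem_setE in_itv.
- apply: (iffLR (measurable_restrictT _ _)); last exact: measurable_powR_itv.
  by apply: bigcupT_measurable => k; exact: measurable_itv.
- move=> s _; rewrite !patchE; case: ifPn; last first.
    by move=> _; case: ifPn => // _; rewrite lee_fin powR_ge0.
  rewrite inE /= in_itv /= andbT => s0.
  have [sY|sY] := ltP s Y; last by rewrite mul0r; case: ifPn => // _; rewrite lee_fin powR_ge0.
  rewrite mul1r mem_set// /bigcup /=.
  have [k _ /(_ k (leqnn k)) hk] := near_infty_natSinv_lt (PosNum (divr_gt0 s0 Y0)).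
  exists k => //=; rewrite in_itv /= (ltW sY) andbT.
  move: hk => /=; rewrite ltr_pdivlMr// => /ltW; apply: le_trans.
  by rewrite mulrC ler_pM2r// lef_pV2 ?posrE ?ltr0n// ler_nat.
Qed.

Lemma integral_powR_ge (b n : R) : 0 < b -> 0 < n ->
  (\int[leb]_(s in `]0%R, +oo[) ((n <= s)%R%:R * s `^ (- b - 1))%:E <= (n `^ (- b) / b)%:E)%E.
Proof.
move=> b0 n0; have bn0 : - b != 0 by rewrite oppr_eq0 gt_eqF.
have /(le_trans _) : (\int[leb]_(s in \bigcup_k `[n, (n + k.+1%:R)%R]%classic) (s `^ (- b - 1))%:E
    <= (n `^ (- b) / b)%:E)%E.
  apply: integral_powR_bigcup_le.
  - move=> i j ij; apply/subsetPset => s /=; rewrite !in_itv /= => /andP[-> h] /=.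
    by apply: le_trans h _; rewrite lerD2l ler_nat ltnS.
  - by move=> k; exact: measurable_itv.
  - move=> k; rewrite integral_powR_itv// ?ltrDl ?ltr0n//.
    rewrite lee_fin !invrN !mulrN opprK addrC lerBlDr lerDl divr_ge0 ?powR_ge0 ?(ltW b0)//.
apply.
rewrite [leLHS]integral_mkcond [leRHS]integral_mkcond; apply: ge0_le_integral => //.
- by move=> s _; rewrite patchE; case: ifPn => // _; rewrite lee_fin mulr_ge0 ?powR_ge0.
- apply: (iffLR (measurable_restrictT _ (measurable_itv `]0%R, +oo[))).
  apply: measurable_funTS; apply/measurable_EFinP; apply: measurable_funM; last exact: measurable_powR.
  rewrite (_ : (fun s : R => _) = (\1_(`[n, +oo[%classic) : R -> R)).
    by apply: measurable_indic; exact: measurable_itv.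
  by apply/funext => s; rewrite indicE mem_setE in_itv /= andbT.
- apply: (iffLR (measurable_restrictT _ _)); last exact: measurable_powR_itv.
  by apply: bigcupT_measurable => k; exact: measurable_itv.
- move=> s _; rewrite !patchE; case: ifPn; last first.
    by move=> _; case: ifPn => // _; rewrite lee_fin powR_ge0.
  rewrite inE /= in_itv /= andbT => s0.
  have [ns|ns] := leP n s; last by rewrite mul0r; case: ifPn => // _; rewrite lee_fin powR_ge0.
  rewrite mul1r mem_set// /bigcup /=.
  exists (Num.truncn s) => //=; rewrite in_itv /= ns /=.
  apply: le_trans (ltW (truncnS_gt s)) _; rewrite lerDr; exact: ltW.
Qed.

(** One half of the layer-cake formula. The integral is cut at a point a > 0 with a^q <= e, so the
    cut costs at most e, and e is arbitrary. *)
Lemma powR_le_integral (q y : R) : 1 < q -> 0 <= y ->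
  ((y `^ q)%:E <= \int[leb]_(s in `]0%R, +oo[) ((s < y)%R%:R * (q * s `^ (q - 1)))%:E)%E.
Proof.
move=> q1 y0; have q0 : 0 < q by exact: lt_trans q1.
have i0 : (0 <= \int[leb]_(s in `]0%R, +oo[) ((s < y)%R%:R * (q * s `^ (q - 1)))%:E)%E.
  by apply: integral_ge0 => s _; rewrite lee_fin !mulr_ge0 ?powR_ge0// ltW.
apply/lee_addgt0Pr => e e0.
pose a := Num.min e 1 `^ (q^-1).
have m0 : 0 < Num.min e 1 by rewrite lt_min e0 ltr01.
have a0 : 0 < a by rewrite powR_gt0.
have aq : a `^ q <= e by rewrite /a -powRrM mulVf ?gt_eqF// powRr1 ?(ltW m0)// ge_min lexx.
have [ya|ay] := leP y a.
  apply: le_trans (leeDr _ i0); rewrite lee_fin; apply: le_trans aq.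
  by rewrite ge0_ler_powR// ?nnegrE// ltW.
have /(le_trans _) : ((y `^ q - a `^ q)%:E + e%:E <=
  \int[leb]_(s in `]0%R, +oo[) ((s < y)%R%:R * (q * s `^ (q - 1)))%:E + e%:E)%E.
  rewrite leeD2r//.
  have -> : (y `^ q - a `^ q)%:E = (\int[leb]_(s in `[a, y]) (q%:E * (s `^ (q - 1))%:E))%E.
    rewrite ge0_integralZl_EFin ?ltW//.
    - rewrite integral_powR_itv ?gt_eqF// -EFinM; congr _%:E; field; lra.
    - by move=> s _; rewrite lee_fin powR_ge0.
    - exact: measurable_powR_itv.
  rewrite [leLHS](_ : _ = \int[leb]_(s in `[a, y[) (q%:E * (s `^ (q - 1))%:E))%E; last first.
    rewrite -integral_itv_bndo_bndc//.
    apply: measurable_funTS; apply: emeasurable_funM => //.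
    exact: measurable_powR_itv.
  rewrite [leLHS]integral_mkcond [leRHS]integral_mkcond; apply: ge0_le_integral => //.
  - by move=> s _; rewrite patchE; case: ifPn => // _; rewrite -EFinM lee_fin mulr_ge0 ?powR_ge0// ltW.
  - apply: (iffLR (measurable_restrictT _ (measurable_itv `[a, y[))).
    apply: emeasurable_funM => //; exact: measurable_powR_itv.
  - apply: (iffLR (measurable_restrictT _ (measurable_itv `]0%R, +oo[))).
    apply: measurable_funTS; apply/measurable_EFinP; apply: measurable_funM.
      rewrite (_ : (fun s : R => _) = (\1_(`]-oo, y[%classic) : R -> R)).
        by apply: measurable_indic; exact: measurable_itv.
      by apply/funext => s; rewrite indicE mem_setE in_itv.
    by apply: measurable_funM => //; exact: measurable_powR.
  - move=> s _; rewrite !patchE; case: ifPn.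
      rewrite inE /= in_itv /= => /andP[as_ sy].
      rewrite mem_set ?sy ?mul1r//= in_itv /= andbT; exact: lt_le_trans as_.
    by move=> _; case: ifPn => // _; rewrite lee_fin !mulr_ge0 ?powR_ge0// ltW.
apply; rewrite -EFinD lee_fin; lra.
Qed.

End power_integrals.

(** * Strong-type bound for the potentials T_kap *)

Section HLS.
Context {R : realType} (d : nat) (th l : R).
Hypothesis l_gt0 : 0 < l.
Local Notation leb := (@lebesgue_measure R).
Local Notation M := (@PH R d).
Local Notation mu := (phase_measure d).
Local Notation ker := (@kker R d th l).
Local Notation c0 := (@kmass R d l).
Local Notation N := (@hdim R d th + 1).

Lemma measurable_ltr_nat dY (Y : measurableType dY) (f g : Y -> R) :
  measurable_fun setT f -> measurable_fun setT g ->
  measurable_fun setT (fun x => (f x < g x)%R%:R : R).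
Proof.
move=> mf mg; rewrite (_ : (fun x => _) = \1_[set x | f x < g x]).
  by apply: measurable_indic; exact: measurable_set_ltr.
by apply/funext => x; rewrite indicE mem_setE.
Qed.

Lemma measurable_ler_nat dY (Y : measurableType dY) (f g : Y -> R) :
  measurable_fun setT f -> measurable_fun setT g ->
  measurable_fun setT (fun x => (f x <= g x)%R%:R : R).
Proof.
move=> mf mg; rewrite (_ : (fun x => _) = \1_[set x | f x <= g x]).
  by apply: measurable_indic; exact: measurable_set_ler.
by apply/funext => x; rewrite indicE mem_setE.
Qed.

Lemma integral_pos_itvE (g : R -> R) :
  (\int[leb]_(s in `]0%R, +oo[) (g s)%:E = \int[leb]_s ((0 < s)%R%:R * g s)%:E)%E.
Proof.
rewrite integral_mkcond; apply: eq_integral => s _; rewrite patchE mem_setE in_itv /= andbT.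
by case: ifPn => _; rewrite ?mul1r ?mul0r.
Qed.

(** Young's inequality for dl^(1/P) a and dl^(-1/P) b, the factors 1/P and 1/P' being bounded by 1.
    The free weight [dl] will be the level v. *)
Lemma young_powR (P P' a b dl : R) : 0 < P -> 0 < P' -> P^-1 + P'^-1 = 1 -> 0 < dl ->
  0 <= a -> 0 <= b -> a * b <= dl * a `^ P + dl `^ (- (P' / P)) * b `^ P'.
Proof.
move=> P0 P'0 PP' d0 a0 b0.
have P1 : P^-1 <= 1 by rewrite -PP' lerDl invr_ge0 ltW.
have P'1 : P'^-1 <= 1 by rewrite -PP' lerDr invr_ge0 ltW.
have -> : a * b = (dl `^ P^-1 * a) * (dl `^ (- P^-1) * b).
  by rewrite mulrACA -powRD ?(gt_eqF d0) ?implybT// subrr powRr0 mul1r.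
have := @conjugate_powR R (dl `^ P^-1 * a) (dl `^ (- P^-1) * b) P P'.
move=> /(_ (mulr_ge0 (powR_ge0 _ _) a0) (mulr_ge0 (powR_ge0 _ _) b0) P0 P'0 PP').
move=> /le_trans; apply.
rewrite !powRM ?powR_ge0// -!powRrM mulVf ?gt_eqF// powRr1 ?(ltW d0)//.
rewrite mulNr [P^-1 * P']mulrC; apply: lerD.
- by rewrite ler_piMr// mulr_ge0 ?powR_ge0 ?(ltW d0).
- by rewrite ler_piMr// mulr_ge0 ?powR_ge0.
Qed.

Variables (P P' kap q : R).
Hypotheses (P_gt1 : 1 < P) (PP' : P^-1 + P'^-1 = 1) (kap_gt0 : 0 < kap) (q_gt1 : 1 < q)
  (N_gt0 : 0 < N) (qE : q^-1 = P^-1 - kap / N).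

Definition rpot (F : M -> R) (z0 : M) : \bar R :=
  (\int[mu]_z (F z * (tau z0 z `^ (kap - 1) * ker z0 z))%:E)%E.

Let P_gt0 : 0 < P. Proof. exact: lt_trans P_gt1. Qed.
Let q_gt0 : 0 < q. Proof. exact: lt_trans q_gt1. Qed.
Let P'_gt0 : 0 < P'.
Proof.
rewrite -invr_gt0; have : P^-1 < 1 by rewrite invf_lt1.
by move: PP'; lra.
Qed.
Let c0_gt0 : 0 < c0. Proof. by rewrite exprn_gt0// mulr_gt0. Qed.
Let l_ge0 : 0 <= l. Proof. exact: ltW. Qed.
(** Comes from raising tau^(kap - 1 - hdim) to the power P': by [qE], (kap - 1 - hdim) P' = (- e -
    1) - hdim, and the last term is that of one kernel. *)
Let e : R := P' * N / q.
Let e_gt0 : 0 < e. Proof. by rewrite divr_gt0// mulr_gt0. Qed.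
Let A0 : R := (c0 / e) `^ e^-1.
Let A0_gt0 : 0 < A0. Proof. by rewrite powR_gt0// divr_gt0. Qed.
(** At level v the potential is split at time distance [nn v] and F at height [mm v]. [A0] and [B0]
    are fixed so that the far kernel term and the low part both come out as exactly v, see [nn_e]
    and [mm_nn]. *)
Let nn (v : R) : R := A0 * v `^ (- (q / N)).
Let B0 : R := kap / (c0 * A0 `^ kap).
Let B0_gt0 : 0 < B0. Proof. by rewrite divr_gt0// mulr_gt0// powR_gt0. Qed.
Let mm (v : R) : R := B0 * v `^ (q / P).

Let qPN : q / P = 1 + q * kap / N.
Proof.
have : q * q^-1 = 1 by rewrite mulfV ?gt_eqF.
by rewrite qE mulrBr => /eqP; rewrite subr_eq => /eqP ->; rewrite mulrA.
Qed.

Let mm_nn v : 0 < v -> mm v * (c0 * (nn v `^ kap / kap)) = v.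
Proof.
move=> v0; rewrite /mm /nn powRM ?powR_ge0 ?ltW// -powRrM /B0 qPN.
rewrite powRD ?(gt_eqF v0) ?implybT// powRr1 ?ltW//.
rewrite (_ : - (q / N) * kap = - (q * kap / N)); last by ring.
rewrite powRN; field.
by apply/and4P; split; apply: lt0r_neq0 => //; [exact: powR_gt0 v0|exact: powR_gt0 A0_gt0].
Qed.

Let nn_e v : 0 < v -> v `^ (- (P' / P)) * (c0 * (nn v `^ (- e) / e)) = v.
Proof.
move=> v0; rewrite /nn powRM ?powR_ge0 ?ltW// -powRrM /A0 -powRrM.
rewrite (_ : e^-1 * - e = -1); last by rewrite mulrN mulVf ?gt_eqF.
rewrite (_ : - (q / N) * - e = P'); last by rewrite mulrNN /e; field; rewrite !gt_eqF.
rewrite powR_inv1; last by rewrite ltW// divr_gt0.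
rewrite (_ : - (P' / P) = 1 - P'); last first.
  have : P' * (P^-1 + P'^-1) = P' by rewrite PP' mulr1.
  by rewrite mulrDr mulfV ?gt_eqF//; lra.
rewrite powRB ?(gt_eqF v0) ?implybT// powRr1 ?ltW//; field.
by rewrite !gt_eqF ?powR_gt0.
Qed.

Let nn_gt0 v : 0 < v -> 0 < nn v. Proof. by move=> v0; exact: mulr_gt0 A0_gt0 (powR_gt0 _ v0). Qed.

Variable F : M -> R.
Hypotheses (mF : measurable_fun setT F) (F0 : forall z, 0 <= F z)
  (F1 : (\int[mu]_z (F z `^ P)%:E <= 1)%E).

Let mtp z0 a : measurable_fun setT (fun z : M => tau z0 z `^ a).
Proof. by apply: (measurableT_comp (measurable_powR a)); exact: measurable_tau2. Qed.

(** Young with weight v: the F-term costs at most v because the L^P norm of F is at most 1, the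
    kernel term costs v by the choice of [nn]. *)
Lemma rpot_far v z0 : 0 < v ->
  (\int[mu]_z (F z * ((nn v <= tau z0 z)%R%:R * tau z0 z `^ (kap - 1) * ker z0 z))%:E
    <= (2 * v)%:E)%E.
Proof.
move=> v0.
apply: (@le_trans _ _ (\int[mu]_z (v%:E * (F z `^ P)%:E + (v `^ (- (P' / P)))%:E *
   ((nn v <= tau z0 z)%R%:R * tau z0 z `^ (- e - 1) * ker z0 z)%:E))%E).
  apply: ge0_le_integral => //.
  - by move=> z _; rewrite lee_fin !mulr_ge0 ?powR_ge0 ?kker_ge0.
  - apply/measurable_EFinP/measurable_funM => //; apply: measurable_funM; last exact: measurable_kker2.
    apply: measurable_funM => //; apply: measurable_ler_nat => //; exact: measurable_tau2.
  - apply/measurable_EFinP; apply: measurable_funD; apply: measurable_funM => //.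
      by apply: (measurableT_comp (measurable_powR P)).
    apply: measurable_funM; last exact: measurable_kker2.
    apply: measurable_funM => //; apply: measurable_ler_nat => //; exact: measurable_tau2.
  - move=> z _; rewrite -!EFinM -EFinD lee_fin.
    have := young_powR P_gt0 P'_gt0 PP' v0 (F0 z)
      (mulr_ge0 (mulr_ge0 (ler0n _ (nn v <= tau z0 z)%R) (powR_ge0 (tau z0 z) (kap - 1))) (kker_ge0 th l z0 z)).
    move=> /le_trans; apply; rewrite lerD2l ler_pM2l ?powR_gt0//.
    rewrite /kker; have [nt|nt] := leP (nn v) (tau z0 z); last by rewrite !mul0r powR0// gt_eqF.
    have t0 : 0 < tau z0 z by exact: lt_le_trans (nn_gt0 v0) nt.
    rewrite !mul1r indicE; case: (_ \in _); last by rewrite !mul0r mulr0 powR0 ?gt_eqF.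
    rewrite !mul1r -!powRD ?(gt_eqF t0) ?implybT// -powRrM le_eqVlt; apply/orP; left; apply/eqP.
    congr (_ `^ _).
    have h1 : P' * N / q = P' * N * (P^-1 - kap / N) by rewrite -qE.
    have h2 : P' * P^-1 = P' - 1.
      have : P' * (P^-1 + P'^-1) = P' by rewrite PP' mulr1.
      by rewrite mulrDr [P' / P']mulfV ?gt_eqF//; lra.
    have h3 : P' * N * (P^-1 - kap / N) = (P' - 1) * N - P' * kap.
      rewrite -h2; field; rewrite !gt_eqF//.
    by rewrite /e h1 h3; ring.
rewrite ge0_integralD//; last 4 first.
- by move=> z _; rewrite -EFinM lee_fin mulr_ge0 ?powR_ge0// ltW.
- apply/measurable_EFinP; apply: measurable_funM => //.
  by apply: (measurableT_comp (measurable_powR P)).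
- by move=> z _; rewrite -EFinM lee_fin !mulr_ge0 ?powR_ge0 ?kker_ge0.
- apply/measurable_EFinP; apply: measurable_funM => //; apply: measurable_funM; last exact: measurable_kker2.
  apply: measurable_funM => //; apply: measurable_ler_nat => //; exact: measurable_tau2.
rewrite mulrDl mul1r EFinD; apply: leeD.
- rewrite ge0_integralZl_EFin; [|exact: measurableT| | |exact: ltW].
  + by rewrite -[leRHS]mule1 lee_pmul2l// ?fin_numE// lte_fin.
  + by move=> z _; rewrite lee_fin powR_ge0.
  + apply/measurable_EFinP; by apply: (measurableT_comp (measurable_powR P)).
- rewrite ge0_integralZl_EFin; [|exact: measurableT| | |exact: powR_ge0]; last 2 first.
  + by move=> z _; rewrite lee_fin !mulr_ge0 ?powR_ge0 ?kker_ge0.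
  + apply/measurable_EFinP; apply: measurable_funM; last exact: measurable_kker2.
    apply: measurable_funM => //; apply: measurable_ler_nat => //; exact: measurable_tau2.
  rewrite (@kker_mass2 R d th l l_ge0 (fun s => (nn v <= s)%R%:R * s `^ (- e - 1))); last 2 first.
  + apply: measurable_funM; last exact: measurable_powR.
    exact: (@measurable_ler_nat _ (measurableTypeR R)).
  + by move=> s; rewrite mulr_ge0 ?powR_ge0.
  apply: (@le_trans _ _ ((v `^ (- (P' / P)))%:E * (c0%:E * (nn v `^ (- e) / e)%:E))%E).
    rewrite lee_pmul2l ?lte_fin ?powR_gt0// lee_pmul2l ?lte_fin//.
    exact: (integral_powR_ge e_gt0 (nn_gt0 v0)).
  by rewrite -!EFinM nn_e.
Qed.

(** Replacing F by [mm v] leaves the kernel mass below [nn v], and [B0] makes the product equal to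
    v. *)
Lemma rpot_low v z0 : 0 < v ->
  (\int[mu]_z (F z * (F z <= mm v)%R%:R * ((tau z0 z < nn v)%R%:R * tau z0 z `^ (kap - 1) * ker z0 z))%:E
    <= v%:E)%E.
Proof.
move=> v0.
have mm0 : 0 <= mm v by rewrite mulr_ge0 ?powR_ge0 ?ltW.
apply: (@le_trans _ _ (\int[mu]_z ((mm v)%:E *
   (((tau z0 z < nn v)%R%:R * tau z0 z `^ (kap - 1)) * ker z0 z)%:E))%E).
  apply: ge0_le_integral => //.
  - by move=> z _; rewrite lee_fin !mulr_ge0 ?powR_ge0 ?kker_ge0.
  - apply/measurable_EFinP/measurable_funM.
      by apply: measurable_funM => //; exact: measurable_ler_nat.
    apply: measurable_funM; last exact: measurable_kker2.
    apply: measurable_funM => //; apply: measurable_ltr_nat => //; exact: measurable_tau2.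
  - apply/measurable_EFinP/measurable_funM => //; apply: measurable_funM; last exact: measurable_kker2.
    apply: measurable_funM => //; apply: measurable_ltr_nat => //; exact: measurable_tau2.
  - move=> z _; rewrite -EFinM lee_fin ler_wpM2r ?mulr_ge0 ?powR_ge0 ?kker_ge0//.
    by have [h|h] := leP (F z) (mm v); rewrite ?mulr1 ?mulr0.
rewrite ge0_integralZl_EFin; [|exact: measurableT| | |by []]; last 2 first.
- by move=> z _; rewrite lee_fin !mulr_ge0 ?powR_ge0 ?kker_ge0.
- apply/measurable_EFinP; apply: measurable_funM; last exact: measurable_kker2.
  apply: measurable_funM => //; apply: measurable_ltr_nat => //; exact: measurable_tau2.
rewrite (@kker_mass2 R d th l l_ge0 (fun s => (s < nn v)%R%:R * s `^ (kap - 1))); last 2 first.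
- apply: measurable_funM; last exact: measurable_powR.
  exact: (@measurable_ltr_nat _ (measurableTypeR R)).
- by move=> s; rewrite mulr_ge0 ?powR_ge0.
apply: (@le_trans _ _ ((mm v)%:E * (c0%:E * (nn v `^ kap / kap)%:E))%E).
  rewrite lee_wpmul2l ?lee_fin// lee_pmul2l ?lte_fin//.
  have := integral_powR_lt (nn v) kap_gt0.
  by rewrite (_ : Num.max (nn v) 0 = nn v)//; apply/max_idPl; rewrite ltW// nn_gt0.
by rewrite -!EFinM mm_nn.
Qed.

(** The part covered by neither estimate: F large, and close to z0 in time. *)
Let W (v : R) (z0 z : M) : R :=
  F z * (mm v < F z)%R%:R * ((tau z0 z < nn v)%R%:R * tau z0 z `^ (kap - 1) * ker z0 z).

Let W_ge0 v z0 z : 0 <= W v z0 z.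
Proof. by rewrite !mulr_ge0 ?powR_ge0 ?kker_ge0. Qed.

Let mW1 v z0 : measurable_fun setT (W v z0).
Proof.
apply: measurable_funM; first by apply: measurable_funM => //; exact: measurable_ltr_nat.
apply: measurable_funM; last exact: measurable_kker2.
apply: measurable_funM => //; apply: measurable_ltr_nat => //; exact: measurable_tau2.
Qed.

Lemma rpot_split v z0 : 0 < v ->
  (rpot F z0 <= (3 * v)%:E + \int[mu]_z (W v z0 z)%:E)%E.
Proof.
move=> v0; rewrite /rpot.
pose f1 z := F z * ((nn v <= tau z0 z)%R%:R * tau z0 z `^ (kap - 1) * ker z0 z).
pose f2 z := F z * (F z <= mm v)%R%:R * ((tau z0 z < nn v)%R%:R * tau z0 z `^ (kap - 1) * ker z0 z).
have mf1 : measurable_fun setT f1.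
  apply/measurable_funM => //; apply: measurable_funM; last exact: measurable_kker2.
  apply: measurable_funM => //; apply: measurable_ler_nat => //; exact: measurable_tau2.
have mf2 : measurable_fun setT f2.
  apply/measurable_funM; first by apply: measurable_funM => //; exact: measurable_ler_nat.
  apply: measurable_funM; last exact: measurable_kker2.
  apply: measurable_funM => //; apply: measurable_ltr_nat => //; exact: measurable_tau2.
have f10 z : 0 <= f1 z by rewrite !mulr_ge0 ?powR_ge0 ?kker_ge0.
have f20 z : 0 <= f2 z by rewrite !mulr_ge0 ?powR_ge0 ?kker_ge0.
rewrite (eq_integral (fun z => ((f1 z)%:E + (f2 z)%:E) + (W v z0 z)%:E)%E); last first.
  move=> z _; rewrite -!EFinD; congr _%:E; rewrite /f1 /f2 /W.
  by have [h|h] := leP (nn v) (tau z0 z); have [g|g] := leP (F z) (mm v);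
    rewrite ?mul1r ?mul0r ?mulr0 ?mulr1 ?mul0r ?addr0 ?add0r.
rewrite ge0_integralD//; last 4 first.
- by move=> z _; rewrite -EFinD lee_fin addr_ge0.
- by apply/measurable_EFinP; exact: measurable_funD.
- by move=> z _; rewrite lee_fin.
- by apply/measurable_EFinP.
apply: leeD => //; rewrite ge0_integralD//; last 4 first.
- by move=> z _; rewrite lee_fin.
- by apply/measurable_EFinP.
- by move=> z _; rewrite lee_fin.
- by apply/measurable_EFinP.
rewrite (_ : 3 * v = 2 * v + v); last by ring.
by rewrite EFinD; apply: leeD; [exact: rpot_far|exact: rpot_low].
Qed.

Let mn : measurable_fun setT (nn : measurableTypeR R -> R).
Proof. by apply: measurable_funM => //; exact: measurable_powR. Qed.

Let mmm : measurable_fun setT (mm : measurableTypeR R -> R).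
Proof. by apply: measurable_funM => //; exact: measurable_powR. Qed.

Let mW : measurable_fun setT (fun p : (measurableTypeR R * M) * M => W p.1.1 p.1.2 p.2).
Proof.
have mFp : measurable_fun setT (fun p : (measurableTypeR R * M) * M => F p.2).
  exact: (measurableT_comp mF).
have mtau : measurable_fun setT (fun p : (measurableTypeR R * M) * M => tau p.1.2 p.2).
  suff : measurable_fun setT ((fun p : M * M => tau p.1 p.2) \o
    (fun p : (measurableTypeR R * M) * M => (p.1.2, p.2))) by [].
  apply: measurableT_comp; first exact: measurable_tau.
  by apply: measurable_fun_pair => //; exact: measurableT_comp.
have m11 : measurable_fun setT (fun p : (measurableTypeR R * M) * M => p.1.1).
  exact: measurableT_comp.
apply: measurable_funM.
  apply: measurable_funM => //; apply: measurable_ltr_nat => //.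
  exact: (measurableT_comp mmm m11).
apply: measurable_funM; last first.
  suff : measurable_fun setT ((fun p : M * M => ker p.1 p.2) \o
    (fun p : (measurableTypeR R * M) * M => (p.1.2, p.2))) by [].
  apply: measurableT_comp; first exact: measurable_kker.
  by apply: measurable_fun_pair => //; exact: measurableT_comp.
apply: measurable_funM.
  apply: measurable_ltr_nat => //; exact: (measurableT_comp mn m11).
exact: (measurableT_comp (measurable_powR (kap - 1)) mtau).
Qed.

(** The layer-cake density q v^(q - 1) divided by v. *)
Let wt (v : R) : R := (0 < v)%R%:R * (q * v `^ (q - 2)).

Let wt_ge0 v : 0 <= wt v.
Proof. by rewrite mulr_ge0// mulr_ge0 ?powR_ge0// ltW. Qed.

Let mwt : measurable_fun setT (wt : measurableTypeR R -> R).
Proof.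
apply: measurable_funM; first exact: (@measurable_ltr_nat _ (measurableTypeR R)).
by apply: measurable_funM => //; exact: measurable_powR.
Qed.

Let CW (v : R) (z0 : M) : \bar R := (\int[mu]_z (W v z0 z)%:E)%E.

Let CW_ge0 v z0 : (0 <= CW v z0)%E.
Proof. by apply: integral_ge0 => z _; rewrite lee_fin. Qed.

Let mCW : measurable_fun setT (fun p : measurableTypeR R * M => CW p.1 p.2).
Proof.
apply: (@measurable_fun_integral_param _ _ _ (measurableTypeR R * M)%type M mu
   (fun p => (W p.1.1 p.1.2 p.2)%:E)).
exact/measurable_EFinP.
Qed.

(** If 4 v < y, then y <= 3 v + [CW v z0] forces [CW v z0] >= v. The layer-cake density q v^(q - 1)
    is therefore at most q v^(q - 2) [CW v z0] for v < y / 4. *)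
Lemma rpot_layer (y : R) z0 : 0 <= y -> (y%:E <= rpot F z0)%E ->
  (((y / 4) `^ q)%:E <= \int[leb]_v ((wt v)%:E * CW v z0))%E.
Proof.
move=> y0 yT; have y40 : 0 <= y / 4 by rewrite divr_ge0.
apply: (le_trans (powR_le_integral q_gt1 y40)).
rewrite integral_pos_itvE; apply: ge0_le_integral => //.
- by move=> v _; rewrite lee_fin !mulr_ge0 ?powR_ge0// ltW.
- apply/measurable_EFinP; apply: measurable_funM; first exact: (@measurable_ltr_nat _ (measurableTypeR R)).
  apply: measurable_funM; first exact: (@measurable_ltr_nat _ (measurableTypeR R)).
  by apply: measurable_funM => //; exact: measurable_powR.
- apply: emeasurable_funM; first exact/measurable_EFinP.
  suff : measurable_fun setT ((fun p : measurableTypeR R * M => CW p.1 p.2) \o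
    (fun v : measurableTypeR R => (v, z0))) by [].
  by apply: measurableT_comp; [exact: mCW|exact: measurable_fun_pair].
- move=> v _; rewrite /wt.
  have [v0|v0] := ltP 0 v; last by rewrite !mul0r mul0e.
  have [vy|vy] := ltP v (y / 4); last first.
    by rewrite mul0r mulr0 mule_ge0// lee_fin mul1r mulr_ge0 ?powR_ge0// ltW.
  rewrite !mul1r (_ : q - 1 = (q - 2) + 1); last by ring.
  rewrite powRD ?(gt_eqF v0) ?implybT// powRr1 ?(ltW v0)// mulrA EFinM.
  apply: lee_wpmul2l; first by rewrite lee_fin mulr_ge0 ?powR_ge0// ltW.
  have := le_trans yT (rpot_split z0 v0); rewrite -/(CW v z0).
  have : 4 * v <= y by move: vy; lra.
  case: (CW v z0) (CW_ge0 v z0) => [c| |] //= c0' yv; last by move=> _; rewrite leey.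
  by rewrite -EFinD !lee_fin => h; lra.
Qed.

(** The quotient v / [mm v], which by [mm_nn] is the kernel mass below [nn v]. *)
Let vm (v : R) : R := B0^-1 * v `^ (1 - q / P).

Let vm_ge0 v : 0 <= vm v. Proof. by rewrite mulr_ge0 ?powR_ge0// invr_ge0 ltW. Qed.

Let Hx_ge0 x v : 0 <= x -> 0 <= x * (mm v < x)%R%:R * vm v.
Proof. by move=> x0; apply: mulr_ge0 => //; exact: mulr_ge0. Qed.

Let mvm : measurable_fun setT (vm : measurableTypeR R -> R).
Proof. by apply: measurable_funM => //; exact: measurable_powR. Qed.

Let vmE v : 0 < v -> vm v * mm v = v.
Proof.
move=> v0; rewrite /vm /mm mulrACA mulVf ?gt_eqF// mul1r.
by rewrite -powRD ?(gt_eqF v0) ?implybT// subrK powRr1// ltW.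
Qed.

(** The factors in F do not depend on z0, so only the kernel mass in its first variable remains. *)
Let Hin v z : 0 < v ->
  (\int[mu]_z0 (W v z0 z)%:E <= (F z * (mm v < F z)%R%:R * vm v)%:E)%E.
Proof.
move=> v0; have mm0 : 0 < mm v by exact: mulr_gt0 B0_gt0 (powR_gt0 _ v0).
under eq_integral do rewrite /W EFinM.
rewrite ge0_integralZl_EFin; [|exact: measurableT| | |by rewrite mulr_ge0]; last 2 first.
- by move=> z0 _; rewrite lee_fin !mulr_ge0 ?powR_ge0 ?kker_ge0.
- apply/measurable_EFinP; apply: measurable_funM; last exact: measurable_kker1.
  apply: measurable_funM; last by apply: (measurableT_comp (measurable_powR (kap - 1))); exact: measurable_tau1.
  apply: measurable_ltr_nat => //; exact: measurable_tau1.
rewrite (@kker_mass1 R d th l l_ge0 (fun s => (s < nn v)%R%:R * s `^ (kap - 1))); last 2 first.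
- apply: measurable_funM; last exact: measurable_powR.
  exact: (@measurable_ltr_nat _ (measurableTypeR R)).
- by move=> s; rewrite mulr_ge0 ?powR_ge0.
rewrite [leRHS]EFinM; apply: lee_wpmul2l; first by rewrite lee_fin mulr_ge0.
apply: (@le_trans _ _ (c0%:E * (nn v `^ kap / kap)%:E)%E).
  rewrite lee_pmul2l ?lte_fin//.
  have := integral_powR_lt (nn v) kap_gt0.
  by rewrite (_ : Num.max (nn v) 0 = nn v)//; apply/max_idPl; rewrite ltW// nn_gt0.
rewrite -EFinM lee_fin.
have h : mm v * (c0 * (nn v `^ kap / kap)) = mm v * vm v by rewrite mm_nn// mulrC vmE.
by rewrite (mulfI (lt0r_neq0 mm0) h).
Qed.

Let b : R := q - q / P.
Let b_gt0 : 0 < b.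
Proof. by rewrite subr_gt0 ltr_pdivrMr// ltr_pMr. Qed.

Let qB0 : 0 <= q / B0. Proof. exact: ltW (divr_gt0 q_gt0 B0_gt0). Qed.

Let cst0 : 0 <= q / B0 * (B0 `^ (- (P - 1)) / b).
Proof. exact: mulr_ge0 qB0 (divr_ge0 (powR_ge0 _ _) (ltW b_gt0)). Qed.

Definition HLS_const : R := 4 `^ q * (q / B0 * (B0 `^ (- (P - 1)) / b)).

(** [mm v < x] means v < Y with Y = (x / B0)^(P / q), and v^(b - 1) integrates to Y^b / b up to Y.
    As (P / q) b = P - 1, the extra factor x produces x^P. *)
Let Hout (x : R) : 0 <= x ->
  (\int[leb]_v (wt v * (x * (mm v < x)%R%:R * vm v))%:E <=
    (q / B0 * (B0 `^ (- (P - 1)) / b) * x `^ P)%:E)%E.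
Proof.
move=> x0; pose Y : R := (x / B0) `^ (P / q).
have xB0 : 0 <= x / B0 by rewrite divr_ge0// ltW.
have Y0 : 0 <= Y by rewrite powR_ge0.
have Pq0 : 0 < P / q by rewrite divr_gt0.
apply: (@le_trans _ _ (\int[leb]_v ((x * (q / B0))%:E * ((0 < v)%R%:R * ((v < Y)%R%:R * v `^ (b - 1)))%:E))%E).
  apply: ge0_le_integral => //.
  - by move=> v _; rewrite lee_fin; apply: mulr_ge0 => //; exact: Hx_ge0.
  - apply/measurable_EFinP; apply: measurable_funM => //; apply: measurable_funM => //.
    apply: measurable_funM => //; exact: (@measurable_ltr_nat _ (measurableTypeR R)).
  - apply/measurable_EFinP; apply: measurable_funM => //.
    apply: measurable_funM; first exact: (@measurable_ltr_nat _ (measurableTypeR R)).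
    apply: measurable_funM; first exact: (@measurable_ltr_nat _ (measurableTypeR R)).
    exact: measurable_powR.
  - move=> v _; rewrite -EFinM lee_fin /wt.
    have [v0|v0] := ltP 0 v; last by rewrite !mul0r mulr0.
    have [h|h] := ltP (mm v) x; last first.
      rewrite mulr0 mul0r mulr0; apply: mulr_ge0; first by exact: mulr_ge0 x0 qB0.
      by rewrite mul1r mulr_ge0 ?powR_ge0.
    have -> : v < Y.
      rewrite /Y; have : v `^ (q / P) < x / B0 by rewrite ltr_pdivlMr// mulrC.
      move=> /(gt0_ltr_powR Pq0); rewrite !nnegrE powR_ge0 => /(_ isT xB0).
      by rewrite -powRrM (_ : q / P * (P / q) = 1) ?powRr1 ?ltW//; field; rewrite !gt_eqF.
    rewrite !mul1r mulr1 /vm le_eqVlt; apply/orP; left; apply/eqP.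
    rewrite /b (_ : q - q / P - 1 = (q - 2) + (1 - q / P)); last by ring.
    have -> : v `^ (q - 2 + (1 - q / P)) = v `^ (q - 2) * v `^ (1 - q / P).
      by rewrite powRD ?(gt_eqF v0) ?implybT.
    by ring.
rewrite ge0_integralZl_EFin; [|exact: measurableT| | |]; last 3 first.
- by move=> v _; rewrite lee_fin !mulr_ge0 ?powR_ge0.
- apply/measurable_EFinP; apply: measurable_funM; first exact: (@measurable_ltr_nat _ (measurableTypeR R)).
  apply: measurable_funM; first exact: (@measurable_ltr_nat _ (measurableTypeR R)).
  exact: measurable_powR.
- exact: mulr_ge0 x0 qB0.
rewrite -integral_pos_itvE.
apply: (@le_trans _ _ ((x * (q / B0))%:E * (Y `^ b / b)%:E)%E).
  apply: lee_wpmul2l; first by rewrite lee_fin; exact: mulr_ge0 x0 qB0.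
  have := integral_powR_lt Y b_gt0.
  by rewrite (_ : Num.max Y 0 = Y)//; exact/max_idPl.
rewrite -EFinM lee_fin le_eqVlt; apply/orP; left; apply/eqP.
rewrite /Y -powRrM (_ : P / q * b = P - 1); last first.
  by rewrite /b; field; rewrite !gt_eqF.
rewrite powRM ?invr_ge0 ?(ltW B0_gt0)// -powR_inv1 ?(ltW B0_gt0)// -powRrM mulN1r.
rewrite -[x `^ P](@mulr_powRB1 _ x P)//; ring.
Qed.

(* At each level [v] the part of the potential far from [z0] is at most [2 v] (Young) and
   the part with [F <= mm v] near [z0] is at most [v]; hence only large values of [F] near
   [z0] contribute to the level set, and the layer-cake formula with Tonelli sums them. *)
Theorem rpot_strong_type (y : M -> R) : measurable_fun setT y -> (forall z, 0 <= y z) ->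
  (forall z, ((y z)%:E <= rpot F z)%E) -> (\int[mu]_z (y z `^ q)%:E <= HLS_const%:E)%E.
Proof.
move=> my y0 yT.
have mTW : measurable_fun setT (fun p : M * measurableTypeR R => ((wt p.2)%:E * CW p.2 p.1)%E).
  apply: emeasurable_funM; first by apply/measurable_EFinP; exact: (measurableT_comp mwt).
  suff : measurable_fun setT ((fun p : measurableTypeR R * M => CW p.1 p.2) \o
    (fun p : M * measurableTypeR R => (p.2, p.1))) by [].
  by apply: measurableT_comp; [exact: mCW|exact: measurable_fun_pair].
apply: (@le_trans _ _ ((4 `^ q)%:E * \int[mu]_z0 \int[leb]_v ((wt v)%:E * CW v z0))%E).
  rewrite -ge0_integralZl_EFin; [|exact: measurableT| | |exact: powR_ge0]; last 2 first.
  - by move=> z _; apply: integral_ge0 => v _; rewrite mule_ge0// lee_fin.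
  - exact: (@measurable_fun_integral_param _ _ _ M (measurableTypeR R) leb _ mTW).
  apply: ge0_le_integral => //.
  - by move=> z _; rewrite lee_fin powR_ge0.
  - by apply/measurable_EFinP; apply: (measurableT_comp (measurable_powR q)).
  - apply: emeasurable_funM => //.
    exact: (@measurable_fun_integral_param _ _ _ M (measurableTypeR R) leb _ mTW).
  - move=> z _.
    have -> : y z `^ q = 4 `^ q * (y z / 4) `^ q.
      by rewrite -powRM// ?divr_ge0// mulrC mulfVK// pnatr_eq0.
    by rewrite EFinM; apply: lee_wpmul2l; [rewrite lee_fin powR_ge0|exact: rpot_layer].
rewrite /HLS_const EFinM; apply: lee_wpmul2l; first by rewrite lee_fin powR_ge0.
rewrite (@fubini_tonelli _ _ _ _ _ mu leb _ mTW); last first.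
  by move=> p; rewrite mule_ge0// lee_fin.
have mH : measurable_fun setT (fun p : measurableTypeR R * M =>
    (wt p.1 * (F p.2 * (mm p.1 < F p.2)%R%:R * vm p.1))%:E).
  apply/measurable_EFinP; apply: measurable_funM; first exact: (measurableT_comp mwt).
  have m2 : measurable_fun setT (fun p : measurableTypeR R * M => F p.2) by exact: (measurableT_comp mF).
  have m1 : measurable_fun setT (fun p : measurableTypeR R * M => mm p.1) by exact: (measurableT_comp mmm).
  apply: measurable_funM.
    by apply: measurable_funM => //; exact: measurable_ltr_nat.
  exact: (measurableT_comp mvm).
have mCWv v : measurable_fun setT (CW v).
  suff : measurable_fun setT ((fun p : measurableTypeR R * M => CW p.1 p.2) \o
    (fun z : M => (v : measurableTypeR R, z))) by [].
  by apply: measurableT_comp; [exact: mCW|exact: measurable_fun_pair].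
have mTW' : measurable_fun setT (fun p : measurableTypeR R * M => ((wt p.1)%:E * CW p.1 p.2)%E).
  apply: emeasurable_funM => //; apply/measurable_EFinP; exact: (measurableT_comp mwt).
(* For fixed v, integrating z0 first collapses [W] to a function of F z alone, by [Hin]. *)
apply: (@le_trans _ _ (\int[leb]_v \int[mu]_z
    (wt v * (F z * (mm v < F z)%R%:R * vm v))%:E)%E).
  apply: ge0_le_integral; first exact: measurableT.
  - by move=> v _; apply: integral_ge0 => z _; rewrite mule_ge0// lee_fin.
  - exact: (@measurable_fun_integral_param _ _ _ (measurableTypeR R) M mu _ mTW').
  - exact: (@measurable_fun_integral_param _ _ _ (measurableTypeR R) M mu _ mH).
  - move=> v _ /=.
    have mFv : measurable_fun setT (fun z => F z * (mm v < F z)%R%:R * vm v).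
      by apply: measurable_funM => //; apply: measurable_funM => //; exact: measurable_ltr_nat.
    have mWv : measurable_fun setT (fun p : M * M => (W v p.1 p.2)%:E).
      apply/measurable_EFinP.
      suff : measurable_fun setT ((fun p : (measurableTypeR R * M) * M => W p.1.1 p.1.2 p.2) \o
        (fun p : M * M => ((v : measurableTypeR R, p.1), p.2))) by [].
      apply: measurableT_comp; first exact: mW.
      by apply: measurable_fun_pair => //; exact: measurable_fun_pair.
    rewrite ge0_integralZl_EFin; [|exact: measurableT| | |exact: wt_ge0]; last 2 first.
    + by move=> z _.
    + exact: mCWv.
    rewrite /CW (@fubini_tonelli _ _ _ _ _ mu mu _ mWv); last by move=> p; rewrite lee_fin.
    under [leRHS]eq_integral do rewrite EFinM.
    rewrite ge0_integralZl_EFin; [|exact: measurableT| | |exact: wt_ge0]; last 2 first.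
    + by move=> z _; rewrite lee_fin Hx_ge0.
    + by apply/measurable_EFinP.
    have [v0|v0] := ltP 0 v; last by rewrite /wt ltNge v0 /= mul0r !mul0e.
    apply: lee_wpmul2l; first by rewrite lee_fin.
    apply: ge0_le_integral; first exact: measurableT.
    + by move=> z _; apply: integral_ge0 => z0 _; rewrite lee_fin.
    + have := measurable_fun_fubini_tonelli_G (m1 := mu) _ mWv; apply=> p.
      by rewrite lee_fin.
    + by apply/measurable_EFinP.
    + by move=> z _; exact: Hin.
(* The order is exchanged once more: integrating v for fixed z gives a multiple of F^P, by
   [Hout]. *)
rewrite (@fubini_tonelli _ _ _ _ _ leb mu _ mH); last first.
  by move=> p; rewrite lee_fin; apply: mulr_ge0 => //; exact: Hx_ge0.
apply: (@le_trans _ _ (\int[mu]_z ((q / B0 * (B0 `^ (- (P - 1)) / b))%:E * (F z `^ P)%:E))%E).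
  apply: ge0_le_integral; first exact: measurableT.
  - by move=> z _; apply: integral_ge0 => v _; rewrite lee_fin; apply: mulr_ge0 => //; exact: Hx_ge0.
  - have := measurable_fun_fubini_tonelli_G (m1 := leb) _ mH; apply=> p.
    by rewrite lee_fin; apply: mulr_ge0 => //; exact: Hx_ge0.
  - apply: emeasurable_funM => //; apply/measurable_EFinP.
    by apply: (measurableT_comp (measurable_powR P)).
  - by move=> z _; rewrite -EFinM; exact: (Hout (F0 z)).
rewrite ge0_integralZl_EFin; [|exact: measurableT| | |]; last 3 first.
- by move=> z _; rewrite lee_fin powR_ge0.
- by apply/measurable_EFinP; apply: (measurableT_comp (measurable_powR P)).
- exact: cst0.
rewrite -[leRHS]mule1; apply: lee_wpmul2l; last exact: F1.
by rewrite lee_fin; exact: cst0.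
Qed.

End HLS.

(** * Recovering a function from its small-scale averages *)

Lemma phase_ball_lty (R : realType) d (r : R) :
  0 < r -> (phase_measure d (ball (0%R : @phase R d) r : set (PH d)) < +oo)%E.
Proof.
move=> r0.
have mI : measurable (`](- r)%R, r[%classic : set (measurableTypeR R)) by exact: measurable_itv.
have mV := @measurable_rVbox R d 0 r.
pose I : set (measurableTypeR R) := `](- r)%R, r[%classic.
pose V : set (BR R d) := rVbox (0%R : 'rV[R]_d) r.
have mVV : measurable (V `*` V) by exact: (measurableX mV mV).
have mB : measurable (ball (0%R : @phase R d) r : set (PH d)).
  by apply: measurable_phase; apply: sub_sigma_algebra; exact: (@ball_open R (@phase R d)).
have mX : measurable (I `*` (V `*` V) : set (PH d)) by exact: (measurableX mI mVV).
apply: (@le_lt_trans _ _ (phase_measure d (I `*` (V `*` V) : set (PH d)))).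
  apply: (le_measure (phase_measure d) (mem_set mB) (mem_set mX)) => -[t [x v]] [/= h1 [/= h2 h3]].
  split => /=; first by move: h1; rewrite ball_itv /= sub0r add0r.
  split => i /=.
  - by have := h2.2 ord0 i; rewrite /ball /= !mxE distrC => /ltW.
  - by have := h3.2 ord0 i; rewrite /ball /= !mxE distrC => /ltW.
have -> : phase_measure d (I `*` (V `*` V) : set (PH d)) =
    (lebesgue_measure I * (rVmeasure d V * rVmeasure d V))%E.
  rewrite [LHS](product_measure1E _ _ mI mVV).
  by congr (_ * _)%E; exact: (product_measure1E _ _ mV mV).
rewrite !rVmeasure_box ?(ltW r0)// lebesgue_measure_itv /=.
by case: ifP => _; rewrite -?EFinD -?EFinM ?mul0e ?ltey.
Qed.

#[global] Opaque phase_measure.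

Section averages.
Context {R : realType} (d : nat) (th l : R).
Hypotheses (l_gt0 : 0 < l) (th_gt0 : 0 < th).
Local Notation leb := (@lebesgue_measure R).
Local Notation M := (@PH R d).
Local Notation mu := (phase_measure d).
Local Notation ker := (@kker R d th l).
Local Notation c0 := (@kmass R d l).
Let l_ge0 : 0 <= l. Proof. exact: ltW. Qed.
Let c0_gt0 : 0 < c0. Proof. by rewrite exprn_gt0// mulr_gt0. Qed.

(** The window 2 e < s < 3 e is where the slope of the time cut-off [chi] is bounded below by a
    multiple of 1/e ([chid_lower]); the height gives it unit integral. *)
Definition bump (e s : R) : R := e^-1 * ((2 * e < s)%R%:R * (s < 3 * e)%R%:R).

Lemma bump_ge0 e s : 0 < e -> 0 <= bump e s.
Proof. by move=> e0; rewrite mulr_ge0 ?invr_ge0 ?(ltW e0)// mulr_ge0. Qed.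

Lemma measurable_bump e : measurable_fun setT (bump e : measurableTypeR R -> R).
Proof.
apply: measurable_funM => //.
by apply: measurable_funM; apply: (@measurable_ltr_nat _ _ (measurableTypeR R)).
Qed.

Lemma integral_bump e : 0 < e -> (\int[leb]_(s in `]0%R, +oo[) (bump e s)%:E = 1)%E.
Proof.
move=> e0; rewrite integral_pos_itvE.
transitivity (\int[leb]_s ((e^-1)%:E * (\1_(`](2 * e)%R, (3 * e)%R[%classic) s)%:E))%E.
  apply: eq_integral => s _; rewrite -EFinM; congr _%:E.
  rewrite /bump indicE mem_setE in_itv /= mulrCA -!natrM !mulnb; congr (_ * _%:R).
  have [h|h] := ltP (2 * e) s => /=; last by rewrite !andbF.
  by rewrite (lt_trans _ h)// mulr_gt0.
rewrite ge0_integralZl_EFin; [|exact: measurableT| | |by rewrite invr_ge0 ltW]; last 2 first.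
- by move=> s _; rewrite lee_fin indicE.
- by apply/measurable_EFinP; apply: measurable_indic; exact: measurable_itv.
rewrite integral_indic// setIT.
have hl : leb `](2 * e)%R, (3 * e)%R[%classic = e%:E.
  rewrite lebesgue_measure_itv /= lte_fin ltr_pM2r// ltr_nat /= -EFinB.
  by congr _%:E; ring.
by rewrite [X in (_ * X)%E](_ : _ = e%:E)// -EFinM mulVf ?gt_eqF.
Qed.

Definition wker (e : R) (z0 z : M) : R := bump e (tau z0 z) * ker z0 z.

Lemma wker_ge0 e z0 z : 0 < e -> 0 <= wker e z0 z.
Proof. by move=> e0; rewrite mulr_ge0 ?bump_ge0 ?kker_ge0. Qed.

Lemma measurable_wker e : measurable_fun setT (fun p : M * M => wker e p.1 p.2).
Proof.
apply: measurable_funM; last exact: measurable_kker.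
by apply: (measurableT_comp (measurable_bump e)); exact: measurable_tau.
Qed.

(** With [wker_mass1], the kernel is doubly stochastic up to the factor c0; the treatment of
    complements in [fills_setD] uses both marginals. *)
Lemma wker_mass2 e z0 : 0 < e -> (\int[mu]_z (wker e z0 z)%:E = c0%:E)%E.
Proof.
move=> e0; rewrite (@kker_mass2 R d th l l_ge0 (bump e)); [|exact: measurable_bump|by move=> s; exact: bump_ge0].
by rewrite integral_bump// mule1.
Qed.

Lemma wker_mass1 e z : 0 < e -> (\int[mu]_z0 (wker e z0 z)%:E = c0%:E)%E.
Proof.
move=> e0; rewrite (@kker_mass1 R d th l l_ge0 (bump e)); [|exact: measurable_bump|by move=> s; exact: bump_ge0].
by rewrite integral_bump// mule1.
Qed.

Let mm : {measure set (M * M)%type -> \bar R} := prod_measure mu mu.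

Definition bil (e : R) (S : set (M * M)) : \bar R := (\int[mm]_(p in S) (wker e p.1 p.2)%:E)%E.

Let mwE e : measurable_fun setT (fun p : M * M => (wker e p.1 p.2)%:E).
Proof. by apply/measurable_EFinP; exact: measurable_wker. Qed.

Lemma bil_ge0 e S : 0 < e -> (0 <= bil e S)%E.
Proof. by move=> e0; apply: integral_ge0 => p _; rewrite lee_fin wker_ge0. Qed.

Lemma bil_subset e S S' : 0 < e -> measurable S -> measurable S' -> S `<=` S' ->
  (bil e S <= bil e S')%E.
Proof.
move=> e0 mS mS' SS'; apply: ge0_subset_integral => //; first exact: measurable_funTS.
by move=> p _; rewrite lee_fin wker_ge0.
Qed.

Lemma bil_indicE e S : 0 < e -> measurable S ->
  bil e S = (\int[mm]_p (\1_S p * wker e p.1 p.2)%:E)%E.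
Proof.
move=> e0 mS; rewrite /bil integral_mkcond; apply: eq_integral => p _.
by rewrite patchE indicE; case: ifPn => _; rewrite ?mul1r ?mul0r.
Qed.

Let m1S S e : measurable S -> measurable_fun setT (fun p : M * M => (\1_S p * wker e p.1 p.2)%:E).
Proof.
move=> mS; apply/measurable_EFinP; apply: measurable_funM; last exact: measurable_wker.
exact: measurable_indic.
Qed.

Lemma bilXT e (B : set M) : 0 < e -> measurable B -> bil e (B `*` setT) = (c0%:E * mu B)%E.
Proof.
move=> e0 mB; have mS : measurable (B `*` (setT : set M)) by exact: measurableX.
rewrite bil_indicE// fubini_tonelli1; [|exact: m1S|]; last first.
  by move=> p; rewrite lee_fin mulr_ge0 ?wker_ge0// indicE.
transitivity (\int[mu]_z0 (c0%:E * (\1_B z0)%:E))%E.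
  apply: eq_integral => z0 _; rewrite /fubini_F -(wker_mass2 z0 e0) muleC.
  rewrite -ge0_integralZl_EFin; [|exact: measurableT| | |by rewrite indicE]; last 2 first.
  - by move=> z _; rewrite lee_fin wker_ge0.
  - apply/measurable_EFinP.
    apply: (measurableT_comp (measurable_wker e) (g := fun z => (z0, z))).
    exact: measurable_fun_pair.
  apply: eq_integral => z _; rewrite -EFinM !indicE; congr ((_)%:R * _)%:E.
  congr nat_of_bool; apply/idP/idP => /set_mem h; apply/mem_set; last by split.
  by case: h.
rewrite ge0_integralZl_EFin; [|exact: measurableT| | |exact: ltW]; last 2 first.
- by move=> s _; rewrite lee_fin indicE.
- by apply/measurable_EFinP; exact: measurable_indic.
by rewrite (integral_indic _ measurableT mB) setIT.
Qed.

Lemma bilTX e (A : set M) : 0 < e -> measurable A -> bil e (setT `*` A) = (c0%:E * mu A)%E.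
Proof.
move=> e0 mA; have mS : measurable ((setT : set M) `*` A) by exact: measurableX.
rewrite bil_indicE// fubini_tonelli2; [|exact: m1S|]; last first.
  by move=> p; rewrite lee_fin mulr_ge0 ?wker_ge0// indicE.
transitivity (\int[mu]_z (c0%:E * (\1_A z)%:E))%E.
  apply: eq_integral => z _; rewrite /fubini_G -(wker_mass1 z e0) muleC.
  rewrite -ge0_integralZl_EFin; [|exact: measurableT| | |by rewrite indicE]; last 2 first.
  - by move=> z0 _; rewrite lee_fin wker_ge0.
  - apply/measurable_EFinP.
    apply: (measurableT_comp (measurable_wker e) (g := fun z0 => (z0, z))).
    exact: measurable_fun_pair.
  apply: eq_integral => z0 _; rewrite -EFinM !indicE; congr ((_)%:R * _)%:E.
  congr nat_of_bool; apply/idP/idP => /set_mem h; apply/mem_set; last by split.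
  by case: h.
rewrite ge0_integralZl_EFin; [|exact: measurableT| | |exact: ltW]; last 2 first.
- by move=> s _; rewrite lee_fin indicE.
- by apply/measurable_EFinP; exact: measurable_indic.
by rewrite (integral_indic _ measurableT mA) setIT.
Qed.

Definition eps (n : nat) : R := n.+1%:R^-1.
Lemma eps_gt0 n : 0 < eps n. Proof. by rewrite invr_gt0. Qed.

(* Averaging between points of [A] asymptotically recovers the full mass of [A].  Open sets
   have this property pointwise, and it is stable under the operations of a Dynkin system;
   it replaces the Lebesgue differentiation theorem. *)
Definition fills (A : set M) := forall eta : R, 0 < eta -> \forall n \near \oo,
  (c0%:E * mu A <= bil (eps n) (A `*` A) + eta%:E)%E.

(** On the support tau < 3 eps, |X| <= l tau^(1 + th) and |V| <= l tau^th; the drift tau v0 is small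
    as well, and th > 0 makes the velocity box shrink. *)
Lemma wker_support (U : set (@phase R d)) (z0 : M) : open U -> U z0 ->
  \forall n \near \oo, forall z : M, wker (eps n) z0 z != 0 -> U z.
Proof.
move=> oU Uz0.
have /nbhs_ballP[r /= r0 rU] := open_nbhs_nbhs (conj oU Uz0 : open_nbhs (z0 : @phase R d) U).
pose V : R := \sum_(i < d) `|(z0.2.2 : 'rV[R]_d) ord0 i|.
have V0 : 0 <= V by exact: sumr_ge0.
have VV i : `|(z0.2.2 : 'rV[R]_d) ord0 i| <= V.
  by rewrite /V (bigD1 i)//= lerDl; exact: sumr_ge0.
(* The three bounds give tau^(1 + th) <= tau^th, a drift below r/4, and l tau^th below r/4. *)
pose rho := Num.min (Num.min 1 (r / 4 / (V + 1))) ((r / (4 * l)) `^ th^-1).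
have rho0 : 0 < rho.
  by rewrite !lt_min ltr01 divr_gt0 ?divr_gt0 ?powR_gt0 ?divr_gt0 ?mulr_gt0// ltr_wpDl.
have rho3 : 0 < rho / 3 by rewrite divr_gt0.
have := near_infty_natSinv_lt (PosNum rho3); apply: filterS => n /= hn z wz.
have h3 : 3 * eps n < rho by rewrite mulrC -ltr_pdivlMr.
move: wz; rewrite /wker /bump.
have [h|h] := ltP (tau z0 z) (3 * eps n); last by rewrite !mulr0 mul0r eqxx.
rewrite /kker indicE; case: (boolP (_ \in _)) => [/set_mem hb _|_]; last by rewrite mul0r mulr0 eqxx.
case: hb => /= t0 hx hv.
set s := tau z0 z in h t0 hx hv.
have srho : s < rho by exact: lt_trans h h3.
have : s < rho by []. rewrite {1}/rho !lt_min => /andP[/andP[s1 sV] sl].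
have sth : l * s `^ th < r / 2.
  have := gt0_ltr_powR th_gt0 (ltW t0 : s \in Num.nneg) (powR_ge0 _ _ : _ \in Num.nneg) sl.
  rewrite -powRrM mulVf ?gt_eqF// powRr1; last by rewrite divr_ge0 ?mulr_ge0 ?ltW.
  rewrite ltr_pdivlMr ?mulr_gt0// => h4; have : 0 < r by []. lra.
have sth1 : l * s `^ (1 + th) < r / 2.
  apply: le_lt_trans sth; rewrite ler_pM2l//.
  by apply: ger_powR; [rewrite t0 ltW|rewrite lerDr].
have sV' : s * V < r / 4.
  apply: le_lt_trans (_ : s * (V + 1) < _); first by rewrite ler_pM2l// lerDl.
  by rewrite -ltr_pdivlMr// ltr_wpDl.
have sr : s < r.
  apply: lt_le_trans sV _; rewrite -mulrA ler_piMr ?(ltW r0)//.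
  rewrite -invfM invf_le1; last by rewrite mulr_gt0// ltr_wpDl.
  lra.
apply: rU; split => /=; last split => /=.
- by rewrite /ball /= -/(tau z0 z) gtr0_norm.
- split => // i j; rewrite (ord1 i) /ball /= distrC.
  have := hx j; rewrite /relx -/s => h5.
  have h6 : `|s * (z0.2.2 : 'rV[R]_d) ord0 j| <= s * V.
    by rewrite normrM gtr0_norm// ler_pM2l.
  have := ler_normB (z.2.1 ord0 j - z0.2.1 ord0 j + s * z0.2.2 ord0 j) (s * z0.2.2 ord0 j).
  rewrite addrK => h7; lra.
- split => // i j; rewrite (ord1 i) /ball /= distrC.
  have := hv j; rewrite /relv -/s => h5; lra.
Qed.

(** At each point of U the average of the indicator of U equals c0 for all large n, by
    [wker_support]; dominated convergence on the finite measure of U gives the total. *)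
Lemma open_fills (U : set (@phase R d)) : open U -> (mu (U : set M) < +oo)%E -> fills U.
Proof.
move=> oU fU eta eta0.
have mU : measurable (U : set M) by apply: measurable_phase; exact: sub_sigma_algebra.
have mUU : measurable ((U : set M) `*` (U : set M)) by exact: measurableX.
pose a n (z0 : M) : \bar R := (\int[mu]_z (\1_(U : set M) z * wker (eps n) z0 z)%:E)%E.
have ma n : measurable_fun setT (a n).
  apply: (@measurable_fun_integral_param _ _ _ M M mu (fun p => (\1_(U : set M) p.2 * wker (eps n) p.1 p.2)%:E)).
  apply/measurable_EFinP; apply: measurable_funM; last exact: measurable_wker.
  by apply: (measurableT_comp (measurable_indic mU)).
have a0 n z0 : (0 <= a n z0)%E.
  by apply: integral_ge0 => z _; rewrite lee_fin mulr_ge0 ?wker_ge0 ?eps_gt0// indicE.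
have ac n z0 : (a n z0 <= c0%:E)%E.
  rewrite -(wker_mass2 z0 (eps_gt0 n)); apply: ge0_le_integral => //.
  - by move=> z _; rewrite lee_fin mulr_ge0 ?wker_ge0 ?eps_gt0// indicE.
  - apply/measurable_EFinP; apply: measurable_funM; first exact: measurable_indic.
    by apply: (measurableT_comp (measurable_wker _) (g := fun z => (z0, z))); exact: measurable_fun_pair.
  - apply/measurable_EFinP.
    by apply: (measurableT_comp (measurable_wker _) (g := fun z => (z0, z))); exact: measurable_fun_pair.
  - by move=> z _; rewrite lee_fin ler_piMl ?wker_ge0 ?eps_gt0// indicE; case: (_ \in _).
have bE n : bil (eps n) ((U : set M) `*` (U : set M)) = (\int[mu]_(z0 in (U : set M)) a n z0)%E.
  rewrite bil_indicE ?eps_gt0// fubini_tonelli1; [|exact: m1S|]; last first.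
    by move=> p; rewrite lee_fin mulr_ge0 ?wker_ge0 ?eps_gt0// indicE.
  rewrite [RHS]integral_mkcond; apply: eq_integral => z0 _; rewrite /fubini_F patchE.
  case: ifPn => [/set_mem h|/negP h].
  - apply: eq_integral => z _; rewrite !indicE; congr ((_)%:R * _)%:E; congr nat_of_bool.
    apply/idP/idP => /set_mem h'; apply/mem_set; last by split.
    by case: h'.
  - rewrite integral0_eq// => z _; rewrite indicE memNset ?mul0r//= => -[h' _].
    by apply: h; exact/mem_set.
have ic : mu.-integrable (U : set M) (cst c0%:E : M -> \bar R).
  apply/integrableP; split; first exact: measurable_cst.
  by rewrite integral_cst// lte_mul_pinfty// abse_ge0.
have cv : (\int[mu]_(z0 in (U : set M)) a n z0)%E @[n --> \oo] --> (c0%:E * mu (U : set M))%E.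
  rewrite -(integral_cst mu mU); apply: (@dominated_cvg _ M R mu (U : set M) mU a (cst c0%:E) (cst c0%:E)) => //.
  - by move=> n; exact: measurable_funTS.
  - move=> z0 Uz0; apply: cvg_near_cst; have := wker_support oU Uz0; apply: filterS => n hn.
    rewrite /a -(wker_mass2 z0 (eps_gt0 n)); apply: eq_integral => z _; congr _%:E.
    rewrite indicE; have [->|/hn Uz] := eqVneq (wker (eps n) z0 z) 0; first by rewrite mulr0.
    by rewrite mem_set// mul1r.
  - by move=> n z0 Uz0; rewrite gee0_abs.
have ffin : (c0%:E * mu (U : set M))%E \is a fin_num by rewrite fin_numM// ge0_fin_numE.
move: cv; rewrite -(fineK ffin) => /fine_cvgP[fin cv].
have /cvgrPdist_le/(_ eta eta0) near2 := cv.
near=> n; rewrite bE.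
have fn : (\int[mu]_(z0 in (U : set M)) a n z0)%E \is a fin_num by near: n.
have h : `|fine (c0%:E * mu (U : set M))%E - fine (\int[mu]_(z0 in (U : set M)) a n z0)%E| <= eta.
  by near: n; exact: near2.
by rewrite -(fineK fn) -EFinD lee_fin; move: h; rewrite ler_distl => /andP[_ ?]; lra.
Unshelve. all: by end_near.
Qed.



Lemma bilXE e (B A : set M) : 0 < e -> measurable A -> measurable B ->
  bil e (B `*` A) = (\int[mu]_(z0 in B) \int[mu]_z (\1_A z * wker e z0 z)%:E)%E.
Proof.
move=> e0 mA mB; have mS : measurable (B `*` A) by exact: measurableX.
rewrite bil_indicE// fubini_tonelli1; [|exact: m1S|]; last first.
  by move=> p; rewrite lee_fin mulr_ge0 ?wker_ge0// indicE.
rewrite [RHS]integral_mkcond; apply: eq_integral => z0 _; rewrite /fubini_F patchE.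
case: ifPn => [/set_mem h|/negP h].
- apply: eq_integral => z _; rewrite !indicE; congr ((_)%:R * _)%:E; congr nat_of_bool.
  apply/idP/idP => /set_mem h'; apply/mem_set; last by split.
  by case: h'.
- rewrite integral0_eq// => z _; rewrite indicE memNset ?mul0r//= => -[h' _].
  by apply: h; exact/mem_set.
Qed.

(** * Extension of [fills] from open to Borel sets *)

Section fills_sigma.
Variable K : set (@phase R d).
Hypotheses (oK : open K) (fK : (mu (K : set M) < +oo)%E).
Let mK : measurable (K : set M).
Proof. by apply: measurable_phase; exact: sub_sigma_algebra. Qed.

Let fin_sub (A : set M) : measurable A -> A `<=` K -> mu A \is a fin_num.
Proof.
move=> mA AK; rewrite ge0_fin_numE; last exact: measure_ge0.
apply: le_lt_trans fK.
exact: (le_measure mu (mem_set mA) (mem_set mK) AK).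
Qed.

Let fin_bil e (A B : set M) : 0 < e -> measurable A -> measurable B -> B `<=` K ->
  bil e (A `*` B) \is a fin_num.
Proof.
move=> e0 mA mB BK; rewrite ge0_fin_numE ?bil_ge0//.
apply: le_lt_trans (_ : bil e (setT `*` B) < _)%E.
  apply: bil_subset => //; [exact: measurableX|exact: measurableX|].
  by move=> p [].
rewrite bilTX//; have := fin_sub mB BK; case: (mu B) => [r| |]//= _.
by rewrite -EFinM ltey.
Qed.

Let bilU e (S S' : set (M * M)) : measurable S -> measurable S' -> [disjoint S & S'] ->
  0 < e -> bil e (S `|` S') = (bil e S + bil e S')%E.
Proof.
move=> mS mS' dS e0; rewrite /bil ge0_integral_setU//.
- by apply: measurable_funTS.
- by move=> p _; rewrite lee_fin wker_ge0.
Qed.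

(** Split K x K into A x K, A' x A and A' x A' with A' = K \ A. The first block carries at most c0
    mu(A). The second is the form on K x A, at most c0 mu(A), minus that on A x A, at least c0 mu(A)
    - eta/2; so it carries at most eta/2. The rest must lie on A' x A'. *)
Let fills_setD (A : set M) : measurable A -> A `<=` K -> fills A -> fills (K : set M) ->
  fills ((K : set M) `\` A).
Proof.
move=> mA AK fA fKK eta eta0; have eta2 : 0 < eta / 2 by rewrite divr_gt0.
have := fA _ eta2; have := fKK _ eta2; apply: filterS2 => n hK hA.
set e := eps n in hK hA *; have e0 : 0 < e by exact: eps_gt0.
set A' := (K : set M) `\` A.
have mA' : measurable A' by exact: measurableD.
have A'K : A' `<=` K by move=> z [].
have AA' : A `|` A' = K by rewrite setDUK.
have AA'0 : A `&` A' = set0 by apply/seteqP; split => z //= -[? []].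
have XK : (K : set M) `*` (K : set M) = (A `*` (K : set M)) `|` ((A' `*` A) `|` (A' `*` A')).
  apply/seteqP; split => -[x y] /=.
  - move=> [Kx Ky]; have [Ax|Ax] := pselect (A x); first by left.
    by right; have [Ay|Ay] := pselect (A y); [left|right].
  - by move=> [[/AK Kx Ky]|[[[Kx _] /AK Ky]|[[Kx _] [Ky _]]]].
have XA : (K : set M) `*` A = (A `*` A) `|` (A' `*` A).
  apply/seteqP; split => -[x y] /=.
  - by move=> [Kx Ay]; have [Ax|Ax] := pselect (A x); [left|right].
  - by move=> [[/AK Kx Ay]|[[Kx _] Ay]].
have mAK : measurable (A `*` (K : set M)) by apply: measurableX.
have mA'A : measurable (A' `*` A) by apply: measurableX.
have mA'A' : measurable (A' `*` A') by apply: measurableX.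
have mAA : measurable (A `*` A) by apply: measurableX.
have eK : bil e ((K : set M) `*` (K : set M)) =
   (bil e (A `*` (K : set M)) + (bil e (A' `*` A) + bil e (A' `*` A')))%E.
  rewrite XK bilU; [|exact: mAK|exact: measurableU| |exact: e0].
    congr (_ + _)%E; apply: bilU => //; apply/disj_setPS => -[x y] /= [[_ h1] [_ [_ h2]]].
    exact: h2.
  by apply/disj_setPS => -[x y] /= [[h1 _] [[[_ h2] _]|[[_ h2] _]]]; apply: h2.
have eA : bil e ((K : set M) `*` A) = (bil e (A `*` A) + bil e (A' `*` A))%E.
  rewrite XA; apply: bilU => //; apply/disj_setPS => -[x y] /= [[h1 _] [[_ h2] _]].
  exact: h2.
have bA : (bil e (A `*` (K : set M)) <= c0%:E * mu A)%E.
  rewrite -(bilXT e0 mA); apply: bil_subset; [exact: e0|exact: measurableX|exact: measurableX|].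
  by move=> p [].
have bKA : (bil e ((K : set M) `*` A) <= c0%:E * mu A)%E.
  rewrite -(bilTX e0 mA); apply: bil_subset; [exact: e0|exact: measurableX|exact: measurableX|].
  by move=> p [].
have muK : mu K = (mu A + mu A')%E.
  by rewrite -AA' measureU.
have f1 := fin_bil e0 mA mK (@subset_refl _ K).
have f2 := fin_bil e0 mA' mA AK.
have f3 := fin_bil e0 mA' mA' A'K.
have f4 := fin_bil e0 mA mA AK.
have f5 := fin_sub mA AK.
have f6 := fin_sub mA' A'K.
move: hK hA bA bKA; rewrite eK eA muK.
move: f1 f2 f3 f4 f5 f6.
case: (bil e (A `*` K)) => [x1| |]//; case: (bil e (A' `*` A)) => [x2| |]//.
case: (bil e (A' `*` A')) => [x3| |]//; case: (bil e (A `*` A)) => [x4| |]//.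
case: (mu A) => [x5| |]//; case: (mu A') => [x6| |]// _ _ _ _ _ _.
rewrite /= !lee_fin mulrDr => h1 h2 h3 h4; lra.
Qed.

Lemma borel_fills (A : set (@phase R d)) : <<s open >> A -> fills (A `&` K : set M).
Proof.
pose PB := g_sigma_algebraType (open : set (set (@phase R d))).
apply: (@dynkin_induction _ PB open (fun A => fills (A `&` K : set M))) => //.
- by move=> U V oU oV; exact: openI.
- by rewrite setTI; exact: open_fills.
- move=> U oU; apply: open_fills; first exact: openI.
  have mUK : measurable (U `&` K : set M) by apply: measurable_phase; apply: sub_sigma_algebra; exact: openI.
  apply: le_lt_trans fK; exact: (le_measure mu (mem_set mUK) (mem_set mK) (@subIsetr _ _ _)).
- move=> S mS fS.
  have mSM : measurable (S : set M) by apply: measurable_phase.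
  have -> : ~` S `&` K = (K : set M) `\` (S `&` K).
    by apply/seteqP; split => z /= [h1 h2]; split => //; [case|move=> h; apply: h2].
  apply: fills_setD => //; first exact: measurableI.
  exact: open_fills.
- move=> F mF tF fF eta eta0.
  have mFM k : measurable (F k `&` K : set M) by apply: measurableI; [exact: (measurable_phase (mF k))|exact: mK].
  pose E k : set M := F k `&` K.
  have tE : trivIset setT E by exact: trivIset_setIr.
  have UE : (\bigcup_k F k) `&` K = \bigcup_k E k by rewrite setI_bigcupl.
  rewrite UE.
  have mUE : measurable (\bigcup_k E k) by exact: bigcupT_measurable.
  have UEK : \bigcup_k E k `<=` K by move=> z [k _ []].
  have eta2 : 0 < eta / 2 by rewrite divr_gt0.
  have fUE : mu (\bigcup_k E k) \is a fin_num by exact: fin_sub.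
  have mEX k : measurable (E k `*` E k) by apply: measurableX; exact: mFM.
  (* Finite measure lets finitely many pieces carry the mass up to eta/2; the other eta/2 is shared
     among those pieces. *)
  have [N hN] : exists N, (c0%:E * mu (\bigcup_k E k) <= \sum_(0 <= k < N) (c0%:E * mu (E k)) + (eta / 2)%:E)%E.
    have cvE : (\sum_(0 <= i < n) mu (E i))%E @[n --> \oo] --> (fine (mu (\bigcup_k E k)))%:E.
      by rewrite fineK//; exact: (@measure_semi_sigma_additive _ _ _ mu E mFM tE mUE).
    have /fine_cvgP[[N1 _ fin] /cvgrPdist_le/(_ _ (divr_gt0 eta2 c0_gt0))[N2 _ h]] := cvE.
    rewrite -[mu (\bigcup_k E k)]fineK//.
    exists (maxn N1 N2); have := h _ (leq_maxr N1 N2); have := fin _ (leq_maxl N1 N2).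
    rewrite /= -ge0_sume_distrr; last by move=> k _; exact: measure_ge0.
    case: (\sum_(0 <= i < maxn N1 N2) mu (E i))%E => [x| |]//= _.
    rewrite ler_distl => /andP[_ h1]; rewrite -!EFinM -EFinD lee_fin.
    apply: le_trans (ler_wpM2l (ltW c0_gt0) h1) _.
    by rewrite mulrDr lerD2l mulrCA mulfV ?gt_eqF// mulr1.
  have : \forall n \near \oo, forall k : 'I_N, (c0%:E * mu (E k) <= bil (eps n) (E k `*` E k) + (eta / 2 / N.+1%:R)%:E)%E.
    by apply: filter_forall => k; apply: fF; rewrite divr_gt0.
  apply: filterS => n hn.
  apply: (le_trans hN).
  apply: (@le_trans _ _ (\sum_(0 <= k < N) bil (eps n) (E k `*` E k) + (eta / 2)%:E + (eta / 2)%:E)%E).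
    rewrite leeD2r// !big_mkord.
    apply: (@le_trans _ _ (\sum_(k < N) (bil (eps n) (E k `*` E k) + (eta / 2 / N.+1%:R)%:E))%E).
      by apply: lee_sum => k _; exact: hn.
    rewrite big_split /= leeD2l// sumEFin lee_fin sumr_const card_ord -[leLHS]mulr_natr.
    by rewrite mulrAC ler_pdivrMr// ler_pM2l// ler_nat leqnSn.
  rewrite -addeA -EFinD -splitr leeD2r//.
  (* The diagonal blocks E_k x E_k are disjoint and contained in the square of the union; dropping
     the mixed blocks only decreases the form. *)
  apply: (@le_trans _ _ (bil (eps n) (\bigcup_k (E k `*` E k)))).
    rewrite /bil ge0_integral_bigcup; [|exact: mEX| | |].
    - apply: nneseries_lim_ge => k _ _; apply: bil_ge0; exact: eps_gt0.
    - exact: measurable_funTS.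
    - by move=> p _; rewrite lee_fin wker_ge0 ?eps_gt0.
    - apply/trivIsetP => i j _ _ ij; apply/seteqP; split => // -[x y] /= [[h1 _] [h2 _]].
      by have /trivIsetP/(_ i j I I ij) := tE; rewrite predeqE => /(_ x) [+ _]; apply.
  apply: bil_subset; [exact: eps_gt0|exact: bigcupT_measurable|exact: measurableX|].
  by move=> p [k _ [h1 h2]]; split; exists k.
Qed.
End fills_sigma.


(** * From uniform bounds on averages to a bound on f *)

Section approximation.
Variables (f : M -> R) (D : set M) (q Kc : R) (Y : nat -> M -> R).
Hypotheses (q_gt1 : 1 < q) (f0 : forall z, D z -> 0 <= f z) (mD : measurable D)
  (fB : forall B : set R, measurable B -> <<s open >> (D `&` f @^-1` B : set (@phase R d)))
  (mY : forall n, measurable_fun setT (Y n)) (Y0 : forall n z, 0 <= Y n z)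
  (fY : forall n z0, D z0 -> (\int[mu]_(z in D) (f z * wker (eps n) z0 z)%:E <= (Y n z0)%:E)%E)
  (YK : forall n, (\int[mu]_(z0 in D) (Y n z0 `^ q)%:E <= Kc%:E)%E).

Let mfD : measurable_fun D f.
Proof. by move=> _ B mB; apply: measurable_phase; exact: fB. Qed.

Section levels.
Variables (K : set (@phase R d)) (dl : R) (J : nat).
Hypotheses (oK : open K) (fK : (mu (K : set M) < +oo)%E) (dl0 : 0 < dl).

Let c (j : nat) : R := 2 ^+ j * dl.
Let A (j : nat) : set M := (D `&` f @^-1` `[c j, c j.+1[%classic) `&` K.

Let c_gt0 j : 0 < c j. Proof. by rewrite mulr_gt0 ?exprn_gt0. Qed.

Let mK : measurable (K : set M).
Proof. by apply: measurable_phase; exact: sub_sigma_algebra. Qed.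

Let mA j : measurable (A j).
Proof.
by apply: measurableI; [apply: measurable_phase; apply: fB; exact: measurable_itv|exact: mK].
Qed.

Let AD j : A j `<=` D. Proof. by move=> z [[]]. Qed.

Let fA j : mu (A j) \is a fin_num.
Proof.
rewrite ge0_fin_numE; last exact: measure_ge0.
apply: le_lt_trans fK; apply: (le_measure mu (mem_set (mA j)) (mem_set mK)).
exact: subIsetr.
Qed.

Let tA : trivIset setT A.
Proof.
apply/ltn_trivIset => n m mn; apply/seteqP; split => // z [[[_ /= h1] _] [[_ /= h2] _]].
move: h1 h2; rewrite !in_itv /= => /andP[_ h1] /andP[h2 _].
have : c m.+1 <= c n by rewrite /c ler_pM2r// ler_eXn2l// ltr1n.
by rewrite leNgt (le_lt_trans h2 h1).
Qed.

(** On [A j] the function f is at least c_j, so its averages dominate c_j times those of the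
    indicator of [A j]. *)
Let level_le n j : ((c j)%:E * bil (eps n) (A j `*` A j) <= \int[mu]_(z0 in A j) (Y n z0)%:E)%E.
Proof.
have e0 := eps_gt0 n.
have ma : measurable_fun setT (fun z0 : M => (\int[mu]_z (\1_(A j) z * wker (eps n) z0 z)%:E)%E).
  apply: (@measurable_fun_integral_param _ _ _ M M mu (fun p => (\1_(A j) p.2 * wker (eps n) p.1 p.2)%:E)).
  apply/measurable_EFinP; apply: measurable_funM; last exact: measurable_wker.
  by apply: (measurableT_comp (measurable_indic (mA j))).
have mw z0 : measurable_fun setT (fun z => wker (eps n) z0 z).
  by apply: (measurableT_comp (measurable_wker _) (g := fun z => (z0, z))); exact: measurable_fun_pair.
have a0 z0 : (0 <= \int[mu]_z (\1_(A j) z * wker (eps n) z0 z)%:E)%E.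
  by apply: integral_ge0 => z _; rewrite lee_fin mulr_ge0 ?wker_ge0// indicE.
rewrite bilXE// -ge0_integralZl_EFin; [|exact: mA| | |exact: ltW]; last 2 first.
- by move=> z0 _; exact: a0.
- exact: measurable_funTS.
apply: ge0_le_integral; [exact: mA| | | |].
- by move=> z0 _; rewrite mule_ge0// lee_fin ltW.
- by apply: measurable_funTS; apply: emeasurable_funM.
- by apply: measurable_funTS; apply/measurable_EFinP.
- move=> z0 Az0; apply: (le_trans _ (fY n (AD Az0))).
  rewrite -ge0_integralZl_EFin; [|exact: measurableT| | |exact: ltW]; last 2 first.
  + by move=> z _; rewrite lee_fin mulr_ge0 ?wker_ge0// indicE.
  + by apply/measurable_EFinP; apply: measurable_funM => //; exact: measurable_indic.
  rewrite [leRHS]integral_mkcond; apply: ge0_le_integral; [exact: measurableT| | | |].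
  + move=> z _; rewrite -EFinM lee_fin; apply: mulr_ge0; first exact: ltW.
    by apply: mulr_ge0; [rewrite indicE|exact: wker_ge0].
  + apply: emeasurable_funM; first exact: measurable_cst.
    apply/measurable_EFinP; apply: measurable_funM; [apply: measurable_indic; exact: mA|exact: mw].
  + apply: (iffLR (measurable_restrictT _ mD)); apply/measurable_EFinP.
    by apply: measurable_funM => //; exact: measurable_funTS.
  + move=> z _; rewrite patchE -EFinM indicE.
    have [/set_mem Az|_] := boolP (z \in A j); last first.
      rewrite mul0r mulr0; case: ifPn => // /set_mem Dz.
      by rewrite lee_fin mulr_ge0 ?wker_ge0// f0.
    rewrite mem_set; last exact: AD Az.
    rewrite mul1r lee_fin ler_wpM2r ?wker_ge0//.
    by case: Az => -[_ /=]; rewrite in_itv /= => /andP[].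
Qed.

(** Pointwise c^(q - 1) Y <= (c0 / 2) c^q + (2 / c0)^(q - 1) Y^q, by comparing Y with (c0 / 2) c.
    The first term is half of what [fills] provides, ready to be absorbed. *)
Let level_young n j : ((c j `^ q)%:E * bil (eps n) (A j `*` A j) <=
  (c0 / 2 * c j `^ q)%:E * mu (A j) +
  ((2 / c0) `^ (q - 1))%:E * \int[mu]_(z0 in A j) (Y n z0 `^ q)%:E)%E.
Proof.
have cq : c j `^ q = c j `^ (q - 1) * c j.
  by rewrite mulrC mulr_powRB1 ?(ltW (c_gt0 j))// (lt_trans _ q_gt1).
rewrite [in leLHS]cq EFinM -muleA.
apply: (le_trans (lee_wpmul2l _ (level_le n j))); first by rewrite lee_fin powR_ge0.
rewrite -ge0_integralZl_EFin; [|exact: mA| | |exact: powR_ge0]; last 2 first.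
- by move=> z0 _; rewrite lee_fin.
- by apply: measurable_funTS; apply/measurable_EFinP.
have mYq : measurable_fun (A j) (fun z => (Y n z `^ q)%:E).
  apply: measurable_funTS; apply/measurable_EFinP.
  by apply: (measurableT_comp (measurable_powR q)).
have cc0 : 0 <= c0 / 2 * c j `^ q by rewrite mulr_ge0 ?powR_ge0// divr_ge0// ltW.
rewrite -(integral_cst mu (mA j) (c0 / 2 * c j `^ q)%:E).
rewrite -ge0_integralZl_EFin; [|exact: mA| |exact: mYq|exact: powR_ge0]; last first.
  by move=> z0 _; rewrite lee_fin powR_ge0.
rewrite -ge0_integralD; [|exact: mA| | | |]; last 4 first.
- by move=> z _; rewrite lee_fin.
- exact: measurable_cst.
- by move=> z _; rewrite -EFinM lee_fin mulr_ge0 ?powR_ge0.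
- by apply: emeasurable_funM.
apply: ge0_le_integral; [exact: mA| | | |].
- by move=> z _; rewrite -EFinM lee_fin mulr_ge0 ?powR_ge0.
- by apply: emeasurable_funM => //; apply: measurable_funTS; apply/measurable_EFinP.
- by apply: emeasurable_funD => //; apply: emeasurable_funM.
- move=> z _; rewrite -!EFinM -EFinD lee_fin.
  have [h|h] := leP (Y n z) (c0 / 2 * c j).
  - apply: (@le_trans _ _ (c j `^ (q - 1) * (c0 / 2 * c j))); first by rewrite ler_wpM2l ?powR_ge0.
    by rewrite mulrCA -cq lerDl mulr_ge0 ?powR_ge0.
  - apply: (@le_trans _ _ ((2 / c0) `^ (q - 1) * Y n z `^ q)); last by rewrite lerDr.
    rewrite -[Y n z `^ q](@mulr_powRB1 _ (Y n z) q)//; last exact: lt_trans q_gt1.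
    rewrite mulrA mulrAC -powRM ?divr_ge0 ?(ltW c0_gt0)//.
    apply: ler_wpM2r => //; apply: ge0_ler_powR; rewrite ?nnegrE ?subr_ge0 ?(ltW q_gt1) ?(ltW (c_gt0 j))//.
      by rewrite mulr_ge0 ?divr_ge0 ?(ltW c0_gt0).
    by rewrite mulrAC ler_pdivlMr// mulrC -ler_pdivrMl// mulrA [_^-1 * _]mulrC ltW.
Qed.

(** For finitely many levels a single n satisfies all [fills] inequalities with error eta. Half of
    the left side is absorbed, disjointness of the levels sums the Y-terms to at most [Kc], and eta
    tends to 0. As n depends on eta, the bound [Kc] has to be uniform in n. *)
Lemma levels_bound :
  (\sum_(0 <= j < J) (c j `^ q)%:E * mu (A j) <= ((2 / c0) `^ q * Kc)%:E)%E.
Proof.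
have Sfin : (\sum_(0 <= j < J) (c j `^ q)%:E * mu (A j))%E \is a fin_num.
  by apply/sum_fin_numP => j _ _; rewrite fin_numM.
have key (eta : R) : 0 < eta ->
  ((c0 / 2)%:E * (\sum_(0 <= j < J) (c j `^ q)%:E * mu (A j)) <=
   ((2 / c0) `^ (q - 1) * Kc)%:E + (eta * \sum_(0 <= j < J) c j `^ q)%:E)%E.
  move=> eta0.
  have [n hn] : exists n, forall j : 'I_J, (c0%:E * mu (A j) <= bil (eps n) (A j `*` A j) + eta%:E)%E.
    have : \forall n \near \oo, forall j : 'I_J, (c0%:E * mu (A j) <= bil (eps n) (A j `*` A j) + eta%:E)%E.
      apply: filter_forall => j; apply: (borel_fills oK fK) => //.
      by apply: fB; exact: measurable_itv.
    by move=> [n _ /(_ n (leqnn n)) h]; exists n.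
  have hY : (\sum_(0 <= j < J) \int[mu]_(z0 in A j) (Y n z0 `^ q)%:E <= Kc%:E)%E.
    apply: (le_trans _ (YK n)).
    apply: (@le_trans _ _ (\int[mu]_(z0 in \bigcup_j A j) (Y n z0 `^ q)%:E)%E).
      rewrite ge0_integral_bigcup; [|exact: mA| | |exact: tA].
      - by apply: nneseries_lim_ge => j _ _; apply: integral_ge0 => z _; rewrite lee_fin powR_ge0.
      - apply: measurable_funTS; apply/measurable_EFinP.
        by apply: (measurableT_comp (measurable_powR q)).
      - by move=> z _; rewrite lee_fin powR_ge0.
    apply: ge0_subset_integral; [exact: bigcupT_measurable|exact: mD| | |].
    - apply: measurable_funTS; apply/measurable_EFinP.
      by apply: (measurableT_comp (measurable_powR q)).
    - by move=> z _; rewrite lee_fin powR_ge0.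
    - by move=> z [j _ /AD].
  have h1 : (c0%:E * (\sum_(0 <= j < J) (c j `^ q)%:E * mu (A j)) <=
     \sum_(0 <= j < J) ((c j `^ q)%:E * bil (eps n) (A j `*` A j)) + (eta * \sum_(0 <= j < J) c j `^ q)%:E)%E.
    rewrite ge0_sume_distrr; last by move=> j _; rewrite mule_ge0 ?measure_ge0// lee_fin powR_ge0.
    rewrite mulr_sumr -sumEFin -big_split /= !big_mkord; apply: lee_sum => j _.
    rewrite muleCA; apply: (le_trans (lee_wpmul2l _ (hn j))); first by rewrite lee_fin powR_ge0.
    by rewrite muleDr ?fin_num_adde_defl// -EFinM mulrC.
  have h2 : (\sum_(0 <= j < J) ((c j `^ q)%:E * bil (eps n) (A j `*` A j)) <=
     (c0 / 2)%:E * (\sum_(0 <= j < J) (c j `^ q)%:E * mu (A j)) + ((2 / c0) `^ (q - 1) * Kc)%:E)%E.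
    rewrite [X in (_ <= X + _)%E]ge0_sume_distrr; last by move=> j _; rewrite mule_ge0 ?measure_ge0// lee_fin powR_ge0.
    apply: (@le_trans _ _ (\sum_(0 <= j < J) ((c0 / 2)%:E * ((c j `^ q)%:E * mu (A j)) +
       ((2 / c0) `^ (q - 1))%:E * \int[mu]_(z0 in A j) (Y n z0 `^ q)%:E))%E).
      by rewrite !big_mkord; apply: lee_sum => j _; rewrite muleA -EFinM; exact: level_young.
    rewrite big_split /= leeD2l// -ge0_sume_distrr; last first.
      by move=> j _; apply: integral_ge0 => z _; rewrite lee_fin powR_ge0.
    by rewrite EFinM; apply: lee_wpmul2l => //; rewrite lee_fin powR_ge0.
  have := le_trans h1 (leeD h2 (lexx _)).
  case: (\sum_(0 <= j < J) _)%E Sfin => [S| |]// _.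
  by rewrite /= !lee_fin => h; lra.
case: (\sum_(0 <= j < J) _)%E Sfin key => [S| |]// _ key.
have {}key : c0 / 2 * S <= (2 / c0) `^ (q - 1) * Kc.
  apply/ler_addgt0Pr => e e0.
  pose L : R := \sum_(0 <= j < J) c j `^ q.
  have L0 : 0 <= L by apply: sumr_ge0 => j _; exact: powR_ge0.
  (* eta is chosen so that eta L <= e; the denominator L + 1 is positive even when L = 0. *)
  have := key (e / (L + 1)) (divr_gt0 e0 (ltr_wpDl L0 ltr01)).
  rewrite -/L /= lee_fin => /le_trans; apply; rewrite lerD2l -mulrA ler_piMr ?(ltW e0)//.
  by rewrite mulrC ler_pdivrMr ?ltr_wpDl// mul1r lerDl.
rewrite lee_fin -[(2 / c0) `^ q](@mulr_powRB1 _ (2 / c0) q); last 2 first.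
- by rewrite divr_ge0// ltW.
- exact: lt_trans q_gt1.
rewrite -mulrA -ler_pdivrMl ?divr_gt0// invf_div; exact: key.
Qed.

(** f < 2 c_j on [A j], whence the factor 2^q. *)
Lemma levels_integral :
  (\int[mu]_(z in \big[setU/set0]_(0 <= j < J) A j) (f z `^ q)%:E <=
   (2 `^ q * ((2 / c0) `^ q * Kc))%:E)%E.
Proof.
have mfq (B : set M) : B `<=` D -> measurable B -> measurable_fun B (fun z => (f z `^ q)%:E).
  move=> BD mB; apply/measurable_EFinP; apply: (measurableT_comp (measurable_powR q)).
  exact: measurable_funS BD mfD.
have mU : measurable (\big[setU/set0]_(0 <= j < J) A j).
  by rewrite big_mkord; apply: bigsetU_measurable.
have UD : \big[setU/set0]_(0 <= j < J) A j `<=` D.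
  by rewrite big_mkord -bigcup_mkord => z [j _ /AD].
rewrite ge0_integral_bigsetU; last 5 first.
- by move=> j; exact: mA.
- exact: iota_uniq.
- by move: tA; apply: sub_trivIset.
- exact: mfq.
- by move=> z _; rewrite lee_fin powR_ge0.
rewrite EFinM; apply: (le_trans _ (lee_wpmul2l _ levels_bound)); last by rewrite lee_fin powR_ge0.
rewrite ge0_sume_distrr; last by move=> j _; rewrite mule_ge0 ?measure_ge0// lee_fin powR_ge0.
apply: lee_sum => j _.
rewrite muleA -EFinM -powRM// ?(ltW (c_gt0 j))//.
rewrite -(integral_cst mu (mA j)); apply: ge0_le_integral; [exact: mA| | | |].
- by move=> z _; rewrite lee_fin powR_ge0.
- exact: mfq.
- exact: measurable_cst.
- move=> z [[Dz /=]]; rewrite in_itv /= => /andP[_ h] _; rewrite lee_fin ge0_ler_powR ?nnegrE ?f0//.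
  + exact: ltW (lt_trans _ q_gt1).
  + by rewrite mulr_ge0// ltW.
  + by rewrite ltW//; move: h; rewrite /c exprS mulrA.
Qed.

End levels.

Let dyadic_level (x e : R) (J : nat) : 2 ^+ 0 * e <= x -> x < 2 ^+ J * e ->
  exists2 j, (j < J)%N & (2 ^+ j * e <= x) && (x < 2 ^+ j.+1 * e).
Proof.
move=> h0; elim: J => [|J IH] hJ; first by move: h0; rewrite leNgt hJ.
have [h|h] := ltP x (2 ^+ J * e); last by exists J => //; rewrite h hJ.
by have [j jJ hj] := IH h; exists j => //; exact: ltnW.
Qed.

Theorem average_bound :
  (\int[mu]_(z in D) (f z `^ q)%:E <= (2 `^ q * ((2 / c0) `^ q * Kc))%:E)%E.
Proof.
have q0 : q != 0 by rewrite gt_eqF// (lt_trans _ q_gt1).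
pose KN (n : nat) : set (@phase R d) := ball (0%R : @phase R d) n.+1%:R.
pose dl (n : nat) : R := 2 ^- n.
have dl0 n : 0 < dl n by rewrite invr_gt0 exprn_gt0.
pose AA n j : set M := (D `&` f @^-1` `[2 ^+ j * dl n, 2 ^+ j.+1 * dl n[%classic) `&` KN n.
(* At stage n there are 2 n dyadic levels from 2^(-n) up to 2^n, inside a ball of radius n+1; these
   sets exhaust the part of D where f > 0. *)
pose S n : set M := \big[setU/set0]_(0 <= j < (n + n)%N) AA n j.
have SE n z : S n z <-> [/\ D z, 2 ^- n <= f z, f z < 2 ^+ n & KN n z].
  rewrite /S big_mkord -(bigcup_mkord _ (AA n)); split.
  - move=> [j /= jn [[Dz /=]]]; rewrite in_itv /= => /andP[h1 h2] hK; split => //.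
    + by apply: le_trans h1; rewrite ler_pMl// exprn_ege1// ler1n.
    + apply: lt_le_trans h2 _; rewrite /dl ler_pdivrMr ?exprn_gt0// -exprD.
      by rewrite ler_weXn2l// ler1n.
  - move=> [Dz h1 h2 hK].
    have [j jn h] : exists2 j, (j < n + n)%N & (2 ^+ j * dl n <= f z) && (f z < 2 ^+ j.+1 * dl n).
      apply: dyadic_level; first by rewrite expr0 mul1r.
      by apply: lt_le_trans h2 _; rewrite /dl exprD mulfK// expf_neq0.
    by exists j => //; split.
have mS n : measurable (S n).
  rewrite /S big_mkord; apply: bigsetU_measurable => j _; apply: measurableI.
  - by apply: measurable_phase; apply: fB; exact: measurable_itv.
  - by apply: measurable_phase; apply: sub_sigma_algebra; exact: (@ball_open R (@phase R d)).
have SD n : S n `<=` D by move=> z /SE[].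
have mfq (B : set M) : B `<=` D -> measurable B -> measurable_fun B (fun z => (f z `^ q)%:E).
  move=> BD mB; apply/measurable_EFinP; apply: (measurableT_comp (measurable_powR q)).
  exact: measurable_funS BD mfD.
have bS n : (\int[mu]_(z in S n) (f z `^ q)%:E <= (2 `^ q * ((2 / c0) `^ q * Kc))%:E)%E.
  apply: levels_integral => //; first exact: (@ball_open R (@phase R d)).
  exact: phase_ball_lty.
have ndS : {homo S : n m / (n <= m)%N >-> (n <= m)%O}.
  move=> n m nm; apply/subsetPset => z /SE[Dz h1 h2 h3]; apply/SE; split => //.
  - apply: le_trans h1; rewrite lef_pV2 ?posrE ?exprn_gt0//.
    by rewrite ler_weXn2l// ler1n.
  - by apply: lt_le_trans h2 _; rewrite ler_weXn2l// ler1n.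
  - by apply: le_ball h3; rewrite ler_nat ltnS.
have -> : (\int[mu]_(z in D) (f z `^ q)%:E = \int[mu]_(z in \bigcup_n S n) (f z `^ q)%:E)%E.
  rewrite [LHS]integral_mkcond [RHS]integral_mkcond; apply: eq_integral => z _.
  rewrite !patchE; case: (boolP (z \in D)) => [/set_mem Dz|/negP nDz]; last first.
    by rewrite memNset// => -[n _ /SD Dz]; apply: nDz; exact/mem_set.
  case: ifPn => // /negP nU.
  (* Points with f = 0 lie in no level but contribute nothing, because q is nonzero. *)
  have [fz|fz] := ltP 0 (f z); last first.
    have -> : f z = 0 by apply/eqP; rewrite eq_le fz f0.
    by rewrite powR0.
  exfalso; apply: nU; apply/mem_set.
  pose N := (Num.truncn (f z) + Num.truncn (f z)^-1 + Num.truncn `|z : @phase R d|)%N.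
  have hN (x : R) : (Num.truncn x <= N)%N -> x < N.+1%:R.
    by move=> xN; apply: lt_le_trans (truncnS_gt x) _; rewrite ler_nat ltnS.
  have h2N : N.+1%:R <= (2 : R) ^+ N.+1 by rewrite -natrX ler_nat ltnW// ltn_expl.
  exists N.+1 => //; apply/SE; split => //.
  - rewrite -[f z]invrK lef_pV2 ?posrE ?exprn_gt0 ?invr_gt0//.
    by apply: le_trans h2N; apply/ltW/hN; rewrite /N addnAC leq_addl.
  - by apply: lt_le_trans h2N; apply: hN; rewrite /N -addnA leq_addr.
  - rewrite /KN -ball_normE /ball_ /= sub0r normrN.
    apply: (@lt_trans _ _ N.+1%:R); last by rewrite ltr_nat.
    by apply: hN; rewrite /N leq_addl.
have /cvg_lim <- // := @ge0_nondecreasing_set_cvg_integral _ M R S (fun z => (f z `^ q)%:E) mu ndS mS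
  (fun i => mfq _ (@SD i) (mS i)) (fun i x _ => powR_ge0 (f x) q).
apply: lime_le; last by apply: nearW.
apply/ereal_nondecreasing_is_cvgn => m n mn.
apply: ge0_subset_integral; [exact: mS|exact: mS| | |].
- exact: mfq.
- by move=> x _; rewrite lee_fin powR_ge0.
- exact/subsetPset/ndS.
Qed.

End approximation.

End averages.

(** * Smooth cut-off functions *)

Section bump_functions.
Context {R : realType}.

(* [bmp 0] is the classical smooth function; the family [bmp m] is closed
   under differentiation up to linear combinations. *)
Definition bmp (m : nat) (y : R) : R := if 0 < y then y ^- m * expR (- y^-1) else 0.

Lemma bmp_ge0 m y : 0 <= bmp m y.
Proof.
rewrite /bmp; case: ifPn => // y0.
by rewrite mulr_ge0 ?expR_ge0// invr_ge0 exprn_ge0// ltW.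
Qed.

(** One term of the exponential series: e^(1/y) >= y^(-m) / m!. *)
Lemma bmp_le_fact m y : bmp m y <= m`!%:R.
Proof.
rewrite /bmp; case: ifPn => // y0.
rewrite expRN -exprVn ler_pdivrMr ?expR_gt0//.
have yV : 0 <= y^-1 by rewrite invr_ge0 ltW.
case: m => [|m]; first by rewrite fact0 expr0 mul1r -expR0 ler_expR.
have := expR_ge1Dxn m yV => /(le_trans _) h.
rewrite -ler_pdivrMl ?ltr0n ?fact_gt0// mulrC; apply: h.
by rewrite lerDr.
Qed.

(** Two powers of y are moved into the index: [bmp m] is [bmp (m+2)] times y^2. Vanishing to second
    order at 0 gives the derivative 0 at that point. *)
Lemma bmp_le_quad m y : bmp m y <= m.+2`!%:R * y ^+ 2.
Proof.
have [y0|y0] := ltP 0 y; last first.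
  by rewrite /bmp ltNge y0 /= mulr_ge0 ?sqr_ge0.
have -> : bmp m y = bmp m.+2 y * y ^+ 2.
  have h : y^-1 * y = 1 by rewrite mulVf// gt_eqF.
  rewrite /bmp y0 -!exprVn; transitivity (y^-1 ^+ m * expR (- y^-1) * (y^-1 * y) * (y^-1 * y)).
    by rewrite h !mulr1.
  by rewrite !exprS; ring.
by rewrite ler_wpM2r ?sqr_ge0// bmp_le_fact.
Qed.

Lemma bmp_lower m y : 2^-1 <= y -> y <= 2 -> 2 ^- m * expR (- 2) <= bmp m y.
Proof.
move=> y1 y2; have y0 : 0 < y by lra.
rewrite /bmp y0 ler_pM ?invr_ge0 ?exprn_ge0 ?expR_ge0//.
- by rewrite lef_pV2 ?posrE ?exprn_gt0// lerXn2r ?nnegrE// ltW.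
- by rewrite ler_expR lerN2 -[leRHS]invrK lef_pV2 ?posrE.
Qed.

Lemma is_derive_bmp m (y : R) :
  is_derive y 1 (bmp m) (- m%:R * bmp m.+1 y + bmp m.+2 y).
Proof.
have [y0|y0|y0] := ltgtP y 0.
- rewrite /bmp !ltNge (ltW y0) /= mulr0 addr0.
  apply: (near_eq_is_derive _ (is_derive_cst (0 : R) _ _)).
  near=> x; have : x < 0 by near: x; apply: (cvgr_lt y) => //; exact: cvg_id.
  by move=> x0; rewrite ltNge (ltW x0).
- pose g (x : R) := x ^- m * expR (- x^-1).
  have y1 : y != 0 by rewrite gt_eqF.
  apply: (@near_eq_is_derive _ _ _ g).
    near=> x; have : 0 < x by near: x; apply: (cvgr_gt y) => //; exact: cvg_id.
    by move=> x0; rewrite /bmp x0.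
  have dV : is_derive y 1 (fun x : R => x^-1) (- y ^- 2).
    have := @is_deriveV R id y 1 1 y1 (is_derive_id _ _).
    by rewrite /GRing.scale /= mulr1.
  have dN : is_derive y 1 (fun x : R => - x^-1) (y ^- 2).
    by have := is_deriveN dV; rewrite opprK.
  have dE : is_derive y 1 (fun x : R => expR (- x^-1)) (expR (- y^-1) * y ^- 2).
    exact: (@is_derive1_comp R expR (fun x : R => - x^-1) y _ _ (is_derive_expR (- y^-1)) dN).
  have dP : is_derive y 1 (fun x : R => x ^- m) (- m%:R * y ^- m.+1).
    have := is_deriveX m dV; rewrite [X in is_derive _ _ X](_ : _ = (fun x : R => x ^- m)); last first.
      by apply/funext => x; rewrite exprfctE exprVn.
    move=> hX; apply: (is_derive_eq hX); rewrite /GRing.scale /=.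
    case: (m) => [|k]; first by rewrite oppr0 !mul0r.
    rewrite /= mulrN mulNr -mulrA -!exprVn; congr (- (_ * _)).
    by rewrite -exprD addn2.
  apply: (is_derive_eq (is_deriveM dP dE)).
  rewrite /bmp y0 /GRing.scale /= -!exprVn.
  by rewrite [y^-1 ^+ m.+2]exprS [y^-1 ^+ m.+1 in RHS]exprS [y^-1 ^+ m.+1]exprS; ring.
- subst y.
  have b0 k : bmp k 0 = 0 by rewrite /bmp ltxx.
  rewrite !b0 mulr0 addr0.
  have cv : (fun h : R => h^-1 *: ((bmp m \o shift 0) (h *: 1) - bmp m 0)) @ 0^' --> (0 : R).
    apply/cvgrPdist_le => e e0.
    pose C : R := m.+2`!%:R.
    have C0 : 0 < C by rewrite ltr0n fact_gt0.
    near=> h.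
    have h0 : h != 0 by near: h; exact: nbhs_dnbhs_neq.
    have hC : `|h| < e / C.
      near: h; apply: dnbhs0_lt; exact: divr_gt0.
    rewrite sub0r normrN b0 subr0 /= addr0 /GRing.scale /= mulr1.
    rewrite normrM normfV (ger0_norm (bmp_ge0 _ _)).
    apply: (@le_trans _ _ (`|h|^-1 * (C * h ^+ 2))).
      by rewrite ler_wpM2l ?invr_ge0// bmp_le_quad.
    rewrite -real_normK ?num_real// expr2 mulrCA mulKf ?normr_eq0//.
    by rewrite mulrC -ler_pdivlMr// ltW.
  split; first by apply/cvg_ex; exists 0.
  by apply/cvg_lim.
Unshelve. all: by end_near.
Qed.

Lemma continuous_bmp m : continuous (bmp m).
Proof.
move=> y; apply: differentiable_continuous; apply/derivable1_diffP.
by have [] := is_derive_bmp m y.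
Qed.

End bump_functions.

(** * Test functions as formal expressions in tau, X and V *)

Section expressions.
Context {R : realType} (d : nat).
Variable z0 : @phase R d.

(** A syntax whose formal derivatives stay inside it, so that all orders of differentiability follow
    by structural induction. Because of the real powers of tau, evaluation is studied only where tau
    > 0. *)
Inductive ex := Cst of R | Tau | Xc of 'I_d | Vc of 'I_d | Ad of ex & ex | Mu of ex & ex
  | Pw of R | Em of nat & ex.

Fixpoint eval (e : ex) (z : @phase R d) : R :=
  match e with
  | Cst c => c
  | Tau => tau z0 z
  | Xc i => relx z0 z i
  | Vc i => relv z0 z i
  | Ad a b => eval a z + eval b z
  | Mu a b => eval a z * eval b z
  | Pw c => tau z0 z `^ c
  | Em m a => bmp m (eval a z)
  end.

(* Symbolic derivative in the direction [u]; closure of the expressions under it is what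
   gives smoothness of all orders. *)
Fixpoint diff (u : @phase R d) (e : ex) : ex :=
  match e with
  | Cst c => Cst 0
  | Tau => Cst (- u.1)
  | Xc i => Cst (u.2.1 ord0 i - u.1 * z0.2.2 ord0 i)
  | Vc i => Cst (u.2.2 ord0 i)
  | Ad a b => Ad (diff u a) (diff u b)
  | Mu a b => Ad (Mu (diff u a) b) (Mu a (diff u b))
  | Pw c => Mu (Cst (- u.1 * c)) (Pw (c - 1))
  | Em m a => Mu (Ad (Mu (Cst (- m%:R)) (Em m.+1 a)) (Em m.+2 a)) (diff u a)
  end.

Lemma is_derive_line (phi : @phase R d -> R) z u df :
  is_derive (0 : R) 1 (fun s => phi (s *: u + z)) df -> is_derive z u phi df.
Proof.
have E : (fun h : R => h^-1 *: (((fun s => phi (s *: u + z)) \o shift 0) (h *: 1) -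
     (fun s => phi (s *: u + z)) 0)) =
   (fun h : R => h^-1 *: ((phi \o shift z) (h *: u) - phi z)).
  apply/funext => h; have h1 : h *: (1 : R) = h by rewrite /GRing.scale /= mulr1.
  by rewrite /comp /shift h1 addr0 scale0r add0r.
move=> [dv dE]; split.
- by move: dv; rewrite /derivable E.
- by move: dE; rewrite /derive E.
Qed.

Lemma tau_line z u s : tau z0 (s *: u + z) = tau z0 z - s * u.1.
Proof. by rewrite /tau /= /GRing.scale /=; ring. Qed.

Lemma eval_line e z u : 0 < tau z0 z ->
  is_derive (0 : R) 1 (fun s => eval e (s *: u + z)) (eval (diff u e) z).
Proof.
move=> t0.
have lin (a c : R) : is_derive (0 : R) 1 (fun s : R => a + s * c) c.
  have h : is_derive (0 : R) 1 (cst a + (c *: id)) (0 + c *: 1) by exact: is_deriveD.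
  move: h; rewrite add0r {2}/GRing.scale /= mulr1.
  by congr is_derive; apply/funext => s /=; rewrite mulrC.
elim: e => [c||i|i|a IHa b IHb|a IHa b IHb|c|m a IHa] /=.
- exact: is_derive_cst.
- have := lin (tau z0 z) (- u.1); congr is_derive; apply/funext => s.
  by rewrite tau_line mulrN.
- have := lin (relx z0 z i) (u.2.1 ord0 i - u.1 * z0.2.2 ord0 i); congr is_derive; apply/funext => s.
  by rewrite /relx tau_line /= !mxE; ring.
- have := lin (relv z0 z i) (u.2.2 ord0 i); congr is_derive; apply/funext => s.
  by rewrite /relv /= !mxE; ring.
- exact: is_deriveD.
- apply: (is_derive_eq (is_deriveM IHa IHb)).
  by rewrite /= !scale0r !add0r /GRing.scale /=; ring.
- have g0 : is_derive (tau z0 (0 *: u + z)) 1 (@powR R ^~ c) (c * tau z0 z `^ (c - 1)).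
    by rewrite scale0r add0r; exact: is_derive_powR.
  have h : is_derive (0 : R) 1 (fun s : R => tau z0 (s *: u + z)) (- u.1).
    have := lin (tau z0 z) (- u.1); congr is_derive; apply/funext => s.
    by rewrite tau_line mulrN.
  apply: (is_derive_eq (@is_derive1_comp R (@powR R ^~ c) (fun s : R => tau z0 (s *: u + z)) 0 _ _ g0 h)); ring.
- have g0 : is_derive (eval a (0 *: u + z)) 1 (bmp m)
      (- m%:R * bmp m.+1 (eval a z) + bmp m.+2 (eval a z)).
    by rewrite scale0r add0r; exact: is_derive_bmp.
  exact: (@is_derive1_comp R (bmp m) (fun s : R => eval a (s *: u + z)) 0 _ _ g0 IHa).
Qed.

Lemma is_derive_eval e z u : 0 < tau z0 z -> is_derive z u (eval e) (eval (diff u e) z).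
Proof. by move=> t0; apply: is_derive_line; exact: eval_line. Qed.

Lemma continuous_tau : continuous (tau z0).
Proof.
move=> z; apply: cvgB; first exact: cvg_cst.
exact: cvg_fst.
Qed.

Lemma continuous_relx i : continuous (fun z => relx z0 z i).
Proof.
move=> z; apply: cvgD; first apply: cvgB.
- apply: (@continuous_comp _ _ _ (fun z : @phase R d => z.2.1) (fun v : 'rV[R]_d => v ord0 i)); last exact: coord_continuous.
  by apply: (@continuous_comp _ _ _ snd fst); [exact: cvg_snd|exact: cvg_fst].
- exact: cvg_cst.
- by apply: cvgM; [exact: continuous_tau|exact: cvg_cst].
Qed.

Lemma continuous_relv i : continuous (fun z => relv z0 z i).
Proof.
move=> z; apply: cvgB; last exact: cvg_cst.
apply: (@continuous_comp _ _ _ (fun z : @phase R d => z.2.2) (fun v : 'rV[R]_d => v ord0 i)); last exact: coord_continuous.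
by apply: (@continuous_comp _ _ _ snd snd); exact: cvg_snd.
Qed.

Lemma continuous_eval e z : 0 < tau z0 z -> {for z, continuous (eval e)}.
Proof.
move=> t0; elim: e => [c||i|i|a IHa b IHb|a IHa b IHb|c|m a IHa].
- exact: cvg_cst.
- exact: continuous_tau.
- exact: continuous_relx.
- exact: continuous_relv.
- exact: cvgD.
- exact: cvgM.
- apply: (@continuous_comp _ _ _ (tau z0) (@powR R ^~ c)); first exact: continuous_tau.
  exact: continuous_powR_gt0.
- apply: (@continuous_comp _ _ _ (eval a) (bmp m)); first exact: IHa.
  exact: continuous_bmp.
Qed.

(** Extension by zero to tau <= 0. It is smooth as soon as the expression vanishes for 0 < tau < ep,
    which hides the singular powers of tau. *)
Definition cut (e : ex) (z : @phase R d) : R := if 0 < tau z0 z then eval e z else 0.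

Definition vanishes (ep : R) (e : ex) := forall z, 0 < tau z0 z -> tau z0 z < ep -> eval e z = 0.

Lemma near_tau_gt z (a : R) : a < tau z0 z -> \forall x \near z, a < tau z0 x.
Proof.
by move=> h; exact: (@cvgr_gt R _ (nbhs z) _ (tau z0) (tau z0 z) (@continuous_tau z) a h).
Qed.

Lemma near_tau_lt z (a : R) : tau z0 z < a -> \forall x \near z, tau z0 x < a.
Proof.
by move=> h; exact: (@cvgr_lt R _ (nbhs z) _ (tau z0) (tau z0 z) (@continuous_tau z) a h).
Qed.

(** A function vanishing on an open set has zero derivative there, so the hypothesis of [smooth_cut]
    survives differentiation. *)
Lemma vanishes_diff ep u e : vanishes ep e -> vanishes ep (diff u e).
Proof.
move=> ve z t0 te; have h := is_derive_eval e u t0.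
have : is_derive z u (eval e) 0.
  apply: (near_eq_is_derive _ (is_derive_cst (0 : R) _ _)).
  near=> x; rewrite ve//; near: x; [exact: near_tau_gt|exact: near_tau_lt].
by move=> h0; rewrite -(@derive_val _ _ _ _ _ _ _ h) (@derive_val _ _ _ _ _ _ _ h0).
Unshelve. all: by end_near.
Qed.

Lemma cut_near0 ep e z : 0 < ep -> vanishes ep e -> tau z0 z <= 0 ->
  \forall x \near z, cut e x = 0.
Proof.
move=> ep0 ve t0; near=> x; rewrite /cut; case: ifPn => // tx; apply: ve => //.
by near: x; apply: near_tau_lt; exact: le_lt_trans ep0.
Unshelve. all: by end_near.
Qed.

Lemma cut_near e z : 0 < tau z0 z -> \forall x \near z, cut e x = eval e x.
Proof.
move=> t0; near=> x; rewrite /cut ifT//; near: x; exact: near_tau_gt.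
Unshelve. all: by end_near.
Qed.

Lemma is_derive_cut ep e z u : 0 < ep -> vanishes ep e ->
  is_derive z u (cut e) (cut (diff u e) z).
Proof.
move=> ep0 ve; have [t0|t0] := ltP 0 (tau z0 z).
- rewrite {2}/cut t0; apply: (@near_eq_is_derive _ _ _ (eval e)); last exact: is_derive_eval.
  by apply: filterS (cut_near e t0) => x ->.
- rewrite {2}/cut ltNge t0 /=; apply: (near_eq_is_derive _ (is_derive_cst (0 : R) _ _)).
  by apply: filterS (cut_near0 ep0 ve t0) => x ->.
Qed.

Lemma derive_cut ep e z u : 0 < ep -> vanishes ep e -> 'D_u (cut e) z = cut (diff u e) z.
Proof. by move=> ep0 ve; have [] := is_derive_cut z u ep0 ve. Qed.

Lemma continuous_cut ep e : 0 < ep -> vanishes ep e -> continuous (cut e).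
Proof.
move=> ep0 ve z; have [t0|t0] := ltP 0 (tau z0 z).
- have cz : cut e z = eval e z by rewrite /cut t0.
  have h : eval e x @[x --> z] --> cut e z by rewrite cz; exact: continuous_eval.
  apply: (cvg_trans _ h); apply: near_eq_cvg.
  by apply: filterS (cut_near e t0) => x ->.
- have cz : cut e z = 0 by rewrite /cut ltNge t0.
  have h : cst (0 : R) x @[x --> z] --> cut e z by rewrite cz; exact: cvg_cst.
  apply: (cvg_trans _ h); apply: near_eq_cvg.
  by apply: filterS (cut_near0 ep0 ve t0) => x ->.
Qed.

(** Induction on the order for all expressions at once: the derivative of a cut expression is the
    cut of its formal derivative. *)
Lemma smooth_cut ep e : 0 < ep -> vanishes ep e -> smooth (cut e).
Proof.
move=> ep0 ve k; elim: k e ve => [|k IH] e ve /=; first exact: continuous_cut ve.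
move=> u; split; first by move=> z; have [] := is_derive_cut z u ep0 ve.
have -> : (fun z => 'D_u (cut e) z) = cut (diff u e).
  by apply/funext => z; exact: derive_cut ve.
by apply: IH; exact: vanishes_diff.
Qed.

(** Vanishing for tau < ep puts the closed support at times at most t0 - ep, hence strictly before
    T; the bound B makes it compact. *)
Lemma test_fun_cut (T ep : R) e (B : R) : 0 < ep -> vanishes ep e -> z0.1 < T ->
  (forall z, 0 < tau z0 z -> eval e z != 0 -> [/\ tau z0 z <= B,
     forall i, `|z.2.1 ord0 i| <= B & forall i, `|z.2.2 ord0 i| <= B]) ->
  test_fun T (cut e).
Proof.
move=> ep0 ve zT hB.
pose BB : set (@phase R d) := `[z0.1 - B, z0.1 - ep]%classic `*`
  ([set x : 'rV[R]_d | forall i, `[- B, B]%classic (x ord0 i)] `*`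
   [set x : 'rV[R]_d | forall i, `[- B, B]%classic (x ord0 i)]).
have cBB : compact BB.
  apply: compact_setX; first exact: segment_compact.
  by apply: compact_setX; apply: (@rV_compact _ _ (fun=> `[- B, B]%classic)) => i; exact: segment_compact.
have sBB : closure [set z | cut e z != 0] `<=` BB.
  rewrite [X in _ `<=` X](_ : _ = closure BB); last first.
    apply/closure_id; exact: compact_closed.
  apply: closureS => z /=; rewrite /cut; case: ifPn => [t0 h|]; last by rewrite eqxx.
  have [h1 h2 h3] := hB z t0 h.
  have h4 : ep <= tau z0 z by rewrite leNgt; apply/negP => h4; move: h; rewrite ve ?eqxx.
  split => /=; first by rewrite in_itv /=; move: h1 h4; rewrite /tau; lra.
  by split => /= i; rewrite in_itv /= -ler_norml.
split; first exact: smooth_cut ve.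
split; first by apply: subclosed_compact sBB => //; exact: closed_closure.
apply: (subset_trans sBB) => z [/=]; rewrite in_itv /= => /andP[_ h] _.
by rewrite /OmegaT /=; move: h; lra.
Qed.

End expressions.

(** * Kinetic test functions *)

Section test_function.
Context {R : realType} (d : nat) (th : R).
Hypotheses (th_gt0 : 0 < th) (th_le1 : th <= 1).
Variable z0 : @phase R d.
Local Notation ex := (@ex R d).
Local Notation eval := (@eval R d z0).
Local Notation diff := (@diff R d z0).

Definition xx (i : 'I_d) : ex := Mu (Xc i) (Pw d (- (1 + th))).
Definition uu (i : 'I_d) : ex :=
  Mu (Ad (Vc i) (Mu (Cst d (1 + th)) (Mu (Pw d (- 1)) (Xc i)))) (Pw d (- th)).
Definition one_sq (e : ex) : ex := Ad (Cst d 1) (Mu (Cst d (- 1)) (Mu e e)).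

(** One coordinate of the test function, with rho(x) = [bmp 0] (1 - x^2) and g(u) = [bmp 2] (1 -
    u^2). The index 2 is there because [bmp 2] is the derivative of [bmp 0]: then -2 u g(u) is the
    derivative of [bmp 0] (1 - u^2). *)
Definition gam (i : 'I_d) : ex :=
  Mu (Pw d (- (1 + 2 * th))) (Mu (Em 0 (one_sq (xx i))) (Em 2 (one_sq (uu i)))).

(* Chosen so that the backward kinetic derivative of [gam i] is the
   velocity derivative of [bet i]. *)
Definition bet (i : 'I_d) : ex :=
  Mu (Pw d (- (2 + th)))
    (Ad (Ad (Mu (xx i) (Mu (Em 0 (one_sq (uu i))) (Em 2 (one_sq (xx i)))))
            (Mu (Cst d (1 + 2 * th)) (Mu (uu i) (Mu (Em 0 (one_sq (xx i))) (Em 2 (one_sq (uu i)))))))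
        (Mu (Cst d (- ((1 + th) * th))) (Mu (xx i) (Mu (Em 0 (one_sq (xx i))) (Em 2 (one_sq (uu i))))))).

Definition kdir (z : @phase R d) : @phase R d := (1, (z.2.2, 0)).

(** The formal derivative is linear in its direction; freezing v at its value in z turns the kinetic
    operator into the single direction [kdir z]. *)
Lemma diff_kdir e z : eval (diff (dir_t d) e) z +
    \sum_(i < d) z.2.2 ord0 i * eval (diff (dir_x i) e) z = eval (diff (kdir z) e) z.
Proof.
elim: e => [c||j|j|a IHa b IHb|a IHa b IHb|c|m a IHa] /=.
- by rewrite big1 ?addr0// => i _; rewrite mulr0.
- by rewrite big1 ?addr0// => i _; rewrite oppr0 mulr0.
- rewrite (bigD1 j)//= big1 => [|i ij].
    by rewrite !mxE eqxx; move: (z.2.2 ord0 j) (z0.2.2 ord0 j) => x y; rewrite mulr1n; ring.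
  by rewrite !mxE (negbTE ij) mul0r subr0 mulr0.
- rewrite !mxE add0r big1// => i _; rewrite ?mxE; ring.
- by rewrite -IHa -IHb addrACA -big_split /=; congr (_ + _); apply: eq_bigr => i _; rewrite mulrDr.
- rewrite -IHa -IHb !mulrDl !mulrDr.
  rewrite mulr_suml mulr_sumr addrACA -big_split /=; congr (_ + _); apply: eq_bigr => i _; ring.
- by rewrite big1 ?addr0// => i _; rewrite oppr0 !mul0r mulr0.
- rewrite -IHa mulrDr; congr (_ + _); rewrite mulr_sumr; apply: eq_bigr => i _; ring.
Qed.

Section tau_powers.
Variable z : @phase R d.
Hypothesis t0 : 0 < tau z0 z.
Let t := tau z0 z.
Let w := t `^ (- 1).
Let b := t `^ (- th).

Let tpow (x y : R) : t `^ (x + y) = t `^ x * t `^ y.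
Proof. by rewrite powRD// (gt_eqF t0) implybT. Qed.

Let E1 : t `^ (- (1 + th)) = w * b.
Proof. by rewrite -tpow; congr (_ `^ _); ring. Qed.
Let E2 : t `^ (- (1 + 2 * th)) = w * (b * b).
Proof. by rewrite -!tpow; congr (_ `^ _); ring. Qed.
Let E3 : t `^ (- (2 + th)) = w * (w * b).
Proof. by rewrite -!tpow; congr (_ `^ _); ring. Qed.

Lemma eval_xx i : eval (xx i) z = relx z0 z i * (w * b).
Proof. by rewrite /= -/t E1. Qed.

Lemma eval_uu i : eval (uu i) z = (relv z0 z i + (1 + th) * (w * relx z0 z i)) * b.
Proof. by []. Qed.

(** Origin of the factor 1 + th in [uu]: the transport of X contributes V, the time derivative of
    tau^(-(1 + th)) contributes (1 + th) X / tau, and their sum is U. *)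
Lemma diff_xx_k i : eval (diff (kdir z) (xx i)) z = w * eval (uu i) z.
Proof.
rewrite eval_uu /= -/t tpow E1 -/w mul1r -/(relv z0 z i).
move: (relx z0 z i) (relv z0 z i) => x v; clearbody w b; ring.
Qed.

Lemma diff_uu_k i : eval (diff (kdir z) (uu i)) z =
  w * ((1 + 2 * th) * eval (uu i) z - (1 + th) * th * eval (xx i) z).
Proof.
rewrite eval_uu eval_xx /= -/t !tpow -/w -/b mxE mul1r -/(relv z0 z i).
move: (relx z0 z i) (relv z0 z i) => x v; clearbody w b; ring.
Qed.

Lemma diff_xx_v i j : eval (diff (dir_v j) (xx i)) z = 0.
Proof. by rewrite /= !mxE; ring. Qed.

Lemma diff_uu_v i j : eval (diff (dir_v j) (uu i)) z = (j == i)%:R * b.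
Proof. by rewrite /= !mxE -/t -/b; move: ((j == i)%:R : R) b => k b'; ring. Qed.

End tau_powers.

Local Opaque xx uu.

Lemma diff_gam_v i z : 0 < tau z0 z -> eval (diff (dir_v i) (gam i)) z =
  tau z0 z `^ (- (1 + 3 * th)) * (bmp 0 (1 - eval (xx i) z ^+ 2) *
    ((- 2 * bmp 3 (1 - eval (uu i) z ^+ 2) + bmp 4 (1 - eval (uu i) z ^+ 2)) * (- 2 * eval (uu i) z))).
Proof.
move=> t0; have -> : - (1 + 3 * th) = - (1 + 2 * th) + (- th) by ring.
rewrite powRD ?(gt_eqF t0) ?implybT// /= diff_xx_v// diff_uu_v// eqxx mulr1n !mulN1r !expr2.
set X := eval (xx i) z; set U := eval (uu i) z.
move: (bmp 0 _) (bmp 1 _) (bmp 2 (1 - X * X)) (bmp 2 _) (bmp 3 _) (bmp 4 _) => b0 b1 b2 b3 b4 b5.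
by move: (_ `^ (- (_ + _))) (_ `^ (- th)) (_ `^ (- _ - 1)) => c1 c2 c3; ring.
Qed.

(** In scaled variables and up to a power of tau, transport is U d_X + ((1 + 2 th) U - (1 + th) th
    X) d_U + (1 + 2 th), the last term coming from the prefactor of [gam]. The last two combine into
    an exact U-derivative; the first is one because U g(U) is. *)
Lemma diff_gam i z : 0 < tau z0 z ->
  eval (diff (kdir z) (gam i)) z = eval (diff (dir_v i) (bet i)) z.
Proof.
move=> t0; have tn : tau z0 z != 0 by rewrite gt_eqF.
have E2 : tau z0 z `^ (- (1 + 2 * th) - 1) = tau z0 z `^ (- 1) * tau z0 z `^ (- (1 + 2 * th)).
  by rewrite -powRD ?tn ?implybT//; congr (_ `^ _); ring.
have E3 : tau z0 z `^ (- (2 + th)) * tau z0 z `^ (- th) = tau z0 z `^ (- 1) * tau z0 z `^ (- (1 + 2 * th)).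
  by rewrite -!powRD ?tn ?implybT//; congr (_ `^ _); ring.
rewrite /= diff_xx_v// diff_uu_v// diff_xx_k// diff_uu_k// eqxx mulr1n E2.
set X := eval (xx i) z; set U := eval (uu i) z.
have -> : 1 + -1 * (X * X) = 1 - X ^+ 2 by rewrite expr2; ring.
have -> : 1 + -1 * (U * U) = 1 - U ^+ 2 by rewrite expr2; ring.
move: E3.
move: (bmp 0 (1 - X ^+ 2)) (bmp 1 (1 - X ^+ 2)) (bmp 2 (1 - X ^+ 2)) (bmp 3 (1 - X ^+ 2)) (bmp 4 (1 - X ^+ 2)) => b0 b1 b2 b3 b4.
move: (bmp 0 (1 - U ^+ 2)) (bmp 1 (1 - U ^+ 2)) (bmp 2 (1 - U ^+ 2)) (bmp 3 (1 - U ^+ 2)) (bmp 4 (1 - U ^+ 2)) => g0 g1 g2 g3 g4.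
move: (_ `^ (- (1 + _))) (_ `^ (- th)) (_ `^ (- (2 + _))) (_ `^ (- 1)) (_ `^ (_ - 1)) => c1 c2 c3 c4 c5 E3.
apply/eqP; rewrite -subr_eq0; apply/eqP.
(* The difference of the two sides is a multiple of c4 c1 - c3 c2, the relation [E3] between powers
   of tau. *)
transitivity ((c4 * c1 - c3 * c2) * ((- 2 * X * U * b2 * g2)
   + (1 + 2 * th) * b0 * g2 + b0 * (- 2 * g3 + g4) * (- 2 * U) * ((1 + 2 * th) * U - (1 + th) * th * X))).
  ring.
by rewrite E3 subrr mul0r.
Qed.

Lemma diff_gam0 i j z : 0 < tau z0 z -> j != i -> eval (diff (dir_v i) (gam j)) z = 0.
Proof.
move=> t0 ji; rewrite /= diff_xx_v// diff_uu_v// eq_sym (negbTE ji) mulr0n.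
set X := eval (xx j) z; set U := eval (uu j) z.
move: (bmp 0 _) (bmp 1 _) (bmp 2 _) (bmp 2 _) (bmp 3 _) (bmp 4 _) => b0 b1 b2 b3 b4 b5.
by move: (_ `^ _) (_ `^ _) (_ `^ _) => c1 c2 c3; ring.
Qed.

Section pointwise_bounds.
Variable z : @phase R d.
Hypothesis t0 : 0 < tau z0 z.
Let t := tau z0 z.

Definition box1 (i : 'I_d) : bool :=
  (`|relx z0 z i| <= 3 * t `^ (1 + th)) && (`|relv z0 z i| <= 3 * t `^ th).

Let tpow (x y : R) : t `^ (x + y) = t `^ x * t `^ y.
Proof. by rewrite powRD// (gt_eqF t0) implybT. Qed.

Let relx_xx i : relx z0 z i = eval (xx i) z * t `^ (1 + th).
Proof.
rewrite eval_xx// -mulrA -!tpow (_ : _ + (1 + th) = 0) ?powRr0 ?mulr1//; ring.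
Qed.

Let relv_uu i : relv z0 z i = (eval (uu i) z - (1 + th) * eval (xx i) z) * t `^ th.
Proof.
have h : t `^ (- th) * t `^ th = 1 by rewrite -tpow addNr powRr0.
rewrite eval_uu// eval_xx// -/t; move: h.
move: (relx z0 z i) (relv z0 z i) (t `^ (- 1)) (t `^ (- th)) (t `^ th) => x v a b c h.
transitivity (v * (b * c)); first by rewrite h mulr1.
ring.
Qed.

Let uu_relv i : eval (uu i) z = relv z0 z i * t `^ (- th) + (1 + th) * eval (xx i) z.
Proof.
rewrite relv_uu -mulrA -tpow subrr powRr0 mulr1; ring.
Qed.

Let xx_relx i : eval (xx i) z = relx z0 z i * t `^ (- (1 + th)).
Proof. by rewrite relx_xx -mulrA -tpow subrr powRr0 mulr1. Qed.

Let bmp_abs m n (x y : R) : `|bmp m x * bmp n y| <= m`!%:R * n`!%:R.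
Proof. by rewrite normrM !ger0_norm ?bmp_ge0// ler_pM ?bmp_ge0 ?bmp_le_fact. Qed.

(** In scaled variables V = tau^th (u - (1 + th) x), so |V| <= (1 + 2) tau^th when th <= 1; this is
    the 3 in [box1]. *)
Lemma box1_small i : `|eval (xx i) z| < 1 -> `|eval (uu i) z| < 1 -> box1 i.
Proof.
have := th_gt0; have := th_le1 => h1 h0 x1 u1; apply/andP; split; rewrite ?relx_xx ?relv_uu;
  move: (eval (xx i) z) (eval (uu i) z) x1 u1 => x u x1 u1;
  rewrite normrM (ger0_norm (powR_ge0 _ _)) ler_wpM2r ?powR_ge0//; first by lra.
have := ler_normB u ((1 + th) * x).
rewrite normrM (ger0_norm (_ : 0 <= 1 + th)); last by lra.
have : (1 + th) * `|x| <= 2 * 1 by rewrite ler_pM//; lra.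
by lra.
Qed.

Lemma bmp_one_sq m (y : R) : 1 <= `|y| -> bmp m (1 - y ^+ 2) = 0.
Proof.
move=> y1; rewrite /bmp ltNge ifF//; apply/negbF.
by rewrite subr_le0 -real_normK ?num_real// exprn_ege1.
Qed.

Let big_case i (c K e : R) : 0 <= K ->
  (`|eval (xx i) z| < 1 -> `|eval (uu i) z| < 1 -> `|e| <= K) ->
  ((1 <= `|eval (xx i) z|) || (1 <= `|eval (uu i) z|) -> e = 0) ->
  `|t `^ c * e| <= K * (t `^ c * (box1 i)%:R).
Proof.
move=> K0 hs hb; rewrite normrM (ger0_norm (powR_ge0 _ _)) mulrCA ler_wpM2l ?powR_ge0//.
case: (ltP `|eval (xx i) z| 1) => [x1|x1]; last by rewrite hb ?x1// normr0 mulr_ge0.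
case: (ltP `|eval (uu i) z| 1) => [u1|u1]; last by rewrite hb ?u1 ?orbT// normr0 mulr_ge0.
by rewrite box1_small// mulr1 hs.
Qed.

Let osq (x : R) : 1 + - 1 * (x * x) = 1 - x ^+ 2.
Proof. ring. Qed.

(* A common bound for the profiles in [gam], [bet] and the velocity derivative of [gam],
   which are combinations of [bmp] with [m <= 4]. *)
Definition cbd : R := 72.

Lemma cbd_ge0 : 0 <= cbd. Proof. exact: ler0n. Qed.

Lemma gam_bound i : `|eval (gam i) z| <= cbd * (t `^ (- (1 + 2 * th)) * (box1 i)%:R).
Proof.
rewrite /cbd; have -> : eval (gam i) z = t `^ (- (1 + 2 * th)) *
  (bmp 0 (1 - eval (xx i) z ^+ 2) * bmp 2 (1 - eval (uu i) z ^+ 2)) by rewrite /= !osq.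
apply: big_case => // [_ _|/orP[h|h]].
- by apply: (le_trans (bmp_abs _ _ _ _)); rewrite /= !factS fact0; lra.
- by rewrite bmp_one_sq// mul0r.
- by rewrite [bmp 2 _]bmp_one_sq// mulr0.
Qed.

Lemma gam_ge0 i : 0 <= eval (gam i) z.
Proof. by rewrite /= mulr_ge0 ?powR_ge0// mulr_ge0// bmp_ge0. Qed.

Lemma diff_gam_bound i : `|eval (diff (dir_v i) (gam i)) z| <=
  cbd * (t `^ (- (1 + 3 * th)) * (box1 i)%:R).
Proof.
rewrite /cbd diff_gam_v//; apply: big_case => // [x1 u1|/orP[h|h]].
- move: (eval (xx i) z) (eval (uu i) z) x1 u1 => x u x1 u1.
  have h3 : `|bmp 0 (1 - x ^+ 2) * bmp 3 (1 - u ^+ 2)| <= 6 by apply: (le_trans (bmp_abs _ _ _ _)); rewrite /= !factS fact0; lra.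
  have h4 : `|bmp 0 (1 - x ^+ 2) * bmp 4 (1 - u ^+ 2)| <= 24 by apply: (le_trans (bmp_abs _ _ _ _)); rewrite /= !factS fact0; lra.
  move: (bmp 0 _) (bmp 3 _) (bmp 4 _) h3 h4 => b0 b3 b4 h3 h4.
  have -> : b0 * ((- 2 * b3 + b4) * (- 2 * u)) = (b0 * b4 - 2 * (b0 * b3)) * (- 2 * u) by ring.
  rewrite normrM.
  (* 24 + 2 * 6 = 36 bounds the combination of profiles, 2 bounds the factor -2 u. *)
  rewrite (_ : 72 = 36 * 2); last by lra.
  apply: ler_pM => //.
    by apply: (le_trans (ler_normB _ _)); rewrite [`|2 * _|]normrM (ger0_norm (ler0n _ 2)); lra.
  by rewrite normrM normrN (ger0_norm (ler0n _ 2)); lra.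
- by rewrite bmp_one_sq// mul0r.
- by rewrite [bmp 3 _]bmp_one_sq// [bmp 4 _]bmp_one_sq// mulr0 addr0 mul0r mulr0.
Qed.

Lemma bet_bound i : `|eval (bet i) z| <= cbd * (t `^ (- (2 + th)) * (box1 i)%:R).
Proof.
rewrite /cbd; have := th_gt0; have := th_le1 => th1 th0.
set x := eval (xx i) z; set u := eval (uu i) z.
have -> : eval (bet i) z = t `^ (- (2 + th)) *
  (x * (bmp 0 (1 - u ^+ 2) * bmp 2 (1 - x ^+ 2)) +
   ((1 + 2 * th) * u - ((1 + th) * th) * x) * (bmp 0 (1 - x ^+ 2) * bmp 2 (1 - u ^+ 2))).
  rewrite /= !osq -/x -/u -/t.
  by move: (bmp 0 _) (bmp 2 _) (bmp 0 _) (bmp 2 _) (t `^ _) => b0 b2 b3 b4 c; ring.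
apply: big_case => //; rewrite -/x -/u; last first.
  by move=> /orP[] h; rewrite (bmp_one_sq 2 h) (bmp_one_sq 0 h) mul0r !mulr0 addr0.
clearbody x u => x1 u1.
have h1 : `|bmp 0 (1 - u ^+ 2) * bmp 2 (1 - x ^+ 2)| <= 2.
  by apply: (le_trans (bmp_abs _ _ _ _)); rewrite /= !factS fact0; lra.
have h2 : `|bmp 0 (1 - x ^+ 2) * bmp 2 (1 - u ^+ 2)| <= 2.
  by apply: (le_trans (bmp_abs _ _ _ _)); rewrite /= !factS fact0; lra.
move: (bmp 0 _ * _) (bmp 0 _ * _) h1 h2 => b b' h1 h2.
(* The second coefficient is at most 3 + 2; the 35 pads it to the common constant. *)
apply: (le_trans (ler_normD _ _)); rewrite [72](_ : _ = 1 * 2 + 35 * 2); last by lra.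
apply: lerD; rewrite normrM ler_pM ?(ltW x1)//.
apply: (le_trans (ler_normB _ _)); rewrite normrM [X in _ + X]normrM.
rewrite (ger0_norm (_ : 0 <= 1 + 2 * th)); last by lra.
rewrite (ger0_norm (_ : 0 <= (1 + th) * th)); last by rewrite mulr_ge0; lra.
have : (1 + 2 * th) * `|u| <= 3 * 1 by rewrite ler_pM//; lra.
have : (1 + th) * th * `|x| <= (2 * 1) * 1 by rewrite ler_pM ?mulr_ge0//; try lra; rewrite ler_pM//; lra.
by lra.
Qed.

(** Product of the lower bounds of [bmp 0] and [bmp 2] on [1/2, 2]; it serves [gam] and again the
    slope of [chi]. *)
Definition cgam : R := expR (- 2) * (2 ^- 2 * expR (- 2)).

Lemma cgam_gt0 : 0 < cgam.
Proof. by rewrite /cgam !mulr_gt0 ?expR_gt0// invr_gt0 exprn_gt0. Qed.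

(** In the box of size 1/8 one has |x| <= 1/8 and |u| <= 1/8 + 2/8, so 1 - x^2 and 1 - u^2 both stay
    in [1/2, 2]. *)
Lemma gam_lower i : `|relx z0 z i| <= 8^-1 * t `^ (1 + th) -> `|relv z0 z i| <= 8^-1 * t `^ th ->
  cgam * t `^ (- (1 + 2 * th)) <= eval (gam i) z.
Proof.
have := th_gt0; have := th_le1 => th1 th0 hx hv.
have tt c : t `^ c * t `^ (- c) = 1 by rewrite -tpow subrr powRr0.
have hX : `|eval (xx i) z| <= 8^-1.
  rewrite xx_relx normrM (ger0_norm (powR_ge0 _ _)).
  have : 8^-1 * (t `^ (1 + th) * t `^ (- (1 + th))) <= 8^-1 by rewrite tt mulr1.
  by apply: le_trans; rewrite mulrA ler_wpM2r ?powR_ge0.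
have hU : `|eval (uu i) z| <= 3 / 8.
  rewrite uu_relv (le_trans (ler_normD _ _))// [3 / 8](_ : _ = 8^-1 * 1 + 2 * 8^-1); last by lra.
  apply: lerD; rewrite normrM.
    have : 8^-1 * (t `^ th * t `^ (- th)) <= 8^-1 * 1 by rewrite tt.
    by apply: le_trans; rewrite (ger0_norm (powR_ge0 _ _)) mulrA ler_wpM2r ?powR_ge0.
  by rewrite (ger0_norm (_ : 0 <= 1 + th)) ?ler_pM//; lra.
have -> : eval (gam i) z =
  (bmp 0 (1 - eval (xx i) z ^+ 2) * bmp 2 (1 - eval (uu i) z ^+ 2)) * t `^ (- (1 + 2 * th)).
  by rewrite /= !osq mulrC.
rewrite ler_wpM2r ?powR_ge0//.
move: (eval (xx i) z) (eval (uu i) z) hX hU => x u hX hU.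
have sq (y c : R) : `|y| <= c -> y ^+ 2 <= c ^+ 2.
  by move=> yc; rewrite -real_normK ?num_real// lerXn2r ?nnegrE// (le_trans _ yc).
have := sq _ _ hX; have := sq _ _ hU; have := sqr_ge0 x; have := sqr_ge0 u.
rewrite (_ : (3 / 8) ^+ 2 = 9 / 64); last by rewrite expr2; lra.
rewrite (_ : (8^-1) ^+ 2 = 64^-1); last by rewrite expr2; lra.
move=> a1 a2 a3 a4; rewrite /cgam; apply: ler_pM.
- exact: expR_ge0.
- by rewrite mulr_ge0 ?expR_ge0// invr_ge0 exprn_ge0.
- by rewrite -[leLHS]mul1r -[X in X * _]invr1 -(expr0 2); apply: bmp_lower; lra.
- by apply: bmp_lower; lra.
Qed.

Local Opaque cbd.

(** The kernel is a tensor product over coordinates, so coordinatewise bounds on the profiles can be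
    multiplied. *)
Lemma kker3E : kker th 3 z0 z = \prod_(i < d) (t `^ (- (1 + 2 * th)) * (box1 i)%:R).
Proof.
rewrite big_split /= prodr_const card_ord -powR_mulrn ?powR_ge0// -powRrM [_ * d%:R]mulrC /kker [RHS]mulrC; congr (_ * _); last first.
  by congr (_ `^ _); rewrite /hdim; ring.
rewrite indicE; case: (boolP (_ \in _)) => [/set_mem [_ hx hv]|/negP h].
  by rewrite big1// => i _; rewrite /box1 hx hv.
have [i hi|h2] := pickP (fun i => ~~ box1 i); first by rewrite (bigD1 i)//= (negbTE hi) mul0r.
exfalso; apply: h; apply/mem_set; split => // i;
  by have /negbFE/andP[] := h2 i.
Qed.

Local Opaque gam bet.

(** One factor of size tau^(c - (1 + 2 th)) among d - 1 factors of size tau^(-(1 + 2 th)) changes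
    the kernel by the weight tau^c. *)
Lemma prod_bound i (c a : R) : `|a| <= cbd * (t `^ (c - (1 + 2 * th)) * (box1 i)%:R) ->
  `|a * \prod_(j < d | j != i) eval (gam j) z| <= cbd ^+ d * (t `^ c * kker th 3 z0 z).
Proof.
move=> ha; have D (F : 'I_d -> R) : \prod_(j < d) F j = F i * \prod_(j < d | j != i) F j.
  by rewrite (bigD1 i).
have E : \prod_(j < d) cbd = cbd ^+ d by rewrite prodr_const card_ord.
rewrite kker3E -{}E (D (fun=> cbd)) (D (fun j => _ * _)).
have hP : `|\prod_(j < d | j != i) eval (gam j) z| <=
    \prod_(j < d | j != i) cbd * \prod_(j < d | j != i) (t `^ (- (1 + 2 * th)) * (box1 j)%:R).
  rewrite -big_split /= normr_prod; apply: ler_prod => j _.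
  by rewrite normr_ge0 gam_bound.
rewrite normrM; apply: (le_trans (ler_pM _ _ ha hP)) => //.
rewrite /= tpow; move: (\prod_(j < d | j != i) cbd) (\prod_(j < d | j != i) (_ * _)) => P Q.
move: cbd (t `^ c) (t `^ _) ((box1 i)%:R : R) => k x y w.
by rewrite le_eqVlt; apply/orP; left; apply/eqP; ring.
Qed.

Lemma Gam_bound : \prod_(j < d) eval (gam j) z <= cbd ^+ d * kker th 3 z0 z.
Proof.
have E : \prod_(j < d) cbd = cbd ^+ d by rewrite prodr_const card_ord.
rewrite kker3E -{}E -big_split /=.
by apply: ler_prod => j _; rewrite gam_ge0 (le_trans (ler_norm _) (gam_bound j)).
Qed.

Lemma Gam_lower : cgam ^+ d * kker th 8^-1 z0 z <= \prod_(j < d) eval (gam j) z.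
Proof.
rewrite /kker indicE; case: (boolP (_ \in _)) => [/set_mem [/= _ hx hv]|_]; last first.
  by rewrite mul0r mulr0 prodr_ge0// => j _; exact: gam_ge0.
have -> : cgam ^+ d * (1%:R * tau z0 z `^ (- hdim d th)) =
    \prod_(j < d) (cgam * t `^ (- (1 + 2 * th))).
  rewrite big_split /= !prodr_const !card_ord mul1r -[(t `^ _) ^+ d]powR_mulrn ?powR_ge0// -powRrM; congr (_ * _ `^ _).
  by rewrite /hdim; ring.
apply: ler_prod => j _; rewrite mulr_ge0 ?powR_ge0 ?(ltW cgam_gt0)//=.
by apply: gam_lower; [exact: hx|exact: hv].
Qed.

End pointwise_bounds.

Local Opaque gam bet.

Fixpoint eprod (s : seq 'I_d) (F : 'I_d -> ex) : ex :=
  if s is i :: s' then Mu (F i) (eprod s' F) else Cst d 1.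

Lemma eval_eprod s F z : eval (eprod s F) z = \prod_(i <- s) eval (F i) z.
Proof. by elim: s => [|i s IH] /=; rewrite ?big_nil// big_cons IH. Qed.

Lemma eval_diff_eprod u s F z : uniq s ->
  eval (diff u (eprod s F)) z =
  \sum_(i <- s) eval (diff u (F i)) z * \prod_(j <- s | j != i) eval (F j) z.
Proof.
elim: s => [|a s IH] /=; first by rewrite big_nil.
move=> /andP[as_ us]; rewrite big_cons big_cons eqxx /= IH// eval_eprod; congr (_ * _ + _).
  rewrite [RHS]big_seq_cond [LHS]big_seq; apply: eq_bigl => j.
  by case: (boolP (j \in s)) => //= js; apply/esym; apply: contraNneq as_ => <-.
rewrite mulr_sumr big_seq [RHS]big_seq; apply: eq_bigr => i is_.
rewrite big_cons ifT; first by ring.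
by apply: contraNneq as_ => ->.
Qed.

Variables (ep Mx : R).
Hypotheses (ep_gt0 : 0 < ep) (Mx_gt0 : 0 < Mx).

(** Depends on tau alone, so velocity derivatives pass through it; it lives on ep < tau < Mx. *)
Definition chi : ex := Mu (Em 0 (Ad (Mu (Cst d ep^-1) (Tau d)) (Cst d (- 1))))
  (Em 0 (Ad (Cst d 1) (Mu (Cst d (- Mx^-1)) (Tau d)))).

Definition phi : ex := Mu chi (eprod (enum 'I_d) gam).
(** Component i of a field whose velocity divergence is the kinetic derivative of [phi], up to the
    slope of [chi] ([diff_phi_k]). *)
Definition phi_ (i : 'I_d) : ex :=
  Mu chi (eprod (enum 'I_d) (fun j => if j == i then bet i else gam j)).

Definition Gam z : R := \prod_(j < d) eval (gam j) z.
(* Minus the kinetic derivative of [chi]. *)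
Definition chid z : R :=
  ep^-1 * bmp 2 (ep^-1 * tau z0 z - 1) * bmp 0 (1 - Mx^-1 * tau z0 z)
  - bmp 0 (ep^-1 * tau z0 z - 1) * (Mx^-1 * bmp 2 (1 - Mx^-1 * tau z0 z)).

Lemma eval_phi z : eval phi z = eval chi z * Gam z.
Proof. by rewrite /phi [LHS]/= eval_eprod big_enum. Qed.

Lemma eval_phi_ i z : eval (phi_ i) z = eval chi z * (eval (bet i) z * \prod_(j < d | j != i) eval (gam j) z).
Proof.
rewrite /phi_ [LHS]/= eval_eprod big_enum /= (bigD1 i)//= eqxx; congr (_ * (_ * _)).
by apply: eq_bigr => j ji; rewrite (negbTE ji).
Qed.

Lemma diff_phi_v i z : 0 < tau z0 z -> eval (diff (dir_v i) phi) z =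
  eval chi z * (eval (diff (dir_v i) (gam i)) z * \prod_(j < d | j != i) eval (gam j) z).
Proof.
move=> t0.
have -> : eval (diff (dir_v i) phi) z = eval (diff (dir_v i) chi) z * eval (eprod (enum 'I_d) gam) z +
   eval chi z * eval (diff (dir_v i) (eprod (enum 'I_d) gam)) z by [].
have -> : eval (diff (dir_v i) chi) z = 0 by rewrite /=; ring.
rewrite mul0r add0r; congr (_ * _); rewrite eval_diff_eprod ?enum_uniq// big_enum /=.
rewrite (bigD1 i)//= [X in _ + X]big1 ?addr0 => [|j ji].
  by rewrite big_enum_cond; congr (_ * _); apply: eq_bigl => k.
by rewrite diff_gam0 ?mul0r.
Qed.

Lemma diff_phi__v i z : 0 < tau z0 z -> eval (diff (dir_v i) (phi_ i)) z =
  eval chi z * (eval (diff (dir_v i) (bet i)) z * \prod_(j < d | j != i) eval (gam j) z).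
Proof.
move=> t0; set F := fun j => if j == i then bet i else gam j.
have -> : eval (diff (dir_v i) (phi_ i)) z = eval (diff (dir_v i) chi) z * eval (eprod (enum 'I_d) F) z +
   eval chi z * eval (diff (dir_v i) (eprod (enum 'I_d) F)) z by [].
have -> : eval (diff (dir_v i) chi) z = 0 by rewrite /=; ring.
rewrite mul0r add0r; congr (_ * _); rewrite eval_diff_eprod ?enum_uniq// big_enum /=.
rewrite (bigD1 i)//= [X in _ + X]big1 ?addr0 => [|j ji].
  rewrite big_enum_cond /F eqxx; congr (_ * _); apply: eq_big => // k ki.
  by rewrite (negbTE ki).
by rewrite /F (negbTE ji) diff_gam0 ?mul0r.
Qed.

Lemma diff_phi_k z : 0 < tau z0 z ->
  eval (diff (kdir z) phi) z = - chid z * Gam z + \sum_(i < d) eval (diff (dir_v i) (phi_ i)) z.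
Proof.
move=> t0.
have -> : eval (diff (kdir z) phi) z = eval (diff (kdir z) chi) z * eval (eprod (enum 'I_d) gam) z +
   eval chi z * eval (diff (kdir z) (eprod (enum 'I_d) gam)) z by [].
congr (_ + _).
  rewrite eval_eprod big_enum; congr (_ * _); rewrite /chid /=.
  rewrite [- Mx^-1 * tau _ _]mulNr; move: (Mx^-1 * _) (ep^-1 * tau z0 z) => m e.
  by move: (bmp 0 _) (bmp 1 _) (bmp 2 _) (bmp 0 _) (bmp 1 _) (bmp 2 _) => b0 b1 b2 b3 b4 b5; ring.
rewrite eval_diff_eprod ?enum_uniq// big_enum /= mulr_sumr; apply: eq_bigr => i _.
rewrite -[RHS]/(eval (diff (dir_v i) (phi_ i)) z) diff_phi__v// diff_gam//; congr (_ * (_ * _)).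
by rewrite big_enum_cond; apply: eq_bigl => k.
Qed.

Local Notation tt := (tau z0).

Lemma chi_ge0 z : 0 <= eval chi z.
Proof. by rewrite /= mulr_ge0 ?bmp_ge0. Qed.

Lemma chi_le1 z : eval chi z <= 1.
Proof.
rewrite /= -[leRHS]mulr1.
apply: ler_pM; rewrite ?bmp_ge0//; apply: (le_trans (bmp_le_fact _ _)); rewrite fact0//.
Qed.

Lemma chi_neq0 z : eval chi z != 0 -> ep < tt z /\ tt z < Mx.
Proof.
move=> h; have h1 : 0 < ep^-1 * tt z - 1.
  by apply: contraNT h => h; rewrite /= {1}/bmp (negbTE h) mul0r.
have h2 : 0 < 1 - Mx^-1 * tt z.
  by rewrite -mulNr; apply: contraNT h => h; rewrite /= {2}/bmp (negbTE h) mulr0.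
split.
  by move: h1; rewrite subr_gt0 mulrC ltr_pdivlMr// mul1r.
by move: h2; rewrite subr_gt0 mulrC ltr_pdivrMr// mul1r.
Qed.

(** On the window of [bump] the argument tau / ep - 1 lies in (1, 2), and 6 ep <= Mx keeps 1 - tau /
    Mx above 1/2, so [bmp_lower] applies to both factors. The fall at Mx costs at most 2! / Mx, and
    only where tau >= ep. *)
Lemma chid_lower z : 0 < tt z -> 6 * ep <= Mx ->
  cgam * bump ep (tt z) - 2 * Mx^-1 * (ep <= tt z)%R%:R <= chid z.
Proof.
move=> t0 h6; rewrite /chid.
have e0 : 0 < ep := ep_gt0. have m0 : 0 < Mx := Mx_gt0.
apply: lerB.
  have [/andP[h2 h3]|h] := boolP ((2 * ep < tt z) && (tt z < 3 * ep)); last first.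
    rewrite (_ : bump ep (tt z) = 0) ?mulr0 ?mulr_ge0 ?bmp_ge0 ?invr_ge0 ?(ltW e0)//.
    by rewrite /bump -natrM mulnb (negbTE h) mulr0.
  rewrite /bump h2 h3 !mulr1 mulrC -mulrA ler_wpM2l ?invr_ge0 ?(ltW e0)//.
  rewrite /cgam mulrC.
  have a1 : ep^-1 * (2 * ep) <= ep^-1 * tt z by rewrite ler_wpM2l ?invr_ge0 ?ltW.
  have a2 : ep^-1 * tt z <= ep^-1 * (3 * ep) by rewrite ler_wpM2l ?invr_ge0 ?ltW.
  have a3 : Mx^-1 * tt z <= Mx^-1 * (Mx / 2) by rewrite ler_wpM2l ?invr_ge0 ?(ltW m0)//; lra.
  have a4 : 0 <= Mx^-1 * tt z by rewrite mulr_ge0 ?invr_ge0 ?ltW.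
  move: a1 a2 a3.
  rewrite mulrCA mulVf ?gt_eqF// [ep^-1 * (3 * ep)]mulrCA mulVf ?gt_eqF// mulrA mulVf ?gt_eqF// => a1 a2 a3.
  apply: ler_pM.
  - by rewrite mulr_ge0 ?expR_ge0// invr_ge0 exprn_ge0.
  - exact: expR_ge0.
  - by apply: bmp_lower; lra.
  - by rewrite -[leLHS]mul1r -[X in X * _]invr1 -(expr0 2); apply: bmp_lower; lra.
have [h|h] := leP ep (tt z); last first.
  rewrite (_ : bmp 0 (ep^-1 * tt z - 1) = 0) ?mul0r ?mulr0//.
  rewrite /bmp ltNge ifF//; apply/negbF.
  by rewrite subr_le0 mulrC ler_pdivrMr// mul1r ltW.
rewrite mulr1 -[leRHS]mul1r; apply: ler_pM; rewrite ?bmp_ge0//.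
- by rewrite mulr_ge0 ?bmp_ge0// invr_ge0 ltW.
- by apply: (le_trans (bmp_le_fact _ _)); rewrite fact0.
- by rewrite mulrC ler_wpM2r ?invr_ge0 ?(ltW m0)//; apply: (le_trans (bmp_le_fact _ _)); rewrite !factS fact0.
Qed.

Lemma gam_neq0 i z : 0 < tt z -> eval (gam i) z != 0 -> box1 z i.
Proof.
move=> t0 h; apply: contraNT h => h; have := gam_bound t0 i.
by rewrite (negbTE h) !mulr0 normr_le0.
Qed.

Lemma bet_neq0 i z : 0 < tt z -> eval (bet i) z != 0 -> box1 z i.
Proof.
move=> t0 h; apply: contraNT h => h; have := bet_bound t0 i.
by rewrite (negbTE h) !mulr0 normr_le0.
Qed.

Lemma test_fun_box (T : R) e : z0.1 < T ->
  (forall z, 0 < tt z -> eval e z != 0 -> eval chi z != 0 /\ forall i, box1 z i) ->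
  vanishes z0 ep e /\ test_fun T (cut z0 e).
Proof.
move=> zT he; have e0 : 0 < ep := ep_gt0. have m0 : 0 < Mx := Mx_gt0.
have th0 : 0 < th := th_gt0.
have ve : vanishes z0 ep e.
  move=> z t0 te; apply/eqP; apply/negPn/negP => /(he z t0)[/chi_neq0[]].
  by rewrite ltNge (ltW te).
split => //.
(* In every coordinate [S] bounds the position and velocity of z0 and its drift over a time Mx. *)
pose S : R := \sum_(i < d) (`|z0.2.1 ord0 i| + (1 + Mx) * `|z0.2.2 ord0 i|).
have S0 : 0 <= S by apply: sumr_ge0 => i _; rewrite addr_ge0// mulr_ge0//; lra.
have hS i : `|z0.2.1 ord0 i| + (1 + Mx) * `|z0.2.2 ord0 i| <= S.
  rewrite /S (bigD1 i)//= lerDl; apply: sumr_ge0 => j _; rewrite addr_ge0// mulr_ge0//; lra.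
pose A : R := 3 * Mx `^ (1 + th); pose A' : R := 3 * Mx `^ th.
have A0 : 0 <= A by rewrite mulr_ge0 ?powR_ge0.
have A'0 : 0 <= A' by rewrite mulr_ge0 ?powR_ge0.
apply: (@test_fun_cut _ _ z0 T ep e (Mx + S + A + A')) => // z t0 /(he z t0)[/chi_neq0[te tM] hb].
have hx i : `|relx z0 z i| <= A.
  have /andP[h _] := hb i; apply: (le_trans h); rewrite ler_wpM2l//.
  by apply: ge0_ler_powR; rewrite ?nnegrE ?(ltW t0) ?(ltW tM)//; lra.
have hv i : `|relv z0 z i| <= A'.
  have /andP[_ h] := hb i; apply: (le_trans h); rewrite ler_wpM2l//.
  by apply: ge0_ler_powR; rewrite ?nnegrE ?(ltW t0) ?(ltW tM)//; lra.
split; first by lra.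
- move=> i; have -> : z.2.1 ord0 i = relx z0 z i + z0.2.1 ord0 i - tt z * z0.2.2 ord0 i.
    by rewrite /relx; ring.
  apply: (le_trans (ler_normB _ _)); rewrite normrM (ger0_norm (ltW t0)).
  have := ler_normD (relx z0 z i) (z0.2.1 ord0 i).
  have : tt z * `|z0.2.2 ord0 i| <= Mx * `|z0.2.2 ord0 i| by rewrite ler_wpM2r// ltW.
  have := normr_ge0 (z0.2.2 ord0 i).
  have := hx i; have := hS i; rewrite mulrDl mul1r; lra.
- move=> i; have -> : z.2.2 ord0 i = relv z0 z i + z0.2.2 ord0 i by rewrite /relv; ring.
  apply: (le_trans (ler_normD _ _)).
  have : 0 <= Mx * `|z0.2.2 ord0 i| by rewrite mulr_ge0// ltW.
  have := normr_ge0 (z0.2.1 ord0 i).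
  have := hv i; have := hS i; rewrite mulrDl mul1r; lra.
Qed.

Lemma test_fun_phi (T : R) : z0.1 < T -> vanishes z0 ep phi /\ test_fun T (cut z0 phi).
Proof.
move=> zT; apply: test_fun_box => // z t0; rewrite eval_phi mulf_eq0 negb_or => /andP[-> h].
split => // i; apply: gam_neq0 => //; move: h; rewrite /Gam (bigD1 i)//= mulf_eq0 negb_or.
by move=> /andP[].
Qed.

Lemma test_fun_phi_ (T : R) i : z0.1 < T -> vanishes z0 ep (phi_ i) /\ test_fun T (cut z0 (phi_ i)).
Proof.
move=> zT; apply: test_fun_box => // z t0; rewrite eval_phi_ mulf_eq0 negb_or => /andP[-> h].
move: h; rewrite mulf_eq0 negb_or => /andP[hb h].
split => // j; have [->|ji] := eqVneq j i; first exact: bet_neq0.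
apply: gam_neq0 => //; move: h; rewrite (bigD1 j)//= mulf_eq0 negb_or.
by move=> /andP[].
Qed.

(** Relative to one kernel factor, [bet] has size tau^(th - 1): the weight of T_th, to be paired
    with the velocity gradient. *)
Lemma phi__bound i z : 0 < tt z ->
  `|eval (phi_ i) z| <= cbd ^+ d * (tt z `^ (th - 1) * kker th 3 z0 z).
Proof.
move=> t0; rewrite eval_phi_ normrM (ger0_norm (chi_ge0 z)).
apply: (@le_trans _ _ (1 * `|eval (bet i) z * \prod_(j < d | j != i) eval (gam j) z|)).
  by rewrite ler_wpM2r// chi_le1.
rewrite mul1r; apply: prod_bound => //.
by have := bet_bound t0 i; rewrite (_ : - (2 + th) = th - 1 - (1 + 2 * th))//; ring.
Qed.

(** The weight tau^(- th) is that of T_(1 - th), to be paired with S0. *)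
Lemma diff_phi_v_bound i z : 0 < tt z ->
  `|eval (diff (dir_v i) phi) z| <= cbd ^+ d * (tt z `^ (- th) * kker th 3 z0 z).
Proof.
move=> t0; rewrite diff_phi_v// normrM (ger0_norm (chi_ge0 z)).
apply: (@le_trans _ _ (1 * `|eval (diff (dir_v i) (gam i)) z * \prod_(j < d | j != i) eval (gam j) z|)).
  by rewrite ler_wpM2r// chi_le1.
rewrite mul1r; apply: prod_bound => //.
by have := diff_gam_bound t0 i; rewrite (_ : - (1 + 3 * th) = - th - (1 + 2 * th))//; ring.
Qed.

Lemma Gam_ge0 z : 0 < tt z -> 0 <= Gam z.
Proof. by move=> t0; apply: prodr_ge0 => j _; exact: gam_ge0. Qed.

Lemma phi_ge0 z : 0 < tt z -> 0 <= eval phi z.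
Proof. by move=> t0; rewrite eval_phi mulr_ge0 ?chi_ge0 ?Gam_ge0. Qed.

Lemma phi_bound z : 0 < tt z -> `|eval phi z| <= cbd ^+ d * kker th 3 z0 z.
Proof.
move=> t0; rewrite ger0_norm ?phi_ge0// eval_phi.
apply: (@le_trans _ _ (1 * Gam z)); first by rewrite ler_wpM2r ?Gam_ge0// chi_le1.
by rewrite mul1r; exact: Gam_bound.
Qed.

End test_function.

(** * Averages of a weak subsolution *)

Section bounded_support.
Context {R : realType} (d : nat).
Local Notation M := (@PH R d).
Local Notation mu := (phase_measure d).
Local Notation ball0 r := (ball (0 : @phase R d) r : set M).

Lemma measurable_ball0 (r : R) : measurable (ball0 r).
Proof.
apply: measurable_phase; apply: sub_sigma_algebra; exact: (@ball_open R (@phase R d)).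
Qed.

Lemma continuous_measurable_phase (h : @phase R d -> R) :
  continuous h -> measurable_fun setT (h : M -> measurableTypeR R).
Proof.
move=> ch; apply: (measurability _ (RGenOInfty.measurableE R)).
move=> _ [_ [x ->] <-]; rewrite setTI; apply: measurable_phase; apply: sub_sigma_algebra.
rewrite [X in open X](_ : _ = h @^-1` [set y | x < y]); last first.
  by apply/seteqP; split => z /=; rewrite in_itv /= andbT.
by apply: open_comp; [move=> z _; exact: ch|exact: open_gt].
Qed.

(* Bounded measurable functions supported in a ball: the admissible multipliers
   of locally integrable functions. *)
Definition adm (w : M -> R) : Prop := measurable_fun setT w /\
  exists C r, [/\ 0 <= C, 0 < r & forall z, `|w z| <= C * \1_(ball0 r) z].

Lemma derive_outside_support (phi : @phase R d -> R) z u : ~ closure [set z | phi z != 0] z ->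
  'D_u phi z = 0.
Proof.
move=> hz; have oz : open (~` closure [set z | phi z != 0]).
  by apply: closed_openC; exact: closed_closure.
have h : is_derive z u phi (0 : R).
  apply: (near_eq_is_derive _ (is_derive_cst (0 : R) _ _)).
  have := open_nbhs_nbhs (conj oz hz); apply: filterS => x hx.
  by apply/esym/eqP; apply/negPn/negP => px; apply: hx; exact: subset_closure.
by have [] := h.
Qed.

Lemma adm_compact (K : set (@phase R d)) (phi : @phase R d -> R) : compact K ->
  continuous phi -> (forall z, ~ K z -> phi z = 0) -> adm phi.
Proof.
move=> cK cphi phi0; split; first exact: continuous_measurable_phase.
have /compact_bounded [B [_ hB]] : compact (phi @` K).
  by apply: continuous_compact => //; exact: continuous_subspaceT.
have /compact_bounded [r [_ hr]] := cK.
exists (`|B| + 1), (`|r| + 2); split; [by rewrite addr_ge0|by rewrite ltr_wpDl|move=> z].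
have [Kz|Kz] := pselect (K z); last first.
  by rewrite phi0// normr0 mulr_ge0// addr_ge0.
have hz : `|z| <= `|r| + 1.
  by apply: (hr (`|r| + 1) _ z Kz); rewrite (le_lt_trans (ler_norm r))// ltrDl.
rewrite indicE mem_set ?mulr1.
  by apply: (hB (`|B| + 1)); [rewrite (le_lt_trans (ler_norm B))// ltrDl|exists z].
rewrite -ball_normE /ball_ /= sub0r normrN (le_lt_trans hz)// ltrD2l; lra.
Qed.

Lemma adm_test (T : R) (phi : @phase R d -> R) : test_fun T phi -> adm phi.
Proof.
move=> [sm [cK _]]; apply: (adm_compact cK); first exact: (sm 0).
by move=> z hz; apply/eqP; apply/negPn/negP => h; apply: hz; exact: subset_closure.
Qed.

Lemma adm_deriv (T : R) (phi : @phase R d -> R) u : test_fun T phi ->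
  adm (fun z => 'D_u phi z).
Proof.
move=> [sm [cK _]]; apply: (adm_compact cK); first exact: (sm 1 u).2.
by move=> z /(derive_outside_support u).
Qed.

Lemma le_indic (A B : set M) z : A `<=` B -> (\1_A z : R) <= \1_B z.
Proof.
move=> AB; rewrite !indicE; case: (boolP (z \in A)) => [/set_mem h|_]; last exact: ler0n.
by rewrite mem_set; [exact: lexx|exact: AB].
Qed.

Lemma le_indic_ball (r r' : R) z : r <= r' -> (\1_(ball0 r) z : R) <= \1_(ball0 r') z.
Proof. by move=> rr'; apply: le_indic => x; exact: (le_ball rr'). Qed.

Lemma admD w1 w2 : adm w1 -> adm w2 -> adm (fun z => w1 z + w2 z).
Proof.
move=> [m1 [C1 [r1 [C10 r10 h1]]]] [m2 [C2 [r2 [C20 r20 h2]]]]; split.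
  exact: measurable_funD.
exists (C1 + C2), (r1 + r2); split; [exact: addr_ge0|exact: addr_gt0|move=> z].
apply: (le_trans (ler_normD _ _)); rewrite mulrDl; apply: lerD.
- by apply: (le_trans (h1 z)); apply: ler_wpM2l C10 _ _ _; apply: le_indic_ball; rewrite lerDl ltW.
- by apply: (le_trans (h2 z)); apply: ler_wpM2l C20 _ _ _; apply: le_indic_ball; rewrite lerDr ltW.
Qed.

Lemma adm0 : adm (fun=> 0).
Proof. by split => //; exists 0, 1; split => // z; rewrite normr0 mul0r. Qed.

Lemma adm_sum (F : 'I_d -> M -> R) : (forall i, adm (F i)) -> adm (fun z => \sum_(i < d) F i z).
Proof.
move=> h; have : forall s : seq 'I_d, adm (fun z => \sum_(i <- s) F i z).
  elim => [|i s IH].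
    by rewrite (_ : (fun z => _) = fun=> 0); [exact: adm0|apply/funext => z; rewrite big_nil].
  rewrite (_ : (fun z => _) = fun z => F i z + \sum_(i <- s) F i z); first exact: admD.
  by apply/funext => z; rewrite big_cons.
by move=> /(_ (index_enum 'I_d)).
Qed.

Lemma adm_mul_v i w : adm w -> adm (fun z => z.2.2 ord0 i * w z).
Proof.
move=> [m [C [r [C0 r0 h]]]]; split.
  by apply: measurable_funM => //; exact: measurable_v_fst.
exists (r * C), r; split; [by rewrite mulr_ge0// ltW|by []|move=> z].
rewrite normrM; move: (h z); rewrite indicE; case: (boolP (_ \in _)) => [/set_mem bz|_].
  rewrite !mulr1 => wC; apply: ler_pM => //.
  have := bz.2.2.2 ord0 i; rewrite /ball /= mxE sub0r normrN.
  exact: ltW.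
by rewrite !mulr0 normr_le0 => /eqP ->; rewrite normr0 mulr0.
Qed.

(** On the ball |h| <= 1 + |h|^P, so a single integrable majorant serves every exponent P >= 1. *)
Lemma integrable_adm (D : set M) (P : R) (h w : M -> R) : measurable D -> 1 <= P ->
  measurable_fun D h -> (\int[mu]_(z in D) (`|h z| `^ P)%:E < +oo)%E -> adm w ->
  mu.-integrable D (fun z => (h z * w z)%:E).
Proof.
move=> mD P1 mh hP [mw [C [r [C0 r0 hw]]]].
have mB := measurable_ball0 r.
have mw' : measurable_fun D w by apply: measurable_funS mw.
have i1 : mu.-integrable D (fun z => (\1_(ball0 r) z)%:E).
  apply/integrableP; split; first by apply/measurable_EFinP; exact: measurable_indic.
  rewrite (eq_integral (fun z => (\1_(ball0 r) z)%:E)); last first.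
    by move=> z _ /=; rewrite ger0_norm.
  rewrite integral_indic//; apply: le_lt_trans (phase_ball_lty d r0).
  by apply: (le_measure mu); rewrite ?inE//; exact: measurableI.
have i2 : mu.-integrable D (fun z => (`|h z| `^ P)%:E).
  apply/integrableP; split.
    apply/measurable_EFinP; apply: (measurableT_comp (measurable_powR P)).
    exact: measurableT_comp.
  rewrite (eq_integral (fun z => (`|h z| `^ P)%:E))//.
  by move=> z _ /=; rewrite ger0_norm ?powR_ge0.
have i3 : mu.-integrable D (fun z => (C * (\1_(ball0 r) z + `|h z| `^ P))%:E).
  rewrite (_ : (fun z => _) = (fun z => C%:E * ((\1_(ball0 r) z)%:E + (`|h z| `^ P)%:E))%E).
    by apply: integrableZl => //; exact: integrableD.
  by apply/funext => z; rewrite EFinM EFinD.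
apply: (le_integrable mD _ _ i3).
  by apply/measurable_EFinP; exact: measurable_funM.
move=> z _ /=; rewrite lee_fin [leRHS]ger0_norm; last first.
  by rewrite mulr_ge0// addr_ge0// powR_ge0.
rewrite normrM; move: (hw z); rewrite indicE; case: (boolP (_ \in _)) => _; last first.
  rewrite mulr0 normr_le0 => /eqP ->; rewrite normr0 mulr0 mulr_ge0// add0r powR_ge0//.
rewrite mulr1 mulrC => wC; apply: ler_pM => //.
have [h1|h1] := leP `|h z| 1.
  by apply: (le_trans h1); rewrite lerDl powR_ge0.
rewrite -[leLHS]add0r lerD// -[leLHS]powRr1//.
by apply: ler_powR => //; exact: ltW.
Qed.

End bounded_support.

(** * Testing the subsolution and the weak gradient *)

Section weak_inequality.
Local Opaque phi phi_.
Context {R : realType} (d : nat) (th T : R).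
Hypotheses (th_gt0 : 0 < th) (th_le1 : th <= 1).
Local Notation M := (@PH R d).
Local Notation mu := (phase_measure d).
Local Notation O := (@OM R d T).
Variables (f : @phase R d -> R) (G S0 : @phase R d -> 'rV[R]_d) (S1 : @phase R d -> R).
Variables (P1 P2 P3 : R).
Hypotheses (P1_ge1 : 1 <= P1) (P2_ge1 : 1 <= P2) (P3_ge1 : 1 <= P3).
Hypotheses (mf : measurable_fun O f) (f_ge0 : forall z, O z -> 0 <= f z)
  (f2 : (\int[mu]_(z in O) (`|f z| `^ 2)%:E < +oo)%E).
Hypotheses (mG : forall i, measurable_fun O (fun z => G z ord0 i))
  (GP : forall i, (\int[mu]_(z in O) (`|G z ord0 i| `^ P1)%:E < +oo)%E).
Hypotheses (mS0 : forall i, measurable_fun O (fun z => S0 z ord0 i))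
  (S0P : forall i, (\int[mu]_(z in O) (`|S0 z ord0 i| `^ P2)%:E < +oo)%E).
Hypotheses (mS1 : measurable_fun O S1)
  (S1P : (\int[mu]_(z in O) (`|S1 z| `^ P3)%:E < +oo)%E).
Hypotheses (wG : weak_grad_v T f G) (wS : weak_subsol T f S0 S1).

Variable z0 : @phase R d.
Hypothesis z0T : z0.1 < T.
Local Notation tt := (tau z0).

Section fixed_cutoff.
Variables (ep Mx : R).
Hypotheses (ep_gt0 : 0 < ep) (Mx_gt0 : 0 < Mx).
Local Notation phi := (@phi R d th ep Mx).
Local Notation phi_ := (@phi_ R d th ep Mx).
Let mO : measurable O := @measurable_OM R d T.

(* The integrand left after testing the subsolution with [phi] and replacing the
   velocity derivatives of the [phi_ i] by the weak gradient. *)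
Definition Psi (z : @phase R d) : R := if 0 < tt z then
   f z * (chid z0 ep Mx z * Gam th z0 z) + \sum_(i < d) G z ord0 i * eval z0 (phi_ i) z
   + \sum_(i < d) S0 z ord0 i * eval z0 (diff z0 (dir_v i) phi) z
   - S1 z * eval z0 phi z else 0.

Let tphi : test_fun T (cut z0 phi) := (test_fun_phi th_gt0 th_le1 ep_gt0 Mx_gt0 z0T).2.
Let vphi : vanishes z0 ep phi := (test_fun_phi th_gt0 th_le1 ep_gt0 Mx_gt0 z0T).1.
Let tphi_ i : test_fun T (cut z0 (phi_ i)) := (test_fun_phi_ th_gt0 th_le1 ep_gt0 Mx_gt0 i z0T).2.
Let vphi_ i : vanishes z0 ep (phi_ i) := (test_fun_phi_ th_gt0 th_le1 ep_gt0 Mx_gt0 i z0T).1.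

Let A (z : M) : R :=
  - f z * ('D_(dir_t d) (cut z0 phi) z
                + \sum_(i < d) z.2.2 ord0 i * 'D_(dir_x i) (cut z0 phi) z)
       + \sum_(i < d) S0 z ord0 i * 'D_(dir_v i) (cut z0 phi) z
       - S1 z * cut z0 phi z.
Let B i (z : M) : R := f z * 'D_(dir_v i) (cut z0 (phi_ i)) z.
Let C i (z : M) : R := G z ord0 i * cut z0 (phi_ i) z.

Let integrable_A : mu.-integrable O (EFin \o A).
Proof.
have i1 : mu.-integrable O (fun z => (f z * ('D_(dir_t d) (cut z0 phi) z
      + \sum_(i < d) z.2.2 ord0 i * 'D_(dir_x i) (cut z0 phi) z))%:E).
  apply: (integrable_adm mO _ mf f2); first exact: ler1n.
  apply: (admD (adm_deriv _ tphi)); apply: adm_sum => i; apply: adm_mul_v.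
  exact: (adm_deriv _ tphi).
have i2 : mu.-integrable O (fun z => (\sum_(i < d) (S0 z ord0 i * 'D_(dir_v i) (cut z0 phi) z)%:E)%E).
  apply: integrable_sum => // i _.
  exact: (integrable_adm mO P2_ge1 (mS0 i) (S0P i) (adm_deriv _ tphi)).
have i3 : mu.-integrable O (fun z => (S1 z * cut z0 phi z)%:E).
  exact: (integrable_adm mO P3_ge1 mS1 S1P (adm_test tphi)).
have := integrableD mO (integrableD mO (integrableN i1) i2) (integrableN i3).
congr integrable; apply/funext => z /=.
by rewrite /A EFinD EFinN EFinD mulNr EFinN sumEFin.
Qed.

Let integrable_B i : mu.-integrable O (EFin \o B i).
Proof. by apply: (integrable_adm mO _ mf f2); [exact: ler1n|exact: (adm_deriv _ (tphi_ i))]. Qed.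

Let integrable_C i : mu.-integrable O (EFin \o C i).
Proof. exact: (integrable_adm mO P1_ge1 (mG i) (GP i) (adm_test (tphi_ i))). Qed.

Let int_A : (\int[mu]_(z in O) (A z)%:E <= 0)%E.
Proof.
rewrite -(integrable_OintE integrable_A); apply: (wS tphi) => z.
rewrite /cut; case: ifPn => // t0; exact: phi_ge0.
Qed.

Let int_BC i : (\int[mu]_(z in O) ((B i z)%:E + (C i z)%:E) = 0)%E.
Proof.
have := wG (tphi_ i) i; rewrite (integrable_OintE (integrable_B i)) (integrable_OintE (integrable_C i)).
move=> h; rewrite integralD//; last 2 first.
  exact: integrable_B.
  exact: integrable_C.
rewrite h /= addeC subee//.
by apply: integrable_fin_num => //; exact: integrable_C.
Qed.

(** Each B_i + C_i integrates to zero by the weak gradient identity. Adding them cancels f times the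
    velocity divergence of the [phi_ i], which the kinetic derivative of [phi] has produced, and
    leaves the gradient in its place. *)
Let PsiE z : Psi z = A z + \sum_(i < d) (B i z + C i z).
Proof.
have D u : 'D_u (cut z0 phi) z = cut z0 (diff z0 u phi) z by apply: derive_cut ep_gt0 vphi.
have D_ i : 'D_(dir_v i) (cut z0 (phi_ i)) z = cut z0 (diff z0 (dir_v i) (phi_ i)) z.
  exact: derive_cut ep_gt0 (vphi_ i).
have -> : A z = - f z * (cut z0 (diff z0 (dir_t d) phi) z
                + \sum_(i < d) z.2.2 ord0 i * cut z0 (diff z0 (dir_x i) phi) z)
       + \sum_(i < d) S0 z ord0 i * cut z0 (diff z0 (dir_v i) phi) z
       - S1 z * cut z0 phi z.
  by rewrite /A D; congr (_ * (_ + _) + _ - _); apply: eq_bigr => i _; rewrite D.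
have -> : \sum_(i < d) (B i z + C i z) = \sum_(i < d) (f z * cut z0 (diff z0 (dir_v i) (phi_ i)) z +
    G z ord0 i * cut z0 (phi_ i) z) by apply: eq_bigr => i _; rewrite /B /C D_.
rewrite /Psi.
rewrite /cut; case: ifPn => t0; last first.
  rewrite !big1 ?addr0 ?mulr0 ?subr0 ?addr0// => i _; by rewrite ?mulr0 ?addr0.
have SE k (a b : 'I_d -> R) : \sum_(i < d) (k * a i + b i) = k * \sum_(i < d) a i + \sum_(i < d) b i.
  by rewrite big_split mulr_sumr.
rewrite diff_kdir diff_phi_k// (SE _ (fun i => eval z0 (diff z0 (dir_v i) (phi_ i)) z)).
set a := \sum_(i < d) eval z0 (diff z0 (dir_v i) (phi_ i)) z.
set b := \sum_(i < d) G z ord0 i * eval z0 (phi_ i) z.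
set c := \sum_(i < d) S0 z ord0 i * eval z0 (diff z0 (dir_v i) phi) z.
by move: a b c (chid _ _ _ _) (Gam _ _ _) (S1 z * _) => a b c e g s; ring.
Qed.

Let integrable_BC : mu.-integrable O (fun z => (\sum_(i < d) ((B i z)%:E + (C i z)%:E))%E).
Proof.
apply: integrable_sum => // i _.
by apply: integrableD => //; [exact: integrable_B|exact: integrable_C].
Qed.

Let EPsi : EFin \o Psi = (fun z => (A z)%:E + \sum_(i < d) ((B i z)%:E + (C i z)%:E))%E.
Proof. by apply/funext => z /=; rewrite PsiE EFinD -sumEFin. Qed.

Lemma integrable_Psi : mu.-integrable O (EFin \o Psi).
Proof. by rewrite EPsi; exact: (integrableD mO integrable_A integrable_BC). Qed.

Lemma integral_Psi_le0 : (\int[mu]_(z in O) (Psi z)%:E <= 0)%E.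
Proof.
rewrite [leLHS](_ : _ = \int[mu]_(z in O) ((EFin \o Psi) z))%E// EPsi integralD//.
rewrite [X in (_ + X)%E](_ : _ = 0) ?adde0; first exact: int_A.
rewrite integral_sum//; last by move=> i; apply: integrableD => //; [exact: integrable_B|exact: integrable_C].
by rewrite big1// => i _; exact: int_BC.
Qed.

End fixed_cutoff.

Hypothesis D_gt1 : 1 < hdim d th.
Local Notation k3 := (kker th 3 z0).
Let mO : measurable O := @measurable_OM R d T.

(** Gathers the weights of [phi__bound], [diff_phi_v_bound] and [phi_bound]; its integral is what
    the three potentials control. *)
Definition rho (z : @phase R d) : R :=
  (\sum_(i < d) `|G z ord0 i|) * (tt z `^ (th - 1) * k3 z) +
  (\sum_(i < d) `|S0 z ord0 i|) * (tt z `^ (- th) * k3 z) + `|S1 z| * k3 z.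

Definition tail (ep : R) (z : @phase R d) : R := f z * ((ep <= tt z)%R%:R * k3 z).

Lemma rho_ge0 z : 0 <= rho z.
Proof.
by rewrite /rho !addr_ge0// !mulr_ge0 ?sumr_ge0 ?powR_ge0 ?kker_ge0.
Qed.

Let mk3 : measurable_fun O k3.
Proof. by apply: measurable_funTS; exact: measurable_kker2. Qed.

Let mtp a : measurable_fun O (fun z : M => tt z `^ a).
Proof. by apply: measurable_funTS; apply: (measurableT_comp (measurable_powR a)); exact: measurable_tau2. Qed.

Let mabs (h : M -> R) : measurable_fun O h -> measurable_fun O (fun z => `|h z|).
Proof. by move=> mh; exact: measurableT_comp. Qed.

Lemma measurable_rho : measurable_fun O rho.
Proof.
apply: measurable_funD; first apply: measurable_funD.
- apply: measurable_funM; first by apply: measurable_sum => i; exact: mabs.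
  by apply: measurable_funM; [exact: mtp|exact: mk3].
- apply: measurable_funM; first by apply: measurable_sum => i; exact: mabs.
  by apply: measurable_funM; [exact: mtp|exact: mk3].
- by apply: measurable_funM; [exact: mabs|exact: mk3].
Qed.

Lemma measurable_tail ep : measurable_fun O (tail ep).
Proof.
apply: measurable_funM; first exact: mf.
apply: measurable_funM; last exact: mk3.
by apply: measurable_funTS; apply: measurable_ler_nat => //; exact: measurable_tau2.
Qed.

Lemma tail_ge0 ep z : O z -> 0 <= tail ep z.
Proof.
move=> Oz; apply: mulr_ge0; first exact: f_ge0.
by apply: mulr_ge0; [exact: ler0n|exact: kker_ge0].
Qed.

(** By f k <= f^2 + k^2 it suffices that the truncated kernel is in L^2. Its square is the kernel
    times tau^(- hdim) on tau >= ep, and this time weight is integrable at infinity because hdim >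
    1. *)
Lemma tail_lty ep : 0 < ep -> (\int[mu]_(z in O) (tail ep z)%:E < +oo)%E.
Proof.
move=> ep0.
(* The exponent is - hdim, written in the shape required by [integral_powR_ge]. *)
pose psi (s : R) : R := (ep <= s)%R%:R * s `^ (- (hdim d th - 1) - 1).
have mpsi : measurable_fun setT (psi : measurableTypeR R -> R).
  apply: measurable_funM; last exact: measurable_powR.
  by apply: measurable_ler_nat.
have psi0 s : 0 <= psi s by rewrite mulr_ge0 ?powR_ge0.
have mpsik : measurable_fun setT (fun z : M => psi (tt z) * k3 z).
  by apply: measurable_funM; [exact: (measurableT_comp mpsi (measurable_tau2 z0))|exact: measurable_kker2].
have mf2 : measurable_fun O (fun z => `|f z| `^ 2).
  by apply: (measurableT_comp (measurable_powR 2)); exact: mabs.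
apply: (@le_lt_trans _ _ (\int[mu]_(z in O) ((`|f z| `^ 2)%:E + (psi (tt z) * k3 z)%:E))%E).
  apply: ge0_le_integral => //.
  - by move=> z Oz; rewrite lee_fin tail_ge0.
  - by apply/measurable_EFinP; exact: measurable_tail.
  - apply/measurable_EFinP; apply: measurable_funD => //; exact: measurable_funTS.
  - move=> z Oz; rewrite -EFinD lee_fin /tail.
    have f0 := f_ge0 Oz; rewrite (ger0_norm f0) -[2]/(2%:R) powR_mulrn//.
    have -> : psi (tt z) * k3 z = ((ep <= tt z)%R%:R * k3 z) ^+ 2.
      rewrite /psi /kker exprMn; have [h|_] := leP ep (tt z); last by rewrite !mul0r expr0n mul0r.
      have t0 : 0 < tt z by exact: lt_le_trans h.
      rewrite expr1n !mul1r exprMn.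
      have -> : (\1_(kbox th 3) (z0, z) : R) ^+ 2 = \1_(kbox th 3) (z0, z).
        by rewrite indicE; case: (_ \in _); rewrite ?expr1n ?expr0n.
      rewrite mulrCA; congr (_ * _); rewrite expr2; congr (_ * _); congr (_ `^ _); ring.
    set k := _ * k3 z.
    have := sqr_ge0 (f z - k); have := sqr_ge0 (f z + k); rewrite !expr2; nra.
have m1 : measurable_fun O (fun z => (`|f z| `^ 2)%:E) by exact/measurable_EFinP.
have m2 : measurable_fun O (fun z => (psi (tt z) * k3 z)%:E).
  by apply/measurable_EFinP; exact: measurable_funTS.
have p2 z : O z -> (0 <= (psi (tt z) * k3 z)%:E)%E by rewrite lee_fin mulr_ge0 ?kker_ge0.
rewrite ge0_integralD//.
apply: lte_add_pinfty; first exact: f2.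
apply: (@le_lt_trans _ _ (\int[mu]_z (psi (tt z) * k3 z)%:E)%E).
  apply: ge0_subset_integral => //; first exact/measurable_EFinP.
  by move=> z _; rewrite lee_fin mulr_ge0 ?kker_ge0.
rewrite (kker_mass2 _ _ mpsi psi0)//.
have b0 : 0 < hdim d th - 1 by rewrite subr_gt0.
have := integral_powR_ge b0 ep0; move=> h.
apply: (@le_lt_trans _ _ ((kmass d (3 : R))%:E * (ep `^ (- (hdim d th - 1)) / (hdim d th - 1))%:E)%E).
  by apply: lee_wpmul2l h; rewrite lee_fin exprn_ge0.
by rewrite -EFinM ltry.
Qed.

(** The rise of [chi] together with [Gam_lower] gives the left side, its fall together with
    [Gam_bound] gives the [tail] term, and [rho] bounds the remaining terms of [Psi]. Where tau <= 0
    the left side is zero. *)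
Lemma Psi_lower ep Mx z : 0 < ep -> 0 < Mx -> 6 * ep <= Mx -> O z ->
  cgam ^+ d.+1 * (f z * wker th 8^-1 ep z0 z) <=
  Psi ep Mx z + (2 / Mx * cbd ^+ d * tail ep z + cbd ^+ d * rho z).
Proof.
move=> ep0 Mx0 h6 Oz; have f0 := f_ge0 Oz.
have cb0 : 0 <= cbd ^+ d :> R by rewrite exprn_ge0// cbd_ge0.
have k30 := kker_ge0 th 3 z0 z.
rewrite /Psi; case: ifPn => t0; last first.
  rewrite (_ : wker _ _ _ _ _ = 0); last first.
    rewrite /wker /bump; case: ltP => h; last by rewrite mul0r mulr0 mul0r.
    by move: t0; rewrite (lt_trans _ h)// mulr_gt0.
  rewrite !mulr0 add0r; apply: addr_ge0; last by rewrite mulr_ge0 ?rho_ge0.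
  by apply: mulr_ge0; [rewrite mulr_ge0// divr_ge0// ltW|exact: tail_ge0].
have Gl := Gam_lower th_gt0 th_le1 t0; have Gu := Gam_bound th_gt0 th_le1 t0.
have cl := chid_lower ep0 Mx0 t0 h6.
rewrite -/(Gam th z0 z) in Gl Gu.
have cg0 : 0 <= cgam :> R by rewrite ltW// cgam_gt0.
have main : cgam ^+ d.+1 * (f z * wker th 8^-1 ep z0 z) <=
    f z * (chid z0 ep Mx z * Gam th z0 z) + 2 / Mx * cbd ^+ d * tail ep z.
  rewrite /wker /tail.
  have b0 := bump_ge0 (tt z) ep0.
  have i0 : 0 <= (ep <= tt z)%R%:R :> R by [].
  have G0 := Gam_ge0 th t0.
  have a1 : (cgam * bump ep (tt z)) * (cgam ^+ d * kker th 8^-1 z0 z) <=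
      (cgam * bump ep (tt z)) * Gam th z0 z by rewrite ler_wpM2l// mulr_ge0.
  have a2 : (2 / Mx * (ep <= tt z)%R%:R) * Gam th z0 z <=
      (2 / Mx * (ep <= tt z)%R%:R) * (cbd ^+ d * k3 z).
    by rewrite ler_wpM2l// mulr_ge0// divr_ge0// ltW.
  have a3 : (cgam * bump ep (tt z) - 2 / Mx * (ep <= tt z)%R%:R) * Gam th z0 z <= chid z0 ep Mx z * Gam th z0 z.
    by rewrite ler_wpM2r.
  have a4 : (cgam * bump ep (tt z)) * (cgam ^+ d * kker th 8^-1 z0 z) <=
     chid z0 ep Mx z * Gam th z0 z + (2 / Mx * (ep <= tt z)%R%:R) * (cbd ^+ d * k3 z).
    apply: (le_trans a1); rewrite -lerBlDr; apply: le_trans a3.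
    by rewrite mulrBl lerD2l lerN2.
  have := ler_wpM2l f0 a4; rewrite exprS.
  move: (chid _ _ _ _) (Gam _ _ _) (bump _ _) (kker th 8^-1 z0 z) (k3 z) (cbd ^+ d) cgam (cgam ^+ d) ((ep <= tt z)%R%:R : R) (2 / Mx) (f z).
  move=> c g b k k' cb c1 cg i m fz h.
  rewrite [leLHS](_ : _ = fz * (c1 * b * (cg * k))); last by ring.
  by rewrite [leRHS](_ : _ = fz * (c * g + m * i * (cb * k'))); last by ring.
have bsum (x : @phase R d -> 'rV[R]_d) (e : 'I_d -> R) (b : R) : (forall i, `|e i| <= cbd ^+ d * b) ->
    - (cbd ^+ d * ((\sum_(i < d) `|x z ord0 i|) * b)) <= \sum_(i < d) x z ord0 i * e i.
  move=> he; rewrite mulr_suml mulr_sumr -sumrN; apply: ler_sum => i _.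
  by rewrite lerNl; apply: (le_trans (ler_norm _)); rewrite normrN normrM mulrCA ler_wpM2l.
have g1 := bsum G _ _ (fun i => phi__bound th_gt0 th_le1 ep Mx i t0).
have g2 := bsum S0 _ _ (fun i => diff_phi_v_bound th_gt0 th_le1 ep Mx i t0).
have g3 : S1 z * eval z0 (phi d th ep Mx) z <= cbd ^+ d * (`|S1 z| * k3 z).
  rewrite (le_trans (ler_norm _))// normrM mulrCA ler_wpM2l//.
  exact: (phi_bound th_gt0 th_le1 ep Mx t0).
rewrite /rho; move: main g1 g2 g3.
move: (f z * (_ * _)) (_ ^+ d.+1 * _) (_ * tail _ _) (_ * eval _ _ _) (\sum_(i < d) G _ _ _ * _) (\sum_(i < d) S0 _ _ _ * _) => a1 a2 a3 a4 a5 a6.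
rewrite !mulrDr; lra.
Qed.

Local Open Scope ereal_scope.

(** Integrating [Psi_lower] leaves an error proportional to 1/Mx times the integral of [tail ep],
    which is finite and does not involve Mx; with ep fixed, Mx tends to infinity. *)
Lemma average_le_potentials ep : (0 < ep)%R ->
  (cgam ^+ d.+1)%:E * \int[mu]_(z in O) (f z * wker th 8^-1 ep z0 z)%:E <=
  (cbd ^+ d)%:E * \int[mu]_(z in O) (rho z)%:E.
Proof.
move=> ep0.
have cg0 : (0 < cgam ^+ d.+1 :> R)%R by rewrite exprn_gt0// cgam_gt0.
have cb0 : (0 <= cbd ^+ d :> R)%R by rewrite exprn_ge0// cbd_ge0.
have mfw : measurable_fun O (fun z => f z * wker th 8^-1 ep z0 z)%R.
  apply: measurable_funM; first exact: mf.
  apply: measurable_funTS.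
  suff : measurable_fun setT ((fun p : M * M => wker th 8^-1 ep p.1 p.2) \o (fun z : M => (z0 : M, z))) by [].
  by apply: measurableT_comp; [exact: measurable_wker|exact: measurable_fun_pair].
have fw0 z : O z -> (0 <= f z * wker th 8^-1 ep z0 z)%R.
  by move=> /f_ge0 h; rewrite mulr_ge0// wker_ge0.
have pull (c : R) (h : @phase R d -> R) : (0 <= c)%R -> measurable_fun O h ->
    (forall z, O z -> (0 <= h z)%R) ->
    c%:E * \int[mu]_(z in O) (h z)%:E = \int[mu]_(z in O) (c * h z)%:E.
  move=> c0 mh h0; under [RHS]eq_integral do rewrite EFinM.
  rewrite ge0_integralZl_EFin//; last exact/measurable_EFinP.
rewrite (pull _ _ (ltW cg0) mfw fw0) (pull _ _ cb0 measurable_rho (fun z _ => rho_ge0 z)).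
set L := (X in X <= _); set Rr := (X in _ <= X).
have [->|Rfin] := eqVneq Rr +oo; first by rewrite leey.
have Rr0 : 0 <= Rr by apply: integral_ge0 => z _; rewrite lee_fin mulr_ge0 ?rho_ge0.
set K := \int[mu]_(z in O) (tail ep z)%:E.
have K0 : 0 <= K by apply: integral_ge0 => z Oz; rewrite lee_fin tail_ge0.
have Kfin : K \is a fin_num by rewrite ge0_fin_numE//; exact: tail_lty.
have bound (Mx : R) : (0 < Mx)%R -> (6 * ep <= Mx)%R ->
    L <= (2 / Mx * cbd ^+ d)%:E * K + Rr.
  move=> Mx0 h6.
  have c0 : (0 <= 2 / Mx * cbd ^+ d)%R by rewrite mulr_ge0// divr_ge0// ltW.
  pose b (z : @phase R d) : R := (2 / Mx * cbd ^+ d * tail ep z + cbd ^+ d * rho z)%R.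
  have mt := measurable_tail ep; have mr := measurable_rho.
  have bE : \int[mu]_(z in O) (b z)%:E = (2 / Mx * cbd ^+ d)%:E * K + Rr.
    under eq_integral do rewrite EFinD.
    rewrite ge0_integralD//; last 4 first.
    - by move=> z Oz; rewrite lee_fin mulr_ge0// tail_ge0.
    - by apply/measurable_EFinP; exact: measurable_funM.
    - by move=> z Oz; rewrite lee_fin mulr_ge0// rho_ge0.
    - by apply/measurable_EFinP; exact: measurable_funM.
    congr (_ + _); by rewrite (pull _ _ c0 mt (@tail_ge0 ep)).
  have ib : mu.-integrable O (EFin \o b).
    apply/integrableP; split.
      by apply/measurable_EFinP; apply: measurable_funD; exact: measurable_funM.
    have -> : \int[mu]_(z in O) `|(EFin \o b) z| = \int[mu]_(z in O) (b z)%:E.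
      apply: eq_integral => z /set_mem Oz /=; rewrite ger0_norm// addr_ge0// mulr_ge0 ?rho_ge0//.
      exact: tail_ge0.
    rewrite bE; apply: lte_add_pinfty; last by rewrite ltey.
    by rewrite -(fineK Kfin) -EFinM ltry.
  have iP := integrable_Psi ep0 Mx0.
  apply: (@le_trans _ _ (\int[mu]_(z in O) ((EFin \o Psi ep Mx) z + (EFin \o b) z))).
    apply: ge0_le_integral => //.
    - by move=> z Oz; rewrite lee_fin mulr_ge0 ?fw0// ltW.
    - by apply/measurable_EFinP; exact: measurable_funM.
    - exact: measurable_int (integrableD mO iP ib).
    - by move=> z Oz /=; rewrite -EFinD lee_fin; exact: Psi_lower.
  rewrite integralD// -bE -[leRHS]add0e; apply: leeD => //.
  exact: integral_Psi_le0.
apply/lee_addgt0Pr => e e0.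
(* Large enough for [chid_lower] and for the error to be at most e. *)
pose Mx : R := (Num.max (6 * ep) ((2 * cbd ^+ d * fine K) / e + 1))%R.
have M1 : (6 * ep <= Mx)%R by rewrite le_max lexx.
have M2 : ((2 * cbd ^+ d * fine K) / e + 1 <= Mx)%R by rewrite le_max lexx orbT.
have Mx0 : (0 < Mx)%R by apply: lt_le_trans M1; rewrite mulr_gt0.
apply: (le_trans (bound Mx Mx0 M1)); rewrite addeC leeD2l//.
rewrite -(fineK Kfin) -EFinM lee_fin.
rewrite [leLHS](_ : _ = (2 * cbd ^+ d * fine K) / Mx)%R; last by ring.
rewrite ler_pdivrMr// [(e * Mx)%R]mulrC -ler_pdivrMr//; apply: le_trans M2.
by rewrite lerDl.
Qed.

End weak_inequality.

(** * The estimate *)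

Section extension_by_zero.
Context {R : realType} (d : nat).
Local Notation M := (@PH R d).
Local Notation mu := (phase_measure d).
Variables (D : set M) (h : M -> R).
Hypotheses (mD : measurable D) (mh : measurable_fun D h).

(** The data are controlled only for t < T, while the potentials integrate over the whole phase
    space. *)
Definition ext0 (z : M) : R := if z \in D then h z else 0.

Lemma measurable_ext0 : measurable_fun setT ext0.
Proof.
rewrite (_ : ext0 = h \_ D); first exact/(measurable_restrictT h mD).
by apply/funext => z; rewrite patchE.
Qed.

Lemma ext0_ge0 z : (forall x, D x -> 0 <= h x) -> 0 <= ext0 z.
Proof. by move=> h0; rewrite /ext0; case: ifPn => // /set_mem /h0. Qed.

Lemma integral_ext0_powR (P : R) : 0 < P ->
  (\int[mu]_z (ext0 z `^ P)%:E = \int[mu]_(z in D) (h z `^ P)%:E)%E.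
Proof.
move=> P0; rewrite [RHS]integral_mkcond; apply: eq_integral => z _.
by rewrite patchE /ext0; case: ifPn => // _; rewrite powR0// gt_eqF.
Qed.

Lemma integral_ext0_mul (w : M -> R) :
  (\int[mu]_z (ext0 z * w z)%:E = \int[mu]_(z in D) (h z * w z)%:E)%E.
Proof.
rewrite [RHS]integral_mkcond; apply: eq_integral => z _.
by rewrite patchE /ext0; case: ifPn => // _; rewrite mul0r.
Qed.

End extension_by_zero.

Section euclidean_norm.
Context {R : realType} (d : nat).
Local Notation M := (@PH R d).

Lemma eucl_ge0 (w : 'rV[R]_d) : 0 <= eucl w.
Proof. exact: sqrtr_ge0. Qed.

Lemma coord_le_eucl (w : 'rV[R]_d) i : `|w ord0 i| <= eucl w.
Proof.
rewrite -sqrtr_sqr ler_wsqrtr// (bigD1 i)//= lerDl.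
by apply: sumr_ge0 => j _; exact: sqr_ge0.
Qed.

Lemma sum_coord_le_eucl (w : 'rV[R]_d) : \sum_(i < d) `|w ord0 i| <= d%:R * eucl w.
Proof.
apply: (@le_trans _ _ (\sum_(i < d) eucl w)).
  by apply: ler_sum => i _; exact: coord_le_eucl.
by rewrite sumr_const card_ord [leRHS]mulr_natl.
Qed.

Lemma measurable_eucl (D : set M) (G : @phase R d -> 'rV[R]_d) :
  (forall i, measurable_fun D (fun z => G z ord0 i)) ->
  measurable_fun D (fun z => eucl (G z)).
Proof.
move=> mG; rewrite (_ : (fun z => _) = fun z => (\sum_(i < d) (G z ord0 i) ^+ 2) `^ 2^-1).
  apply: (measurableT_comp (measurable_powR 2^-1)).
  by apply: measurable_sum => i; exact: measurable_funX.
apply/funext => z; rewrite powR12_sqrt// sumr_ge0// => i _; exact: sqr_ge0.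
Qed.

End euclidean_norm.

Lemma Lpnorm_normr (R : realType) (d : nat) (T P : R) (h : @phase R d -> R) :
  Lpnorm T P (fun z => `|h z|) = Lpnorm T P h.
Proof.
have E : (fun z => (`| `|h z| | `^ P)%:E) = (fun z => (`|h z| `^ P)%:E).
  by apply/funext => z; rewrite normr_id.
by rewrite /Lpnorm E.
Qed.

Section Lpnorm_phase_measure.
Context {R : realType} (d : nat) (T P : R).
Hypothesis P_gt0 : 0 < P.
Local Notation M := (@PH R d).
Local Notation mu := (phase_measure d).
Local Notation O := (@OM R d T).
Variable h : @phase R d -> R.
Hypothesis mh : measurable_fun O h.

Let I : \bar R := (\int[mu]_(z in O) (`|h z| `^ P)%:E)%E.

Let I0 : (0 <= I)%E.
Proof. by apply: integral_ge0 => z _; rewrite lee_fin powR_ge0. Qed.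

Lemma LpnormE : Lpnorm T P h = (I `^ P^-1)%E.
Proof.
rewrite /Lpnorm (@ge0_OintE _ _ _ (fun z => (`|h z| `^ P)%:E))//.
apply/measurable_EFinP; apply: (measurableT_comp (measurable_powR P)).
exact: measurableT_comp.
Qed.

Lemma Lpnorm_ltyP : (Lpnorm T P h < +oo)%E -> (I < +oo)%E.
Proof. by rewrite LpnormE; apply: lty_poweRy; rewrite invr_eq0 gt_eqF. Qed.

Lemma Lpnorm_leP (A : R) : 0 <= A -> (Lpnorm T P h <= A%:E)%E <-> (I <= (A `^ P)%:E)%E.
Proof.
move=> A0; rewrite LpnormE; split => hA.
- have -> : I = ((I `^ P^-1) `^ P)%E by rewrite -poweRrM mulVf ?gt_eqF// poweRe1.
  rewrite -poweR_EFin; apply: gt0_ler_poweR => //; first exact: ltW.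
  + by rewrite in_itv /= leey andbT poweR_ge0.
  + by rewrite in_itv /= leey andbT lee_fin.
- have -> : A%:E = ((A `^ P)%:E `^ P^-1)%E by rewrite poweR_EFin -powRrM mulfV ?gt_eqF// powRr1.
  apply: gt0_ler_poweR => //; first by rewrite invr_ge0 ltW.
  + by rewrite in_itv /= leey andbT.
  + by rewrite in_itv /= leey andbT lee_fin powR_ge0.
Qed.

End Lpnorm_phase_measure.

Section potentials.
Context {R : realType} (d : nat) (th l : R).
Hypothesis l_ge0 : 0 <= l.
Local Notation M := (@PH R d).
Local Notation mu := (phase_measure d).

Lemma measurable_rpot kap (F : M -> R) : measurable_fun setT F ->
  measurable_fun setT (rpot th l kap F).
Proof.
move=> mF; apply: (@measurable_fun_integral_param _ _ _ M M mu
  (fun p => (F p.2 * (tau p.1 p.2 `^ (kap - 1) * kker th l p.1 p.2))%:E)).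
apply/measurable_EFinP; apply: measurable_funM; first exact: measurableT_comp.
apply: measurable_funM; last exact: measurable_kker.
exact: measurable_tau_powR.
Qed.

Lemma rpot_ge0 kap (F : M -> R) z0 : (forall z, 0 <= F z) -> (0 <= rpot th l kap F z0)%E.
Proof. by move=> F0; apply: integral_ge0 => z _; rewrite lee_fin !mulr_ge0 ?powR_ge0 ?kker_ge0. Qed.

End potentials.

(** Each term is at most the maximum m, and m^q is one of the three powers. *)
Lemma powR_add3 (R : realType) (a b c q : R) : 0 <= a -> 0 <= b -> 0 <= c -> 0 < q ->
  (a + b + c) `^ q <= 3 `^ q * (a `^ q + b `^ q + c `^ q).
Proof.
move=> a0 b0 c0 q0; pose m := Num.max a (Num.max b c).
have [am bm cm] : [/\ a <= m, b <= m & c <= m] by rewrite /m !le_max !lexx !orbT.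
have m0 : 0 <= m by exact: le_trans am.
have pa := powR_ge0 a q; have pb := powR_ge0 b q; have pc := powR_ge0 c q.
apply: (@le_trans _ _ (3 `^ q * m `^ q)).
  by rewrite -powRM//; apply: ge0_ler_powR; rewrite ?nnegrE ?mulr_ge0 ?addr_ge0 ?(ltW q0)//; lra.
rewrite ler_wpM2l ?powR_ge0//.
have [->|[->|->]] : m = a \/ m = b \/ m = c; last 3 first.
- by lra.
- by lra.
- by lra.
rewrite /m; case: (leP b c) => _; case: (leP a _) => _; tauto.
Qed.

(** Each of a, b, c is a summand capped at x. If some cap is active, that term alone is x; otherwise
    all three are the summands themselves. *)
Lemma cap_sum (R : realType) (x a b c : R) (A B C : \bar R) : 0 <= a -> 0 <= b -> 0 <= c ->
  a = x \/ a%:E = A -> b = x \/ b%:E = B -> c = x \/ c%:E = C ->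
  (x%:E <= A + B + C)%E -> x <= a + b + c.
Proof.
move=> a0 b0 c0 [->|<-]; first by lra.
move=> [->|<-]; first by lra.
by move=> [->|<-]; [lra|rewrite -!EFinD lee_fin].
Qed.

(** * From pointwise domination by potentials to the L^q bound *)

Section potential_domination.
Context {R : realType} (d : nat) (th T : R).
Hypotheses (th_gt0 : 0 < th) (th_lt1 : th < 1) (D_gt1 : 1 < hdim d th).
Local Notation M := (@PH R d).
Local Notation mu := (phase_measure d).
Local Notation O := (@OM R d T).
Local Notation N := (hdim d th + 1).

Lemma kker_le (l l' : R) (z0 z : M) : l <= l' -> kker th l z0 z <= kker th l' z0 z.
Proof.
move=> ll'; rewrite /kker ler_wpM2r ?powR_ge0//.
rewrite !indicE; case: (boolP ((z0, z) \in kbox th l)) => [/set_mem [/= h1 h2 h3]|_]; last exact: ler0n.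
rewrite mem_set//; split => //= i.
- by apply: (le_trans (h2 i)); rewrite ler_wpM2r ?powR_ge0.
- by apply: (le_trans (h3 i)); rewrite ler_wpM2r ?powR_ge0.
Qed.

Variables (f : @phase R d -> R).
Hypotheses (fB : borel_meas (OmegaT d T) f) (f_ge0 : forall z, O z -> 0 <= f z)
  (f2 : (\int[mu]_(z in O) (`|f z| `^ 2)%:E < +oo)%E).
Let mO : measurable O := @measurable_OM R d T.
Let mf : measurable_fun O f := borel_measurable fB.
Local Notation F := (ext0 O (f : M -> R)).
Let mF : measurable_fun setT F := measurable_ext0 mO mf.

Let avg (ep : R) (z0 : M) : \bar R := (\int[mu]_z (F z * wker th 8^-1 ep z0 z)%:E)%E.

Let avgE ep z0 : avg ep z0 = (\int[mu]_(z in O) (f z * wker th 8^-1 ep z0 z)%:E)%E.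
Proof. exact: integral_ext0_mul. Qed.

Let avg_ge0 ep z0 : 0 < ep -> (0 <= avg ep z0)%E.
Proof.
move=> ep0; apply: integral_ge0 => z _; rewrite lee_fin; apply: mulr_ge0; first exact: ext0_ge0.
exact: wker_ge0.
Qed.

Let measurable_avg ep : measurable_fun setT (avg ep).
Proof.
apply: (@measurable_fun_integral_param _ _ _ M M mu
  (fun q => (F q.2 * wker th 8^-1 ep q.1 q.2)%:E)).
apply/measurable_EFinP; apply: measurable_funM; first exact: measurableT_comp.
exact: measurable_wker.
Qed.

(** The window of [bump] lies in tau >= ep and has height 1/ep, so the average is at most 1/ep times
    the integral of [tail]. *)
Let avg_lty ep z0 : 0 < ep -> (avg ep z0 < +oo)%E.
Proof.
move=> ep0; rewrite avgE.
have tl := @tail_lty _ d th T f mf f_ge0 f2 z0 D_gt1 ep ep0.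
have mt : measurable_fun O (fun z => (tail th f z0 ep z)%:E).
  by apply/measurable_EFinP; exact: measurable_tail.
have c0 : 0 <= ep^-1 by rewrite invr_ge0 ltW.
apply: (@le_lt_trans _ _ (ep^-1%:E * \int[mu]_(z in O) (tail th f z0 ep z)%:E)%E); last first.
  have tf : (\int[mu]_(z in O) (tail th f z0 ep z)%:E)%E \is a fin_num.
    by rewrite ge0_fin_numE// integral_ge0// => z Oz; rewrite lee_fin (tail_ge0 th f_ge0).
  by rewrite -(fineK tf) -EFinM ltry.
rewrite -ge0_integralZl_EFin//; last by move=> z Oz; rewrite lee_fin (tail_ge0 th f_ge0).
apply: ge0_le_integral => //.
- by move=> z Oz; rewrite lee_fin mulr_ge0 ?f_ge0 ?wker_ge0.
- apply/measurable_EFinP; apply: measurable_funM => //; apply: measurable_funTS.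
  suff : measurable_fun setT ((fun q : M * M => wker th 8^-1 ep q.1 q.2) \o (fun z : M => (z0 : M, z))) by [].
  by apply: measurableT_comp; [exact: measurable_wker|exact: measurable_fun_pair].
- by apply: emeasurable_funM.
move=> z Oz; rewrite -EFinM lee_fin /tail [leRHS]mulrCA; apply: ler_wpM2l; first exact: f_ge0.
rewrite /wker [leRHS]mulrA; apply: ler_pM; [exact: bump_ge0|exact: kker_ge0| |].
  rewrite /bump ler_wpM2l//; have [h|h] := leP ep (tau z0 z).
    by rewrite -natrM ler_nat; case: (_ < _)%R; case: (_ < _)%R.
  by rewrite (_ : (2 * ep < tau z0 z) = false) ?mul0r//; apply/negbTE; rewrite -leNgt; lra.
by apply: kker_le; lra.
Qed.

Variables (p p' s s' r r' q Ka : R) (F1 F2 F3 : M -> R).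
Hypotheses (p_gt1 : 1 < p) (pp' : p^-1 + p'^-1 = 1) (s_gt1 : 1 < s) (ss' : s^-1 + s'^-1 = 1)
  (r_gt1 : 1 < r) (rr' : r^-1 + r'^-1 = 1) (q_gt1 : 1 < q)
  (qp : q^-1 = p^-1 - th / N) (qs : q^-1 = s^-1 - (1 - th) / N) (qr : q^-1 = r^-1 - 1 / N)
  (Ka_gt0 : 0 < Ka).
Hypotheses (mF1 : measurable_fun setT F1) (F1_ge0 : forall z, 0 <= F1 z)
  (F1_le1 : (\int[mu]_z (F1 z `^ p)%:E <= 1)%E).
Hypotheses (mF2 : measurable_fun setT F2) (F2_ge0 : forall z, 0 <= F2 z)
  (F2_le1 : (\int[mu]_z (F2 z `^ s)%:E <= 1)%E).
Hypotheses (mF3 : measurable_fun setT F3) (F3_ge0 : forall z, 0 <= F3 z)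
  (F3_le1 : (\int[mu]_z (F3 z `^ r)%:E <= 1)%E).
Local Notation r1 := (rpot th 3 th F1).
Local Notation r2 := (rpot th 3 (1 - th) F2).
Local Notation r3 := (rpot th 3 1 F3).
Hypothesis dom : forall z0 ep, O z0 -> 0 < ep ->
  (\int[mu]_(z in O) (f z * wker th 8^-1 ep z0 z)%:E <= Ka%:E * (r1 z0 + r2 z0 + r3 z0))%E.

Let HH : R := HLS_const d th 3 p p' th q + HLS_const d th 3 s s' (1 - th) q
  + HLS_const d th 3 r r' 1 q.

Let Y n z0 : R := fine (avg (eps n) z0).
(** A potential may be infinite at some points, whereas [rpot_strong_type] takes a real-valued
    minorant. Capping at Y / Ka gives one and still retains enough to bound Y. *)
Let part n (pot : M -> \bar R) z0 : R := fine (Order.min (Y n z0 / Ka)%:E (pot z0)).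

Let Y0 n z0 : 0 <= Y n z0.
Proof. by apply: fine_ge0; apply: avg_ge0; exact: eps_gt0. Qed.

Let mY n : measurable_fun setT (Y n).
Proof. by apply: (measurableT_comp (@fine_measurable R setT measurableT)); exact: measurable_avg. Qed.

Let mpart n pot : measurable_fun setT pot -> measurable_fun setT (part n pot).
Proof.
move=> mp; apply: (measurableT_comp (@fine_measurable R setT measurableT)); apply: measurable_mine => //.
by apply/measurable_EFinP; apply: measurable_funM.
Qed.

Let part_fin n pot z0 : (0 <= pot z0)%E ->
  Order.min (Y n z0 / Ka)%:E (pot z0) \is a fin_num /\ (0 <= Order.min (Y n z0 / Ka)%:E (pot z0))%E.
Proof.
move=> p0; have h : (0 <= Order.min (Y n z0 / Ka)%:E (pot z0))%E.
  by rewrite le_min p0 lee_fin divr_ge0// ltW.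
split => //; rewrite ge0_fin_numE//.
by apply: (@le_lt_trans _ _ (Y n z0 / Ka)%:E); [rewrite ge_min lexx|exact: ltry].
Qed.

Let part_ge0 n pot z0 : (0 <= pot z0)%E -> 0 <= part n pot z0.
Proof. by move=> /(part_fin n)[_ h]; exact: fine_ge0. Qed.

Let part_le n pot z0 : (0 <= pot z0)%E -> ((part n pot z0)%:E <= pot z0)%E.
Proof. by move=> /(part_fin n)[h _]; rewrite /part fineK// ge_min lexx orbT. Qed.

Let pot1_ge0 z0 : (0 <= r1 z0)%E := rpot_ge0 th 3 th z0 F1_ge0.
Let pot2_ge0 z0 : (0 <= r2 z0)%E := rpot_ge0 th 3 (1 - th) z0 F2_ge0.
Let pot3_ge0 z0 : (0 <= r3 z0)%E := rpot_ge0 th 3 1 z0 F3_ge0.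

Let Y_le n z0 : O z0 -> Y n z0 <= Ka * (part n r1 z0 + part n r2 z0 + part n r3 z0).
Proof.
move=> Oz; have a0 := pot1_ge0 z0; have b0 := pot2_ge0 z0; have c0 := pot3_ge0 z0.
have pa := part_ge0 n a0; have pb := part_ge0 n b0; have pc := part_ge0 n c0.
rewrite mulrC -ler_pdivrMr//.
have cap pot : (0 <= pot z0)%E -> part n pot z0 = Y n z0 / Ka \/ (part n pot z0)%:E = pot z0.
  move=> p0; have [pf _] := part_fin n p0; move: pf; rewrite /part.
  by case: leP => h pf; [left|right; rewrite fineK].
apply: (cap_sum pa pb pc (cap r1 a0) (cap r2 b0) (cap r3 c0)).
have af : avg (eps n) z0 \is a fin_num.
  by rewrite ge0_fin_numE ?avg_ge0 ?avg_lty ?eps_gt0.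
have Ki : (0 <= Ka^-1%:E)%E by rewrite lee_fin invr_ge0 ltW.
rewrite EFinM muleC; apply: (@le_trans _ _ (Ka^-1%:E * (Ka%:E * (r1 z0 + r2 z0 + r3 z0)))%E).
  by apply: (lee_wpmul2l Ki); rewrite /Y fineK// avgE; apply: (dom Oz); exact: eps_gt0.
by rewrite muleA -EFinM mulVf ?gt_eqF// mul1e.
Qed.

Let N_gt0 : 0 < N.
Proof. by have := D_gt1; lra. Qed.

(** Each capped part is a minorant of one potential, and all three potentials reach the same L^q;
    the bound is therefore uniform in n. *)
Let YK n : (\int[mu]_(z0 in O) (Y n z0 `^ q)%:E <= ((3 * Ka) `^ q * HH)%:E)%E.
Proof.
have q0 : 0 < q by exact: lt_trans q_gt1.
have th0 := th_gt0; have th1 := th_lt1.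
pose y1 := part n r1; pose y2 := part n r2; pose y3 := part n r3.
have my1 : measurable_fun setT y1 by apply: mpart; exact: measurable_rpot.
have my2 : measurable_fun setT y2 by apply: mpart; exact: measurable_rpot.
have my3 : measurable_fun setT y3 by apply: mpart; exact: measurable_rpot.
have y10 z : 0 <= y1 z := part_ge0 n (pot1_ge0 z).
have y20 z : 0 <= y2 z := part_ge0 n (pot2_ge0 z).
have y30 z : 0 <= y3 z := part_ge0 n (pot3_ge0 z).
have l3 : 0 < 3 :> R by [].
have s1 : (\int[mu]_z (y1 z `^ q)%:E <= (HLS_const d th 3 p p' th q)%:E)%E.
  apply: (rpot_strong_type l3 p_gt1 pp' th_gt0 q_gt1 N_gt0 qp mF1 F1_ge0 F1_le1 my1 y10) => z.
  exact: (part_le n (pot1_ge0 z)).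
have s2 : (\int[mu]_z (y2 z `^ q)%:E <= (HLS_const d th 3 s s' (1 - th) q)%:E)%E.
  have k0 : 0 < 1 - th by lra.
  apply: (rpot_strong_type l3 s_gt1 ss' k0 q_gt1 N_gt0 qs mF2 F2_ge0 F2_le1 my2 y20) => z.
  exact: (part_le n (pot2_ge0 z)).
have s3 : (\int[mu]_z (y3 z `^ q)%:E <= (HLS_const d th 3 r r' 1 q)%:E)%E.
  apply: (rpot_strong_type l3 r_gt1 rr' ltr01 q_gt1 N_gt0 qr mF3 F3_ge0 F3_le1 my3 y30) => z.
  exact: (part_le n (pot3_ge0 z)).
have Yl z : O z -> Y n z <= Ka * (y1 z + y2 z + y3 z) by exact: Y_le.
clearbody y1 y2 y3.
have mpow (y : M -> R) : measurable_fun setT y -> measurable_fun setT (fun z => (y z `^ q)%:E).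
  by move=> my; apply/measurable_EFinP; exact: (measurableT_comp (measurable_powR q)).
have pow0 (y : M -> R) z : (0 <= (y z `^ q)%:E)%E by rewrite lee_fin powR_ge0.
have m1 := mpow _ my1; have m2 := mpow _ my2; have m3 := mpow _ my3.
apply: (@le_trans _ _ (\int[mu]_z (((3 * Ka) `^ q)%:E *
    ((y1 z `^ q)%:E + (y2 z `^ q)%:E + (y3 z `^ q)%:E)))%E).
  rewrite [leLHS]integral_mkcond; apply: ge0_le_integral => //.
  - by move=> z _; rewrite patchE; case: ifPn.
  - apply: (iffLR (measurable_restrictT _ mO)); apply: measurable_funTS; exact: mpow.
  - by apply: emeasurable_funM => //; apply: emeasurable_funD => //; exact: emeasurable_funD.
  - move=> z _; rewrite patchE; case: ifPn => [/set_mem Oz|_]; last first.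
      by rewrite -!EFinD -EFinM lee_fin mulr_ge0 ?addr_ge0 ?powR_ge0.
    rewrite -!EFinD -EFinM lee_fin.
    apply: (@le_trans _ _ ((Ka * (y1 z + y2 z + y3 z)) `^ q)).
      by apply: ge0_ler_powR; rewrite ?nnegrE ?(ltW q0) ?Y0 ?Yl ?mulr_ge0 ?addr_ge0 ?(ltW Ka_gt0).
    rewrite powRM ?addr_ge0 ?(ltW Ka_gt0)// [(3 * Ka) `^ q]powRM ?(ltW Ka_gt0)//.
    rewrite [X in _ <= X * _]mulrC -[leRHS]mulrA ler_wpM2l ?powR_ge0//.
    exact: powR_add3.
have c0 : 0 <= (3 * Ka) `^ q by exact: powR_ge0.
have m12 := emeasurable_funD m1 m2; have m123 := emeasurable_funD m12 m3.
have p12 z : (0 <= (y1 z `^ q)%:E + (y2 z `^ q)%:E)%E by rewrite adde_ge0.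
have p123 z : (0 <= (y1 z `^ q)%:E + (y2 z `^ q)%:E + (y3 z `^ q)%:E)%E by rewrite adde_ge0.
rewrite ge0_integralZl_EFin//.
rewrite [leRHS]EFinM; apply: lee_wpmul2l; first by rewrite lee_fin.
rewrite ge0_integralD// ge0_integralD// /HH !EFinD.
exact: (leeD (leeD s1 s2) s3).
Qed.

Definition kinetic_const : R :=
  2 `^ q * ((2 / kmass d (8^-1 : R)) `^ q * ((3 * Ka) `^ q * HH)).

Theorem kinetic_bound : (\int[mu]_(z in O) (f z `^ q)%:E <= kinetic_const%:E)%E.
Proof.
have l8 : 0 < 8^-1 :> R by rewrite invr_gt0.
apply: (average_bound l8 th_gt0 q_gt1 f_ge0 mO fB mY Y0 _ YK) => n z0 Oz.
rewrite -avgE /Y fineK// ge0_fin_numE ?avg_ge0 ?avg_lty ?eps_gt0//.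
Qed.

End potential_domination.

(** Equating 1/p - th/N with 1/s - (1 - th)/N for N = x (1 + 2 th) + 1 is a linear equation whose
    solution is th; then N = p (4 x + 2) / (p (2 x + 2) - 4 x), and q and r follow by
    substitution. *)
Lemma kinetic_exponents (R : realType) (x p : R) : 1 <= x ->
  2 - 2 / (3 * x + 2) < p -> p < 2 + 2 / x ->
  let th := (2 * x + 2 - x * p) / (p * (2 * x + 2) - 4 * x) in
  let N := x * (1 + 2 * th) + 1 in
  let q := p * (4 * x + 2) / (x * (p + 2)) in
  let r := p * (4 * x + 2) / (p * (3 * x + 2) - 2 * x) in
  let s := p / (p - 1) in
  [/\ [/\ 0 < th, th < 1 & 1 < x * (1 + 2 * th)], [/\ 1 < p, 1 < s, 1 < r & 1 < q] &
  [/\ q^-1 = p^-1 - th / N, q^-1 = s^-1 - (1 - th) / N & q^-1 = r^-1 - 1 / N]].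
Proof.
move=> x1 hp1 hp2 th N q r s.
have x0 : 0 < x by lra.
have y0 : 0 < 3 * x + 2 by lra.
(* The lower bound on p in the form that amounts to th < 1; [h2] is the upper bound in the form that
   amounts to th > 0. *)
have h1 : 6 * x + 2 < p * (3 * x + 2).
  rewrite [ltLHS](_ : _ = (2 - 2 / (3 * x + 2)) * (3 * x + 2)) ?ltr_pM2r//.
  by rewrite mulrBl mulfVK ?gt_eqF//; lra.
have h2 : x * p < 2 * x + 2.
  by have := hp2; rewrite -ltrBlDl ltr_pdivlMr// mulrBl => h; lra.
have p1 : 1 < p.
  have : 1 * (3 * x + 2) < p * (3 * x + 2) by lra.
  by rewrite ltr_pM2r.
have p0 : 0 < p by lra.
have px : 0 < p * x by rewrite mulr_gt0.
(* After multiplication by 3 x + 2, [h1] reduces this to (6 x + 2)(2 x + 2) > 4 x (3 x + 2). *)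
have D0 : 0 < p * (2 * x + 2) - 4 * x.
  rewrite -(pmulr_lgt0 _ y0) mulrBl.
  have a : (6 * x + 2) * (2 * x + 2) < p * (3 * x + 2) * (2 * x + 2) by rewrite ltr_pM2r//; lra.
  have := mulr_gt0 x0 x0; nra.
have th0 : 0 < th by rewrite divr_gt0//; lra.
have th1 : th < 1 by rewrite ltr_pdivrMr// mul1r; lra.
have xp : 0 < x * (p + 2) by rewrite mulr_gt0//; lra.
have rp : 0 < p * (3 * x + 2) - 2 * x by lra.
have NE : N = p * (4 * x + 2) / (p * (2 * x + 2) - 4 * x).
  by rewrite /N /th; field; rewrite gt_eqF.
have N0 : 0 < N by rewrite NE divr_gt0// mulr_gt0//; lra.
have nz := (gt_eqF p0, gt_eqF D0, gt_eqF xp, gt_eqF rp, gt_eqF x0).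
have c0 : (4 * x + 2 == 0) = false by rewrite gt_eqF//; lra.
have c1 : (p - 1 == 0) = false by rewrite gt_eqF//; lra.
have c2 : (p + 2 == 0) = false by rewrite gt_eqF//; lra.
split; split => //.
- have := mulr_gt0 x0 th0; have := mulr_ge0 (ltW x0) (ltW th0); nra.
- by rewrite ltr_pdivlMr ?subr_gt0// mul1r; lra.
- by rewrite ltr_pdivlMr// mul1r; lra.
- by rewrite ltr_pdivlMr// mul1r; lra.
- by rewrite NE /q /th; field; rewrite ?nz ?c0 ?c1 ?c2.
- by rewrite NE /q /s /th; field; rewrite ?nz ?c0 ?c1 ?c2.
- by rewrite NE /q /r; field; rewrite ?nz ?c0 ?c1 ?c2.
Qed.

(** * Homogeneity: reduction to data of norm at most one *)

Section scaling.
Context {R : realType} (d : nat) (T : R).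
Local Notation M := (@PH R d).
Local Notation mu := (phase_measure d).
Local Notation O := (@OM R d T).

Lemma normalised_le1 (h : M -> R) (P A : R) : 0 < P -> 0 < A -> measurable_fun O h ->
  (forall z, O z -> 0 <= h z) ->
  (\int[mu]_(z in O) (h z `^ P)%:E <= (A `^ P)%:E)%E ->
  (\int[mu]_z (ext0 O (fun z => h z / A) z `^ P)%:E <= 1)%E.
Proof.
move=> P0 A0 mh h0 hA; rewrite integral_ext0_powR//.
have mhP : measurable_fun O (fun z => (h z `^ P)%:E).
  by apply/measurable_EFinP; exact: (measurableT_comp (measurable_powR P)).
have AP : 0 < A `^ P by rewrite powR_gt0.
have -> : (\int[mu]_(z in O) ((h z / A) `^ P)%:E =
    ((A `^ P)^-1)%:E * \int[mu]_(z in O) (h z `^ P)%:E)%E.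
  rewrite -ge0_integralZl_EFin//; last 3 first.
  - exact: measurable_OM.
  - by move=> z Oz; rewrite lee_fin powR_ge0.
  - by rewrite invr_ge0 ltW.
  apply: eq_integral => z /set_mem Oz; rewrite -EFinM powRM ?h0 ?invr_ge0 ?(ltW A0)//.
  by rewrite mulrC -powR_inv1 ?(ltW A0)// -powRrM mulN1r powRN.
apply: (@le_trans _ _ (((A `^ P)^-1)%:E * (A `^ P)%:E)%E).
  by apply: lee_wpmul2l => //; rewrite lee_fin invr_ge0 ltW.
by rewrite -EFinM mulVf ?gt_eqF.
Qed.

Lemma rpot_scale th kap (h : M -> R) (A : R) z0 : 0 < A -> measurable_fun O h ->
  (forall z, O z -> 0 <= h z) ->
  (A%:E * rpot th 3 kap (ext0 O (fun z => h z / A)%R) z0 =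
   \int[mu]_(z in O) (h z * (tau z0 z `^ (kap - 1) * kker th 3 z0 z))%:E)%E.
Proof.
move=> A0 mh h0; rewrite /rpot integral_ext0_mul -ge0_integralZl_EFin//; last 4 first.
- exact: measurable_OM.
- by move=> z Oz; rewrite lee_fin !mulr_ge0 ?h0 ?invr_ge0 ?powR_ge0 ?kker_ge0 ?(ltW A0).
- apply/measurable_EFinP; apply: measurable_funM; first exact: measurable_funM.
  apply: measurable_funM; apply: measurable_funTS; last exact: measurable_kker2.
  by apply: (measurableT_comp (measurable_powR (kap - 1))); exact: measurable_tau2.
- exact: ltW.
apply: eq_integral => z _; rewrite -EFinM; congr EFin.
by move: (_ `^ _ * _) (h z) => w x; field; rewrite gt_eqF.
Qed.

End scaling.

Section scaled_estimate.
Context {R : realType} (d : nat) (th T : R).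
Hypotheses (d_gt0 : (0 < d)%N) (th_gt0 : 0 < th) (th_lt1 : th < 1) (D_gt1 : 1 < hdim d th).
Local Notation M := (@PH R d).
Local Notation mu := (phase_measure d).
Local Notation O := (@OM R d T).
Local Notation N := (hdim d th + 1).
Variables (p s r q : R).
Hypotheses (p_gt1 : 1 < p) (s_gt1 : 1 < s) (r_gt1 : 1 < r) (q_gt1 : 1 < q)
  (ps : p^-1 + s^-1 = 1)
  (qp : q^-1 = p^-1 - th / N) (qs : q^-1 = s^-1 - (1 - th) / N) (qr : q^-1 = r^-1 - 1 / N).
Variables (f : @phase R d -> R) (G S0 : @phase R d -> 'rV[R]_d) (S1 : @phase R d -> R).
Hypotheses (f_ge0 : forall z, OmegaT d T z -> 0 <= f z) (f2 : inLp T 2 f)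
  (Gp : inLp_vec T p G) (wG : weak_grad_v T f G) (S0s : inLp_vec T s S0) (S1r : inLp T r S1)
  (wS : weak_subsol T f S0 S1).
Variable A : R.
Hypotheses (A_gt0 : 0 < A) (GA : (Lpnorm_vec T p G <= A%:E)%E)
  (S0A : (Lpnorm_vec T s S0 <= A%:E)%E) (S1A : (Lpnorm T r S1 <= A%:E)%E).

Let mO : measurable O := @measurable_OM R d T.
Let mf : measurable_fun O f := borel_measurable f2.1.
Let mG i : measurable_fun O (fun z : M => G z ord0 i) := borel_measurable (Gp.1 i).
Let mS0 i : measurable_fun O (fun z : M => S0 z ord0 i) := borel_measurable (S0s.1 i).
Let mS1 : measurable_fun O S1 := borel_measurable S1r.1.
Let meG : measurable_fun O (fun z : M => eucl (G z)) := measurable_eucl mG.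
Let meS0 : measurable_fun O (fun z : M => eucl (S0 z)) := measurable_eucl mS0.
Let maS1 : measurable_fun O (fun z : M => `|S1 z|).
Proof. exact: measurableT_comp. Qed.
Let p_gt0 : 0 < p. Proof. exact: lt_trans p_gt1. Qed.
Let s_gt0 : 0 < s. Proof. exact: lt_trans s_gt1. Qed.
Let r_gt0 : 0 < r. Proof. exact: lt_trans r_gt1. Qed.
Let q_gt0 : 0 < q. Proof. exact: lt_trans q_gt1. Qed.

Let coord_lty (P : R) (H : @phase R d -> 'rV[R]_d) i : 0 < P ->
  (forall i, measurable_fun O (fun z : M => H z ord0 i)) ->
  (Lpnorm_vec T P H < +oo)%E -> (\int[mu]_(z in O) (`|H z ord0 i| `^ P)%:E < +oo)%E.
Proof.
move=> P0 mH /(Lpnorm_ltyP P0 (measurable_eucl mH)); apply: le_lt_trans.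
apply: ge0_le_integral => //.
- apply/measurable_EFinP; apply: (measurableT_comp (measurable_powR P)).
  by apply: measurableT_comp => //; exact: mH.
- apply/measurable_EFinP; apply: (measurableT_comp (measurable_powR P)).
  by apply: measurableT_comp => //; exact: measurable_eucl.
- move=> z _; rewrite lee_fin; apply: ge0_ler_powR; rewrite ?nnegrE ?(ltW P0)//.
  by apply: (le_trans (coord_le_eucl _ _)); exact: ler_norm.
Qed.

Let F1 : M -> R := ext0 O (fun z => eucl (G z) / A).
Let F2 : M -> R := ext0 O (fun z => eucl (S0 z) / A).
Let F3 : M -> R := ext0 O (fun z => `|S1 z| / A).
Let f' (z : @phase R d) : R := f z / A.

Let mdivA (h : M -> R) : measurable_fun O h -> measurable_fun O (fun z => h z / A).
Proof. by move=> mh; apply: measurable_funM. Qed.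

Let divA_ge0 (h : M -> R) : (forall z, O z -> 0 <= h z) -> forall z, O z -> 0 <= h z / A.
Proof. by move=> h0 z Oz; rewrite divr_ge0 ?h0 ?(ltW A_gt0). Qed.

Let abs_normE (h : M -> R) (P : R) : (forall z, O z -> 0 <= h z) ->
  (\int[mu]_(z in O) (`|h z| `^ P)%:E = \int[mu]_(z in O) (h z `^ P)%:E)%E.
Proof. by move=> h0; apply: eq_integral => z /set_mem Oz; rewrite ger0_norm ?h0. Qed.

Let F_le1 (h : M -> R) (P : R) : 0 < P -> measurable_fun O h -> (forall z, O z -> 0 <= h z) ->
  (Lpnorm T P (h : @phase R d -> R) <= A%:E)%E ->
  (\int[mu]_z (ext0 O (fun z => h z / A) z `^ P)%:E <= 1)%E.
Proof.
move=> P0 mh h0 /(Lpnorm_leP P0 mh (ltW A_gt0)); rewrite abs_normE// => hA.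
exact: normalised_le1.
Qed.

(** Coordinate sums cost a factor d against the Euclidean norm; for the S1-term the common factor is
    harmless because d >= 1. *)
Let rho_le z0 z : O z -> rho th G S0 S1 z0 z <= d%:R *
  (eucl (G z) * (tau z0 z `^ (th - 1) * kker th 3 z0 z) +
   eucl (S0 z) * (tau z0 z `^ (1 - th - 1) * kker th 3 z0 z) +
   `|S1 z| * (tau z0 z `^ (1 - 1) * kker th 3 z0 z)).
Proof.
move=> _; have d1 : 1 <= d%:R :> R by rewrite ler1n.
have -> : 1 - th - 1 = - th by ring.
rewrite subrr powRr0 mul1r !mulrDr /rho.
have k0 := kker_ge0 th 3 z0 z.
apply: lerD; first apply: lerD.
- by rewrite [leRHS]mulrA ler_wpM2r ?sum_coord_le_eucl// mulr_ge0 ?powR_ge0.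
- by rewrite [leRHS]mulrA ler_wpM2r ?sum_coord_le_eucl// mulr_ge0 ?powR_ge0.
- by rewrite ler_peMl// mulr_ge0.
Qed.

(** [cbd ^+ d] comes from the upper bounds on the test functions, [cgam ^+ d.+1] from d lower bounds
    on [gam] and one on the slope of [chi], and d from the coordinate sums. *)
Let Ka : R := cbd ^+ d / cgam ^+ d.+1 * d%:R.

Let Ka_gt0 : 0 < Ka.
Proof. by rewrite !mulr_gt0 ?invr_gt0 ?exprn_gt0 ?cgam_gt0 ?ltr0n. Qed.

Let f2' : (\int[mu]_(z in O) (`|f z| `^ 2)%:E < +oo)%E.
Proof. exact: (Lpnorm_ltyP (ltr0n _ 2) mf f2.2). Qed.

Local Notation r1 := (rpot th 3 th F1).
Local Notation r2 := (rpot th 3 (1 - th) F2).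
Local Notation r3 := (rpot th 3 1 F3).

Let sum_pot (z0 : M) : (\int[mu]_(z in O) (rho th G S0 S1 z0 z)%:E <=
  (d%:R * A)%:E * (r1 z0 + r2 z0 + r3 z0))%E.
Proof.
have e0 z : O z -> 0 <= eucl (G z) by move=> _; exact: eucl_ge0.
have e1 z : O z -> 0 <= eucl (S0 z) by move=> _; exact: eucl_ge0.
have e2 z : O z -> 0 <= `|S1 z| by [].
have pot0 F kap : (forall z, 0 <= F z) -> (0 <= rpot th 3 kap F z0)%E := rpot_ge0 th 3 kap z0 (F:=F).
have F10 z : 0 <= F1 z by apply: ext0_ge0; exact: divA_ge0.
have F20 z : 0 <= F2 z by apply: ext0_ge0; exact: divA_ge0.
have F30 z : 0 <= F3 z by apply: ext0_ge0; exact: divA_ge0.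
have p1 := pot0 F1 th F10; have p2 := pot0 F2 (1 - th) F20; have p3 := pot0 F3 1 F30.
have -> : ((d%:R * A)%:E * (r1 z0 + r2 z0 + r3 z0) =
    d%:R%:E * (A%:E * r1 z0 + A%:E * r2 z0 + A%:E * r3 z0))%E.
  by rewrite [(d%:R * A)%:E]EFinM -muleA (ge0_muleDr _ (adde_ge0 p1 p2) p3) (ge0_muleDr _ p1 p2).
rewrite [X in (_ * (X + _ + _))%E](rpot_scale th th z0 A_gt0 meG e0).
rewrite [X in (_ * (_ + X + _))%E](rpot_scale th (1 - th) z0 A_gt0 meS0 e1).
rewrite [X in (_ * (_ + _ + X))%E](rpot_scale th 1 z0 A_gt0 maS1 e2).
have mk kap (h : M -> R) : measurable_fun O h ->
    measurable_fun O (fun z => (h z * (tau z0 z `^ (kap - 1) * kker th 3 z0 z))%:E).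
  move=> mh; apply/measurable_EFinP; apply: measurable_funM => //.
  apply: measurable_funM; apply: measurable_funTS; last exact: measurable_kker2.
  by apply: (measurableT_comp (measurable_powR (kap - 1))); exact: measurable_tau2.
have k0 kap (h : M -> R) : (forall z, O z -> 0 <= h z) ->
    forall z, O z -> (0 <= (h z * (tau z0 z `^ (kap - 1) * kker th 3 z0 z))%:E)%E.
  by move=> h0 z Oz; rewrite lee_fin !mulr_ge0 ?h0 ?powR_ge0 ?kker_ge0.
have m1 := mk th _ meG; have m2 := mk (1 - th) _ meS0; have m3 := mk 1 _ maS1.
have n1 := k0 th _ e0; have n2 := k0 (1 - th) _ e1; have n3 := k0 1 _ e2.
have m12 := emeasurable_funD m1 m2; have m123 := emeasurable_funD m12 m3.
rewrite -ge0_integralD// -ge0_integralD//; last first.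
  by move=> z Oz; apply: adde_ge0; [exact: n1|exact: n2].
rewrite -ge0_integralZl_EFin//; last first.
  by move=> z Oz; apply: adde_ge0; [apply: adde_ge0; [exact: n1|exact: n2]|exact: n3].
apply: ge0_le_integral => //.
- by move=> z _; rewrite lee_fin rho_ge0.
- by apply/measurable_EFinP; exact: measurable_rho.
- exact: emeasurable_funM.
- by move=> z Oz; rewrite -!EFinD -EFinM lee_fin; exact: rho_le.
Qed.

Let wker_meas (z0 : M) ep : measurable_fun O (fun z => wker th 8^-1 ep z0 z).
Proof.
apply: measurable_funTS.
suff : measurable_fun setT ((fun w : M * M => wker th 8^-1 ep w.1 w.2) \o (fun z : M => (z0 : M, z))) by [].
by apply: measurableT_comp; [exact: measurable_wker|exact: measurable_fun_pair].
Qed.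

Let dom (z0 : M) (ep : R) : O z0 -> 0 < ep ->
  (\int[mu]_(z in O) (f' z * wker th 8^-1 ep z0 z)%:E <= Ka%:E * (r1 z0 + r2 z0 + r3 z0))%E.
Proof.
move=> Oz ep0; have cg0 : 0 < cgam ^+ d.+1 :> R by rewrite exprn_gt0// cgam_gt0.
have cb0 : 0 <= cbd ^+ d :> R by rewrite exprn_ge0// cbd_ge0.
have c0 : 0 <= (cgam ^+ d.+1 * A)^-1 by rewrite invr_ge0 mulr_ge0 ?(ltW cg0) ?(ltW A_gt0).
have GP i := coord_lty i p_gt0 mG Gp.2.
have SP i := coord_lty i s_gt0 mS0 S0s.2.
have S1P := Lpnorm_ltyP r_gt0 mS1 S1r.2.
have key := average_le_potentials th_gt0 (ltW th_lt1) (ltW p_gt1) (ltW s_gt1) (ltW r_gt1)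
  mf f_ge0 f2' mG GP mS0 SP mS1 S1P wG wS Oz D_gt1 ep0.
have mfw : measurable_fun O (fun z => (f z * wker th 8^-1 ep z0 z)%:E).
  by apply/measurable_EFinP; apply: measurable_funM; [exact: mf|exact: wker_meas].
have -> : (\int[mu]_(z in O) (f' z * wker th 8^-1 ep z0 z)%:E =
   ((cgam ^+ d.+1 * A)^-1)%:E *
    ((cgam ^+ d.+1)%:E * \int[mu]_(z in O) (f z * wker th 8^-1 ep z0 z)%:E))%E.
  rewrite muleA -EFinM -ge0_integralZl_EFin//; last 2 first.
  - by move=> z Oz'; rewrite lee_fin mulr_ge0 ?f_ge0 ?wker_ge0.
  - by rewrite mulr_ge0// ltW.
  apply: eq_integral => z _; rewrite -EFinM; congr EFin; rewrite /f'.
  move: (wker _ _ _ _ _) (f z) => w x; field; by rewrite !gt_eqF.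
apply: (@le_trans _ _ (((cgam ^+ d.+1 * A)^-1)%:E *
    ((cbd ^+ d)%:E * ((d%:R * A)%:E * (r1 z0 + r2 z0 + r3 z0))))%E).
  apply: lee_wpmul2l; first by rewrite lee_fin.
  apply: (le_trans key); apply: lee_wpmul2l; first by rewrite lee_fin.
  exact: sum_pot.
have KaE : (cgam ^+ d.+1 * A)^-1 * cbd ^+ d * (d%:R * A) = Ka.
  rewrite /Ka; move: (cgam ^+ d.+1) (cbd ^+ d) (d%:R : R) cg0 => c b x c_gt0.
  by field; rewrite !gt_eqF.
by rewrite !muleA -!EFinM KaE.
Qed.

Lemma borel_f' : borel_meas (OmegaT d T) f'.
Proof.
move=> B mB; have mB' : measurable ((fun x : R => x / A) @^-1` B).
  rewrite -[X in measurable X]setTI.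
  by apply: (measurable_funM (@measurable_id _ R setT) (@measurable_cst _ _ _ _ setT A^-1)).
have := f2.1 _ mB'; congr (<<s open >> _).
Qed.

(** The hypotheses are homogeneous: after division by A all three sources have norm at most 1,
    [kinetic_bound] applies to f / A, and the power A^q is restored at the end. *)
Lemma scaled_estimate :
  (Lpnorm T q f <= (kinetic_const d th p s s p r (r / (r - 1)) q Ka `^ q^-1 * A)%:E)%E.
Proof.
set Kc := kinetic_const _ _ _ _ _ _ _ _ _ _.
have sp : s^-1 + p^-1 = 1 by rewrite addrC.
have rr : r^-1 + (r / (r - 1))^-1 = 1.
  have r1 : r - 1 != 0 by rewrite subr_eq0 gt_eqF.
  by field; rewrite r1 gt_eqF.
have f'0 z : O z -> 0 <= f' z by apply: divA_ge0.
have mf' : measurable_fun O f' by exact: mdivA.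
have e0 z : O z -> 0 <= eucl (G z) by move=> _; exact: eucl_ge0.
have e1 z : O z -> 0 <= eucl (S0 z) by move=> _; exact: eucl_ge0.
have e2 z : O z -> 0 <= `|S1 z| by [].
have f'2 : (\int[mu]_(z in O) (`|f' z| `^ 2)%:E < +oo)%E.
  have -> : (\int[mu]_(z in O) (`|f' z| `^ 2)%:E =
      ((A^-1) `^ 2)%:E * \int[mu]_(z in O) (`|f z| `^ 2)%:E)%E.
    have mfP : measurable_fun O (fun z => (`|f z| `^ 2)%:E).
      apply/measurable_EFinP; apply: (measurableT_comp (measurable_powR 2)).
      by apply: measurableT_comp => //; exact: mf.
    have AP : 0 <= A^-1 `^ 2 by exact: powR_ge0.
    rewrite -ge0_integralZl_EFin//.
    apply: eq_integral => z _; rewrite -EFinM; congr EFin.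
    by rewrite /f' normrM powRM// mulrC ger0_norm// invr_ge0 ltW.
  have fin : (\int[mu]_(z in O) (`|f z| `^ 2)%:E)%E \is a fin_num.
    by rewrite ge0_fin_numE ?f2'//; apply: integral_ge0 => z _; rewrite lee_fin powR_ge0.
  by rewrite -(fineK fin) -EFinM ltry.
have S1abs : (Lpnorm T r (fun z : @phase R d => `|S1 z|%R) <= A%:E)%E.
  by rewrite Lpnorm_normr; exact: S1A.
have := kinetic_bound th_gt0 th_lt1 D_gt1 borel_f' f'0 f'2 p_gt1 ps s_gt1 sp r_gt1 rr q_gt1
  qp qs qr Ka_gt0
  (measurable_ext0 mO (mdivA meG)) (fun z => ext0_ge0 z (divA_ge0 e0)) (F_le1 p_gt0 meG e0 GA)
  (measurable_ext0 mO (mdivA meS0)) (fun z => ext0_ge0 z (divA_ge0 e1)) (F_le1 s_gt0 meS0 e1 S0A)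
  (measurable_ext0 mO (mdivA maS1)) (fun z => ext0_ge0 z (divA_ge0 e2)) (F_le1 r_gt0 maS1 e2 S1abs)
  dom.
rewrite -/Kc => kb.
have Kc0 : 0 <= Kc.
  rewrite -lee_fin; apply: le_trans kb; apply: integral_ge0 => z _; by rewrite lee_fin powR_ge0.
have C0 : 0 <= Kc `^ q^-1 * A by rewrite mulr_ge0 ?powR_ge0 ?ltW.
apply/(Lpnorm_leP q_gt0 mf C0).
rewrite powRM ?powR_ge0 ?(ltW A_gt0)// -powRrM mulVf ?gt_eqF// powRr1//.
apply: (@le_trans _ _ ((A `^ q)%:E * \int[mu]_(z in O) (f' z `^ q)%:E)%E); last first.
  by rewrite mulrC EFinM; apply: lee_wpmul2l => //; rewrite lee_fin powR_ge0.
rewrite -ge0_integralZl_EFin ?powR_ge0//; last 2 first.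
- by move=> z _; rewrite lee_fin powR_ge0.
- by apply/measurable_EFinP; exact: (measurableT_comp (measurable_powR q)).
rewrite le_eqVlt; apply/orP; left; apply/eqP; apply: eq_integral => z /set_mem Oz.
have f0 := f_ge0 Oz; rewrite -EFinM /f' -powRM ?(ltW A_gt0) ?divr_ge0 ?(ltW A_gt0)//.
by rewrite mulrCA mulfV ?gt_eqF// mulr1 ger0_norm.
Qed.

End scaled_estimate.

Lemma Lpnorm_ge0 (R : realType) (d : nat) (T P : R) (h : @phase R d -> R) : (0 <= Lpnorm T P h)%E.
Proof. exact: poweR_ge0. Qed.

Theorem theorem3p2 (R : realType) (d : nat) (p : R) :
  (0 < d)%N ->
  2 - 2 / (3 * d%:R + 2) < p -> p < 2 + 2 / d%:R ->
  let q := p * (4 * d%:R + 2) / (d%:R * (p + 2)) in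
  let r := p * (4 * d%:R + 2) / (p * (3 * d%:R + 2) - 2 * d%:R) in
  exists C : R, 0 < C /\
  forall (T : R), 0 < T ->
  forall (f : @phase R d -> R) (G : @phase R d -> 'rV[R]_d)
         (S0 : @phase R d -> 'rV[R]_d) (S1 : @phase R d -> R),
    (forall z, OmegaT d T z -> 0 <= f z) ->
    inLp T 2 f ->
    inLp_vec T p G -> weak_grad_v T f G ->
    inLp_vec T (p / (p - 1)) S0 ->
    inLp T r S1 ->
    weak_subsol T f S0 S1 ->
    (Lpnorm T q f <=
       C%:E * (Lpnorm_vec T p G + Lpnorm_vec T (p / (p - 1)) S0 + Lpnorm T r S1))%E.
Proof.
move=> d0 hp1 hp2 q r.
have x1 : 1 <= d%:R :> R by rewrite ler1n.
have [[th0 th1 D1] [p1 s1 r1 q1] [qp qs qr]] := kinetic_exponents x1 hp1 hp2.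
move: th0 th1 D1 s1 r1 q1 qp qs qr; rewrite -/q -/r.
set th := (_ / (_ - 4 * _)); set s := p / (p - 1) => th0 th1 D1 s1 r1 q1 qp qs qr.
have ps : p^-1 + s^-1 = 1.
  have h1 : p - 1 != 0 by rewrite subr_eq0 gt_eqF.
  by rewrite /s; field; rewrite h1 gt_eqF// (lt_trans _ p1).
pose K := kinetic_const d th p s s p r (r / (r - 1)) q (cbd ^+ d / cgam ^+ d.+1 * d%:R) `^ q^-1.
have K0 : 0 <= K by exact: powR_ge0.
have K1 : 0 < K + 1 by rewrite ltr_wpDl.
(* [K] is only known to be nonnegative, so 1 is added to obtain a positive constant. *)
exists (K + 1); split => // T T0 f G S0 S1 f0 f2 Gp wG S0s S1r wS.
set a := Lpnorm_vec T p G; set b := Lpnorm_vec T s S0; set c := Lpnorm T r S1.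
have a0 : (0 <= a)%E by exact: Lpnorm_ge0.
have b0 : (0 <= b)%E by exact: Lpnorm_ge0.
have c0 : (0 <= c)%E by exact: Lpnorm_ge0.
have af : a \is a fin_num by rewrite ge0_fin_numE//; exact: Gp.2.
have bf : b \is a fin_num by rewrite ge0_fin_numE//; exact: S0s.2.
have cf : c \is a fin_num by rewrite ge0_fin_numE//; exact: S1r.2.
apply/lee_addgt0Pr => e e0.
(* Normalisation divides by A, which must be positive even when all three norms vanish; the extra
   term costs e after multiplication by K + 1. *)
pose A := fine a + fine b + fine c + e / (K + 1).
have eK : 0 < e / (K + 1) by exact: divr_gt0.
have [fa fb fc] : [/\ 0 <= fine a, 0 <= fine b & 0 <= fine c] by split; exact: fine_ge0.
have A0 : 0 < A by rewrite /A; lra.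
have aA : (a <= A%:E)%E by rewrite -(fineK af) lee_fin /A; lra.
have bA : (b <= A%:E)%E by rewrite -(fineK bf) lee_fin /A; lra.
have cA : (c <= A%:E)%E by rewrite -(fineK cf) lee_fin /A; lra.
apply: (le_trans (scaled_estimate d0 th0 th1 D1 p1 s1 r1 q1 ps qp qs qr
  f0 f2 Gp wG S0s S1r wS A0 aA bA cA)).
rewrite -/K -(fineK af) -(fineK bf) -(fineK cf) -(EFinD (fine a)) -(EFinD (fine a + fine b)) -EFinM -EFinD lee_fin.
have -> : (K + 1) * (fine a + fine b + fine c) + e = (K + 1) * A.
  by rewrite /A; move: (fine a) (fine b) (fine c) => x y z; field; rewrite gt_eqF.
by rewrite ler_wpM2r ?(ltW A0)//; lra.
Qed.
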